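(* Let $\lambda_1^*,\lambda_2^*,\mu_1^*,\mu_2^*,\omega_1^2,\omega_2^2>0$, $\eta_1>0$, $p\in[0,1]$, and set $\beta_i=\lambda_i^*-\mu_i^*$. If $\eta_2=0$ and $y\in\mathbb{R}^+$, then for $t>0$ the first-passage-time density $k(0,t|y)=\frac{d}{dt}\mathbb{P}(\mathcal{T}_y<t)$ can be expressed as $$k(0,t|y)=p\,e^{-\eta_1t}\,\widehat g^{(1)}(0,t|y)+(1-p)\,\widehat g^{(2)}(0,t|y)+\eta_1p\int_0^{+\infty}dz\int_0^te^{-\eta_1\tau}\,\widehat\alpha^{(1)}(z,\tau|y)\,\widehat g^{(2)}(0,t-\tau|z)\,d\tau,$$ where, for $i=1,2$ and $t>0$, $$\widehat g^{(i)}(0,t|y)=\frac{y}{\sqrt{2\pi\omega_i^2t^3}}\exp\biggl\{-\frac{(y+\beta_it)^2}{2\omega_i^2t}\biggr\},$$ $$\widehat\alpha^{(i)}(x,t|y)=\frac{1}{\sqrt{2\pi\omega_i^2t}}\Biggl[\exp\biggl\{-\frac{(x-y-\beta_it)^2}{2\omega_i^2t}\biggr\}-\exp\biggl\{-\frac{2\beta_iy}{\omega_i^2}\biggr\}\exp\biggl\{-\frac{(x+y-\beta_it)^2}{2\omega_i^2t}\biggr\}\Biggr].$$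
   Context: $\mathbb R^+=(0,\infty)$, $\mathbb R_0^+=[0,\infty)$. $\{{\bf X}(t)=[X(t),\mathscr{E}(t)],\,t\ge0\}$ is the alternating Wiener process with state space $\mathbb{R}^+_0\times\{1,2\}$ in the case $\eta_2=0$: the environment $\mathscr{E}(t)$ switches from $1$ to $2$ at rate $\eta_1$ and never from $2$ to $1$, and while $\mathscr{E}(t)=i$ the component $X(t)$ evolves as a Wiener process with drift $\lambda_i^*-\mu_i^*$ and infinitesimal variance $\omega_i^2$, with a reflecting boundary at $0$. The initial state is $(y,1)$ with probability $p$ and $(y,2)$ with probability $1-p$, $y>0$. The first-passage time through zero is $\mathcal{T}_y=\inf\{t>0:{\bf X}(t)=(0,1)\text{ or }{\bf X}(t)=(0,2)\}$. Equivalently, $\mathbb{P}(\mathcal{T}_y<t)=1-\int_0^\infty[h_1(x,t|y)+h_2(x,t|y)]\,dx$, where $h_i(x,t|y)$ is the density on $\{x>0,\ \mathscr{E}(t)=i\}$ of the same process absorbed at $0$. For the Wiener process with drift $\beta_i$ and infinitesimal variance $\omega_i^2$, $\widehat g^{(i)}(0,t|y)$ is the first-passage-time density from $y$ to $0$, and $\widehat\alpha^{(i)}(x,t|y)$ is the transition density with an absorbing boundary at $0$. *)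

(* Defs.v *)
(* MathComp-Analysis; time is indexed by [R] and only nonnegative times are
   ever constrained or used. *)
From HB Require Import structures.
From mathcomp Require Import all_boot all_order all_algebra.
From mathcomp Require Import all_classical all_reals all_analysis.

Set Implicit Arguments.
Unset Strict Implicit.
Unset Printing Implicit Defensive.

Import Order.TTheory GRing.Theory Num.Theory.
Import numFieldNormedType.Exports.

Local Open Scope classical_set_scope.
Local Open Scope ring_scope.

Inductive env : Set := env1 | env2.

(* [q t i j] is a probability of moving from [i] to [j] in time [t]; off the
   diagonal, [q h i j = eta i * h + o(h)] as [h] decreases to [0], so [eta i]
   is the rate of leaving [i]. *)
Record transition_function (R : realType) (eta : env -> R)
    (q : R -> env -> env -> R) : Prop := TransitionFunction {
  transition_ge0 : forall (t : R) i j, 0 <= t -> 0 <= q t i j ;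
  transition_sum1 : forall (t : R) i, 0 <= t -> q t i env1 + q t i env2 = 1 ;
  transition_id : forall i, q 0 i i = 1 ;
  transition_semigroup : forall (s t : R) i j, 0 <= s -> 0 <= t ->
    q (s + t) i j = q s i env1 * q t env1 j + q s i env2 * q t env2 j ;
  transition_rate : forall i j, i <> j -> q h i j / h @[h --> 0^'+] --> eta i }.

(* Time-homogeneous Markov chain with leaving rates [eta], started in [env1]
   with probability [p], with cadlag (hence piecewise constant) paths. *)
Record environment_process d (T : measurableType d) (R : realType)
    (P : probability T R) (eta : env -> R) (p : R) (E : R -> T -> env) : Prop :=
  EnvironmentProcess {
  environment_measurable : forall (t : R) i, 0 <= t -> measurable [set w | E t w = i] ;
  environment_right : forall (t : R) w, 0 <= t -> \forall s \near t^'+, E s w = E t w ;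
  environment_left : forall (t : R) w, 0 < t ->
    exists i, \forall s \near t^'-, E s w = i ;
  environment_law : exists2 q, transition_function eta q &
    forall (n : nat) (t : nat -> R) (e : nat -> env),
      t 0%N = 0 -> (forall k, t k <= t k.+1) ->
      P [set w | forall k, (k <= n)%N -> E (t k) w = e k] =
      ((if e 0%N is env1 then p else 1 - p) *
       \prod_(k < n) q (t k.+1 - t k) (e k) (e k.+1))%:E }.

(* Wiener process from [0] with drift [b] and infinitesimal variance
   [omega ^+ 2]; the second parameter of [normal_prob] is a standard
   deviation, which enters only through its square. *)
Record wiener_process d (T : measurableType d) (R : realType)
    (P : probability T R) (b omega : R) (W : R -> T -> R) : Prop :=
  WienerProcess {
  wiener_measurable : forall t : R, 0 <= t -> measurable_fun setT (W t) ;
  wiener_start : forall w, W 0 w = 0 ;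
  wiener_continuous : forall w,
    {within `[0, +oo[, continuous (fun t => W t w)} ;
  wiener_increment : forall (s t : R) (B : set R), 0 <= s -> s < t -> measurable B ->
    P [set w | B (W t w - W s w)] =
    normal_prob (b * (t - s)) (omega * Num.sqrt (t - s)) B ;
  wiener_independent : forall (n : nat) (t : nat -> R) (B : nat -> set R),
    0 <= t 0%N -> (forall k, t k <= t k.+1) -> (forall k, measurable (B k)) ->
    P [set w | forall k, (k < n)%N -> B k (W (t k.+1) w - W (t k) w)] =
    (\prod_(k < n) P [set w | B k (W (t k.+1) w - W (t k) w)%R])%E }.

Definition env_sigma (T : Type) (R : realType)
    (E : R -> T -> env) : set (set T) :=
  <<s [set A | exists (t : R) i, 0 <= t /\ A = [set w | E t w = i]] >>.

Definition process_sigma (T : Type) (R : realType)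
    (W : R -> T -> R) : set (set T) :=
  <<s [set A | exists (t : R) (B : set R), [/\ 0 <= t, measurable B & A = W t @^-1` B]] >>.

(* Pairwise independence is included, by taking one of the events to be
   [setT]. *)
Definition independent3 d (T : measurableType d) (R : realType)
    (P : probability T R) (F G H : set (set T)) : Prop :=
  forall A B C, F A -> G B -> H C ->
    P (A `&` B `&` C) = (P A * P B * P C)%E.

Definition occupation_time (T : Type) (R : realType) (E : R -> T -> env)
    (i : env) (t : R) (w : T) : R :=
  fine (lebesgue_measure [set s : R | 0 <= s <= t /\ E s w = i]).

(* [x] is the path [z] reflected upwards at [0] (Skorokhod problem): the
   regulator [l] grows only while [x] is at [0]. *)
Record reflected_path (R : realType) (z x l : R -> R) : Prop := ReflectedPath {
  reflected_decomposition : forall t : R, 0 <= t -> x t = z t + l t ;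
  reflected_ge0 : forall t : R, 0 <= t -> 0 <= x t ;
  regulator_start : l 0 = 0 ;
  regulator_continuous : {within `[0, +oo[, continuous l} ;
  regulator_nondecreasing : forall s t : R, 0 <= s -> s <= t -> l s <= l t ;
  regulator_support : forall s t : R, 0 <= s -> s <= t ->
    (forall u : R, s <= u <= t -> 0 < x u) -> l s = l t }.

(* Each Wiener process [W i] is run with the clock [occupation_time E i], which
   advances at unit speed while the environment is [i] and is stopped
   otherwise: while the environment is [i], the free path moves as [W i]. *)
Definition alternating_wiener_process d (T : measurableType d) (R : realType)
    (P : probability T R) (lambda mu omega eta : env -> R) (p y : R)
    (X : R -> T -> R) (E : R -> T -> env) : Prop :=
  exists (W : env -> R -> T -> R) (L : R -> T -> R),
    [/\ environment_process P eta p E,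
        forall i, wiener_process P (lambda i - mu i) (omega i) (W i),
        independent3 P (env_sigma E)
          (process_sigma (W env1)) (process_sigma (W env2)) &
        forall w, reflected_path
          (fun t => y + W env1 (occupation_time E env1 t w) w
                      + W env2 (occupation_time E env2 t w) w)
          (fun t => X t w) (fun t => L t w)].

Definition first_passage_time (T : Type) (R : realType)
    (X : R -> T -> R) (E : R -> T -> env) (w : T) : \bar R :=
  ereal_inf [set t%:E | t in [set t : R | 0 < t /\
    ((X t w, E t w) = (0, env1) \/ (X t w, E t w) = (0, env2))]].

Definition first_passage_cdf d (T : measurableType d) (R : realType)
    (P : probability T R) (X : R -> T -> R) (E : R -> T -> env) (t : R) : R :=
  fine (P [set w | (first_passage_time X E w < t%:E)%E]).

Definition g_hat (R : realType) (beta omega t y : R) : R :=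
  y / Num.sqrt (2 * pi * omega ^+ 2 * t ^+ 3) *
  expR (- ((y + beta * t) ^+ 2 / (2 * omega ^+ 2 * t))).

Definition alpha_hat (R : realType) (beta omega x t y : R) : R :=
  (Num.sqrt (2 * pi * omega ^+ 2 * t))^-1 *
  (expR (- ((x - y - beta * t) ^+ 2 / (2 * omega ^+ 2 * t))) -
   expR (- (2 * beta * y / omega ^+ 2)) *
   expR (- ((x + y - beta * t) ^+ 2 / (2 * omega ^+ 2 * t)))).

(* Main.v *)
(* The reflected path X first reaches 0 exactly when the free path
   z(u) = y + W1(occ1(u)) + W2(occ2(u)) first does, since its regulator vanishes
   until then.  As environment 2 is absorbing, almost surely occ1(u) = min(u, S)
   and occ2(u) = u - min(u, S), where S = occ1(t) has an exponential law censored
   at t and is independent of W1 and W2.  Conditionally on S = s, the law of z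
   killed at 0 is given by the absorbed kernels alpha_hat: sampling a Wiener path
   on a grid, the Chapman-Kolmogorov equation bounds the discretised killed
   expectation from below, and raising the path by a small e bounds it from above
   up to an error that vanishes with the mesh.  Hence P(T_y >= t) is
   (1-p) G2(t,y) + p exp(-eta t) G1(t,y) + p \int_0^t eta exp(-eta s) phi_s ds,
   where Gi(t,y) = 1 - \int_0^t g_hat^(i)(0,s|y) ds are the survival probabilities
   and phi_s = \int alpha_hat^(1)(x,s|y) G2(t-s,x) dx.  Tonelli rewrites
   phi_s = G1(s,y) - \int_s^t \int alpha_hat^(1)(x,s|y) g_hat^(2)(0,v-s|x) dx dv, so
   the last term is an integral over (0,t) of a function not depending on t, and
   the formula follows by the fundamental theorem of calculus once the inner
   convolution is known to be continuous in v; this is dominated convergence with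
   the arcsine-type bound C (tau^(-1/2) + (v-tau)^(-1/2)), after scaling. *)
Require Import Defs.
From HB Require Import structures.
From mathcomp Require Import all_boot all_order all_algebra.
From mathcomp Require Import all_classical all_reals all_analysis.
From mathcomp Require Import measurable_realfun.
From mathcomp Require Import ring lra.

Set Implicit Arguments.
Unset Strict Implicit.
Unset Printing Implicit Defensive.

Import Order.TTheory GRing.Theory Num.Theory.
Import numFieldNormedType.Exports.

Local Open Scope classical_set_scope.
Local Open Scope ring_scope.

Local Notation leb := lebesgue_measure.
Implicit Type R : realType.

(** * Integrals and Gaussian densities *)

(** [wiener_process] constrains increments at deterministic times only, so no stopping time and no
    reflection argument enters: the absorbed kernel is an explicit formula, tied to the paths
    through grids alone. Testing the path only at grid times overestimates survival. Raising the
    path by [e] repairs this at a cost of at most exp(-e^2 / (4 w^2 h)) per step; with n steps of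
    size h = t / n the total cost vanishes for fixed [e], and only then does [e] tend to 0. Path
    events are stated with weak inequalities, since a closed condition on a continuous path is a
    countable one. Returning to strict positivity costs a small shift of the starting point, which
    the continuity of the explicit law in that point absorbs. Independence is used with the sample
    point itself as a variable: one factor of the product space is the sample space with the smaller
    sigma-algebra generated by the Wiener paths. Only omega_i^2 > 0 is assumed, so a scale such as
    [w * Num.sqrt t] may be negative; hence the conditions [w != 0] and the absolute values in the
    distribution functions. *)

Lemma measurable_invr R : measurable_fun [set: R] (@GRing.inv R).
Proof.
have -> : [set: R] = [set x | x != 0] `|` [set 0].
  by apply/seteqP; split => // x _ /=; case: (eqVneq x 0) => [->|]; [right|left].
apply/measurable_funU => //.
- apply: open_measurable; rewrite (_ : [set x | _] = ~` [set 0]).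
    by apply: closed_openC; exact: closed_eq.
  by apply/seteqP; split => x /= /eqP.
- split; last exact: measurable_fun_set1.
  apply: open_continuous_measurable_fun.
    rewrite (_ : [set x | _] = ~` [set 0]).
      by apply: closed_openC; exact: closed_eq.
    by apply/seteqP; split => x /= /eqP.
  by move=> x; rewrite inE /= => x0; apply: inv_continuous.
Qed.

Lemma measurable_funV d (T : measurableType d) R (D : set T)
    (f : T -> R) : measurable_fun D f -> measurable_fun D (fun x => (f x)^-1).
Proof. by move=> mf; apply: measurableT_comp => //; exact: measurable_invr. Qed.

Lemma measurable_sqrtr R : measurable_fun [set: R] (@Num.sqrt R).
Proof. by apply: continuous_measurable_fun; exact: sqrt_continuous. Qed.

(** Lebesgue measure is characterised by its values on half-open intervals; the pushforward under x
    -> a x + b, scaled by [a], has the same values there. *)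
Lemma ge0_integral_affine R (a b : R) (f : R -> \bar R) :
  0 < a -> measurable_fun [set: R] f -> (forall x, (0 <= f x)%E) ->
  (\int[leb]_x f x =
   a%:E * \int[leb]_x f (a * x + b)%R)%E.
Proof.
move=> a0 mf f0.
pose phi : measurableTypeR R -> measurableTypeR R := fun x => a * x + b.
have mphi : measurable_fun [set: measurableTypeR R] phi.
  by apply: measurable_funD => //; exact: measurable_funM.
pose k : {nonneg R} := NngNum (ltW a0).
pose m0 := (fun h : measurable_fun [set: measurableTypeR R] phi =>
  mscale k (pushforward leb phi) : {measure set (measurableTypeR R) -> \bar R}).
pose m' := m0 mphi mphi.
have mE A : measurable A -> leb A = m' A.
  move=> mA; apply: lebesgue_measure_unique => // X [[u v] _ <-].
  change (leb `]u, v]%classic = a%:E * leb (phi @^-1` `]u, v]))%E.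
  have -> : phi @^-1` `]u, v]%classic = `](u - b) / a, (v - b) / a]%classic.
    apply/seteqP; split => x /=; rewrite !in_itv /= ltr_pdivrMr// ler_pdivlMr//;
      rewrite /phi ltrBlDr lerBrDr mulrC //.
  rewrite !lebesgue_measure_itv /= !lte_fin ltr_pM2r ?invr_gt0// ltrD2r.
  case: ifPn => _; last by rewrite mule0.
  rewrite -!EFinB -EFinM; congr EFin; field; exact: lt0r_neq0.
have -> : (\int[leb]_x f x = \int[m']_x f x)%E.
  by apply: eq_measure_integral => A mA _; exact: mE.
rewrite ge0_integral_mscale// ge0_integral_pushforward//.
Qed.

Lemma ge0_integral_oppr R (f : R -> \bar R) :
  measurable_fun [set: R] f -> (forall x, (0 <= f x)%E) ->
  (\int[leb]_x f (- x)%R = \int[leb]_x f x)%E.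
Proof.
move=> mf f0; pose phi : measurableTypeR R -> measurableTypeR R := fun x => - x.
have mphi : measurable_fun [set: measurableTypeR R] phi by exact: oppr_measurable.
rewrite -[LHS](ge0_integral_pushforward mphi leb measurableT)//.
by apply: eq_measure_integral => A mA _; exact: lebesgue_measureN.
Qed.

(** Serves the method of images: a half-line integral of an even combination is a convolution over
    the whole line. *)
Lemma ge0_integral_fold R (f : R -> \bar R) :
  measurable_fun [set: R] f -> (forall x, (0 <= f x)%E) ->
  (\int[leb]_(x in `]0%R, +oo[) (f x + f (- x)%R) =
   \int[leb]_x f x)%E.
Proof.
move=> mf f0.
rewrite ge0_integralD//; first last.
- by apply: measurable_funTS; apply: measurableT_comp.
- exact: measurable_funTS.
have -> : [set: R] = `]-oo, 0[%classic `|` ([set 0] `|` `]0, +oo[%classic).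
  apply/seteqP; split => // x _ /=; rewrite !in_itv/= andbT.
  by case: (ltgtP x 0) => [x0|x0|->]; [left|right;right|right;left].
rewrite ge0_integral_setU//=; first last.
- apply/disj_setPRL => x /= [->|]; rewrite !in_itv/= ?andbT ?ltxx//.
  by move=> /ltW; rewrite leNgt => /negP.
- by apply: measurable_funTS.
- exact: measurableU.
rewrite ge0_integral_setU//=; first last.
- by apply/disj_setPRL => x /=; rewrite !in_itv/= andbT => x0 xE; rewrite xE ltxx in x0.
- by apply: measurable_funTS.
rewrite integral_set1 add0e.
rewrite addeC; congr (_ + _)%E.
rewrite integral_mkcond [RHS]integral_mkcond -[RHS]ge0_integral_oppr; first last.
- by move=> x; apply: erestrict_ge0.
- by apply/(measurable_restrictT _ _).1 => //; apply: measurable_funTS.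
apply: eq_integral => x _; rewrite /patch !mem_setE /= !in_itv /= andbT.
by rewrite oppr_lt0.
Qed.

(** The integrand is extended by 0 off the rectangle. The local form matters because [alpha_hat] is
    nonnegative only for nonnegative space arguments. *)
Lemma fubini_tonelli_in d1 d2 (T1 : measurableType d1) (T2 : measurableType d2)
    R (m1 : {sigma_finite_measure set T1 -> \bar R})
    (m2 : {sigma_finite_measure set T2 -> \bar R}) (A : set T1) (B : set T2)
    (f : T1 -> T2 -> \bar R) : measurable A -> measurable B ->
  measurable_fun (A `*` B) (fun z => f z.1 z.2) ->
  (forall x y, A x -> B y -> 0 <= f x y)%E ->
  (\int[m1]_(x in A) \int[m2]_(y in B) f x y =
   \int[m2]_(y in B) \int[m1]_(x in A) f x y)%E.
Proof.
move=> mA mB mf f0.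
pose F := (fun z : T1 * T2 => f z.1 z.2) \_ (A `*` B).
have mF : measurable_fun setT F.
  by apply/(measurable_restrictT _ _).1 => //; exact: measurableX.
have F0 z : (0 <= F z)%E.
  by apply: erestrict_ge0 => -[x y] [/= Ax By]; exact: f0.
have := fubini_tonelli (m1 := m1) (m2 := m2) F mF F0.
have FE x y : F (x, y) = if (x \in A) && (y \in B) then f x y else 0%E.
  by rewrite /F /patch in_setX.
move=> H; rewrite integral_mkcond [RHS]integral_mkcond.
transitivity (\int[m1]_x \int[m2]_y F (x, y))%E.
  apply: eq_integral => x _; rewrite /patch; case: ifPn => xA.
    by rewrite integral_mkcond; apply: eq_integral => y _; rewrite FE /patch xA.
  by rewrite integral0_eq// => y _; rewrite FE (negbTE xA).
rewrite H; apply: eq_integral => y _; rewrite /patch; case: ifPn => yB.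
  by rewrite [RHS]integral_mkcond; apply: eq_integral => x _; rewrite FE /patch yB andbT.
by rewrite integral0_eq// => x _; rewrite FE (negbTE yB) andbF.
Qed.

(** * Gaussian algebra and the absorbed kernel *)

Lemma normal_pdf_expE R (m s x : R) : s != 0 ->
  normal_pdf m s x =
  (Num.sqrt (2 * pi * s ^+ 2))^-1 * expR (- ((x - m) ^+ 2 / (2 * s ^+ 2))).
Proof.
move=> s0; rewrite normal_pdfE// /normal_peak /normal_fun mulNr -[s ^+ 2 * pi *+ 2]mulr_natl
  -[s ^+ 2 *+ 2]mulr_natl.
by rewrite (mulrC (s ^+ 2)) mulrA.
Qed.

Lemma sqr_scale_sqrt R (w t : R) : 0 <= t ->
  (w * Num.sqrt t) ^+ 2 = w ^+ 2 * t.
Proof. by move=> t0; rewrite exprMn sqr_sqrtr. Qed.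

Lemma scale_sqrt_neq0 R (w t : R) : w != 0 -> 0 < t ->
  w * Num.sqrt t != 0.
Proof. by move=> w0 t0; rewrite mulf_neq0// gt_eqF// sqrtr_gt0. Qed.

(** Completing the square in [z]: the product is the convolved density at [v] times the density of
    the intermediate point conditioned on both ends. Only squares of the scales matter, so [S] is
    any root of the total variance. *)
Lemma normal_pdf_mul R (x v s1 s2 S z : R) :
  s1 != 0 -> s2 != 0 -> S ^+ 2 = s1 ^+ 2 + s2 ^+ 2 ->
  normal_pdf x s1 z * normal_pdf z s2 v =
  normal_pdf x S v *
  normal_pdf ((s2 ^+ 2 * x + s1 ^+ 2 * v) / S ^+ 2) (s1 * s2 / S) z.
Proof.
move=> s10 s20 SE.
have h1 : 0 < s1 ^+ 2 by rewrite exprn_even_gt0.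
have h2 : 0 < s2 ^+ 2 by rewrite exprn_even_gt0.
have S0 : S != 0.
  by apply/eqP => S0; move: SE; rewrite S0 expr0n/=; apply/eqP; rewrite lt_eqF// addr_gt0.
have q0 : s1 * s2 / S != 0 by rewrite !mulf_neq0// invr_eq0.
rewrite !normal_pdf_expE// [LHS]mulrACA [RHS]mulrACA; congr (_ * _).
  rewrite -!invfM -!sqrtrM; try by rewrite mulr_ge0 ?sqr_ge0// mulr_ge0 ?pi_ge0.
  move: (@pi R) => c; apply: (congr1 (fun u => (Num.sqrt u)^-1)).
  rewrite exprMn exprVn exprMn SE; field.
  by rewrite gt_eqF// addr_gt0.
rewrite -!expRD; congr expR.
rewrite !exprMn exprVn SE; field.
by rewrite s10 s20 gt_eqF// addr_gt0.
Qed.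

Lemma normal_pdf_conv R (x v s1 s2 S : R) :
  s1 != 0 -> s2 != 0 -> S ^+ 2 = s1 ^+ 2 + s2 ^+ 2 ->
  (\int[leb]_z (normal_pdf x s1 z * normal_pdf z s2 v)%:E =
   (normal_pdf x S v)%:E)%E.
Proof.
move=> s10 s20 SE.
under eq_integral do rewrite (normal_pdf_mul _ _ _ s10 s20 SE) EFinM.
rewrite ge0_integralZl//=.
- by rewrite integral_normal_pdf mule1.
- by apply/measurable_EFinP; exact: measurable_normal_pdf.
- by move=> z _; rewrite lee_fin normal_pdf_ge0.
- by rewrite lee_fin normal_pdf_ge0.
Qed.

Lemma normal_pdf_opp R (x s z : R) : s != 0 ->
  normal_pdf (- x) s (- z) = normal_pdf x s z.
Proof. by move=> s0; rewrite !normal_pdf_expE// -(sqrrN (- z - - x)) opprB opprK addrC. Qed.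

Lemma measurable_normal_pdf2 d (T : measurableType d) R (s : R)
    (f g : T -> R) : s != 0 -> measurable_fun setT f -> measurable_fun setT g ->
  measurable_fun setT (fun x => normal_pdf (f x) s (g x)).
Proof.
move=> s0 mf mg.
rewrite (_ : (fun x => _) = (fun x => (Num.sqrt (2 * pi * s ^+ 2))^-1 *
   expR (- ((g x - f x) ^+ 2 / (2 * s ^+ 2))))); last first.
  by apply/funext => x; rewrite normal_pdf_expE.
apply: measurable_funM => //; apply: measurableT_comp => //.
apply: measurableT_comp => //; apply: measurable_funM => //.
by apply: measurable_funX; apply: measurable_funB.
Qed.

Lemma alpha_hatE R (b w z t x : R) : w != 0 -> 0 < t ->
  alpha_hat b w z t x = normal_pdf (x + b * t) (w * Num.sqrt t) z -
    expR (- (2 * b * x / w ^+ 2)) * normal_pdf (- x + b * t) (w * Num.sqrt t) z.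
Proof.
move=> w0 t0; have s0 := scale_sqrt_neq0 w0 t0.
rewrite /alpha_hat !normal_pdf_expE// (sqr_scale_sqrt _ (ltW t0)).
rewrite mulrBr [in RHS](mulrCA (expR _)); congr (_ * _ - _ * (_ * _)).
- by congr (Num.sqrt _)^-1; rewrite !mulrA.
- by congr expR; congr (- (_ * _^-1)); ring.
- by congr (Num.sqrt _)^-1; rewrite !mulrA.
- by congr expR; congr (- (_ * _^-1)); ring.
Qed.

(* Girsanov: the drift only contributes an exponential factor. *)
Lemma alpha_hat_driftless R (b w z t x : R) : w != 0 -> 0 < t ->
  alpha_hat b w z t x = expR (b * (z - x) / w ^+ 2 - b ^+ 2 * t / (2 * w ^+ 2)) *
    (normal_pdf x (w * Num.sqrt t) z - normal_pdf x (w * Num.sqrt t) (- z)).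
Proof.
move=> w0 t0; have s0 := scale_sqrt_neq0 w0 t0.
have t1 : t != 0 by rewrite gt_eqF.
rewrite /alpha_hat !normal_pdf_expE// (sqr_scale_sqrt _ (ltW t0)).
rewrite -mulrBr [in RHS]mulrCA; congr (_ * _).
  by congr (Num.sqrt _)^-1; ring.
rewrite mulrBr -!expRD; congr (expR _ - expR _); field.
- by rewrite w0 t1.
- by rewrite w0 t1.
Qed.

(** In the driftless form the two Gaussians compare through (z + x)^2 - (z - x)^2 = 4 x z. *)
Lemma alpha_hat_ge0 R (b w z t x : R) : w != 0 -> 0 < t ->
  0 <= x -> 0 <= z -> 0 <= alpha_hat b w z t x.
Proof.
move=> w0 t0 x0 z0; rewrite alpha_hat_driftless// mulr_ge0 ?expR_ge0// subr_ge0.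
have s0 := scale_sqrt_neq0 w0 t0.
rewrite !normal_pdf_expE// ler_wpM2l ?invr_ge0 ?sqrtr_ge0// ler_expR.
rewrite lerN2 ler_wpM2r//.
  by rewrite invr_ge0 mulr_ge0 ?sqr_ge0.
by rewrite -subr_ge0 (_ : _ - _ = 4 * (x * z)) ?mulr_ge0//; ring.
Qed.

Lemma alpha_hat_le R (b w z t x : R) : w != 0 -> 0 < t ->
  alpha_hat b w z t x <= normal_pdf (x + b * t) (w * Num.sqrt t) z.
Proof.
by move=> w0 t0; rewrite alpha_hatE// gerBl mulr_ge0 ?expR_ge0 ?normal_pdf_ge0.
Qed.

(** Joint measurability holds for all real arguments, nonpositive times included, because inversion
    and [Num.sqrt] are total and measurable. No side condition then propagates to the double
    integrals. *)
Lemma measurable_alpha_hat d (T : measurableType d) R (b w : R)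
    (f g h : T -> R) : measurable_fun setT f -> measurable_fun setT g ->
  measurable_fun setT h ->
  measurable_fun setT (fun x => alpha_hat b w (f x) (g x) (h x)).
Proof.
move=> mf mg mh; rewrite /alpha_hat.
have mq : measurable_fun setT (fun x => 2 * w ^+ 2 * g x) by exact: measurable_funM.
apply: measurable_funM.
  apply: measurable_funV; apply: measurableT_comp; first exact: measurable_sqrtr.
  exact: measurable_funM.
apply: measurable_funB.
  apply: measurableT_comp => //; apply: measurableT_comp => //.
  apply: measurable_funM; last exact: measurable_funV.
  apply: measurable_funX; apply: measurable_funB; last exact: measurable_funM.
  exact: measurable_funB.
apply: measurable_funM.
  apply: measurableT_comp => //; apply: measurableT_comp => //.
  by apply: measurable_funM => //; exact: measurable_funM.
apply: measurableT_comp => //; apply: measurableT_comp => //.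
apply: measurable_funM; last exact: measurable_funV.
apply: measurable_funX; apply: measurable_funB; last exact: measurable_funM.
exact: measurable_funD.
Qed.

Lemma measurable_g_hat d (T : measurableType d) R (b w : R)
    (f g : T -> R) : measurable_fun setT f -> measurable_fun setT g ->
  measurable_fun setT (fun x => g_hat b w (f x) (g x)).
Proof.
move=> mf mg; rewrite /g_hat.
apply: measurable_funM.
  apply: measurable_funM => //.
  apply: measurable_funV; apply: measurableT_comp; first exact: measurable_sqrtr.
  by apply: measurable_funM => //; exact: measurable_funX.
apply: measurableT_comp => //; apply: measurableT_comp => //.
apply: measurable_funM; last by apply: measurable_funV; exact: measurable_funM.
by apply: measurable_funX; apply: measurable_funD => //; exact: measurable_funM.
Qed.

(** The drift exponentials of the two factors multiply to that of the product. What remains is a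
    product of two differences of images; since the Gaussian is symmetric under changing both signs,
    its four terms group into [q v z + q v (- z)] minus the same with [- v]. Folding turns each
    group into a full Gaussian convolution, at [v] and at [- v]. *)
Lemma alpha_hat_chapman_kolmogorov R (b w x v h r : R) : w != 0 ->
  0 < h -> 0 < r -> 0 <= x -> 0 <= v ->
  (\int[leb]_(z in `]0%R, +oo[)
     (alpha_hat b w z h x * alpha_hat b w v r z)%:E =
   (alpha_hat b w v (h + r) x)%:E)%E.
Proof.
move=> w0 h0 r0 x0 v0.
set s1 := w * Num.sqrt h; set s2 := w * Num.sqrt r; set S := w * Num.sqrt (h + r).
have s10 : s1 != 0 by exact: scale_sqrt_neq0.
have s20 : s2 != 0 by exact: scale_sqrt_neq0.
have hr0 : 0 < h + r by exact: addr_gt0.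
have SE : S ^+ 2 = s1 ^+ 2 + s2 ^+ 2.
  by rewrite !sqr_scale_sqrt ?ltW// mulrDr.
pose q v' z := normal_pdf x s1 z * normal_pdf z s2 v'.
have q0 v' z : 0 <= q v' z by rewrite mulr_ge0 ?normal_pdf_ge0.
have mq v' : measurable_fun setT (q v').
  apply: measurable_funM; first exact: measurable_normal_pdf.
  by apply: measurable_normal_pdf2.
have iq v' : (\int[leb]_(z in `]0%R, +oo[) (q v' z + q v' (- z))%:E =
    (normal_pdf x S v')%:E)%E.
  rewrite -(normal_pdf_conv x v' s10 s20 SE) -ge0_integral_fold//.
  - by apply/measurable_EFinP; exact: mq.
  - by move=> z; rewrite lee_fin q0.
have mq' v' : measurable_fun setT (fun z => q v' z + q v' (- z)).
  by apply: measurable_funD => //; apply: measurableT_comp.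
have intq v' : leb.-integrable `]0, +oo[ (fun z => (q v' z + q v' (- z))%:E).
  apply/integrableP; split.
    by apply: measurable_funTS; apply/measurable_EFinP; exact: mq'.
  under eq_integral do rewrite gee0_abs ?lee_fin ?addr_ge0//.
  by rewrite iq ltry.
pose c := expR (b * (v - x) / w ^+ 2 - b ^+ 2 * (h + r) / (2 * w ^+ 2)).
transitivity (\int[leb]_(z in `]0%R, +oo[)
   (c%:E * ((q v z + q v (- z))%:E - (q (- v) z + q (- v) (- z))%:E)))%E.
  apply: eq_integral => z _; rewrite -EFinB -EFinM; congr EFin.
  rewrite !alpha_hat_driftless// [LHS]mulrACA -expRD; congr (_ * _).
    by congr expR; field; rewrite w0.
  rewrite /q -/s1 -/s2 -(normal_pdf_opp z v)// -[in normal_pdf z s2 (- v)]normal_pdf_opp// ?opprK//.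
  ring.
rewrite integralZl//; last exact: integrableB.
rewrite integralB// !iq -EFinB -EFinM; congr EFin.
by rewrite alpha_hat_driftless.
Qed.

(** * Integration under independence *)

(** [A] will be a survival event, so this measure is finite but not a probability. The measurability
    proofs are arguments so that the measure instances can be attached to the term. *)
Definition restricted_law d d1 (T : measurableType d) (T1 : measurableType d1)
    R (P : probability T R) (A : set T) (U : T -> T1)
    (mA : measurable A) (mU : measurable_fun setT U) : set T1 -> \bar R :=
  pushforward (mrestr P mA) U.

Section restricted_law.
Context d d1 (T : measurableType d) (T1 : measurableType d1)
    R (P : probability T R) (A : set T) (U : T -> T1)
    (mA : measurable A) (mU : measurable_fun setT U).
Local Notation law := (restricted_law P mA mU).

Let law0 : law set0 = 0%E.
Proof. by rewrite /restricted_law /pushforward preimage_set0 measure0. Qed.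

Let law_ge0 X : (0 <= law X)%E.
Proof. exact: measure_ge0. Qed.

Let law_sigma_additive : semi_sigma_additive law.
Proof.
move=> F mF tF mUF.
have mpre X : measurable X -> measurable (U @^-1` X).
  by move=> mX; rewrite -[X in measurable X]setTI; exact: mU.
rewrite /restricted_law /pushforward preimage_bigcup.
apply: (@measure_semi_sigma_additive _ _ _ (mrestr P mA)).
- by move=> n; exact: mpre.
- by apply/trivIsetP => i j _ _ ij; rewrite -preimage_setI (trivIsetP.1 tF)// preimage_set0.
- by rewrite -preimage_bigcup; exact: mpre.
Qed.

HB.instance Definition _ := isMeasure.Build _ _ _ law law0 law_ge0 law_sigma_additive.

Let law_fin : fin_num_fun law.
Proof.
move=> X mX; rewrite /restricted_law /pushforward.
apply: (@fin_num_measure _ _ _ (mrestr P mA)).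
by rewrite -[X in measurable X]setTI; exact: mU.
Qed.

HB.instance Definition _ := @Measure_isFinite.Build _ T1 _ law law_fin.

End restricted_law.

Lemma ge0_integral_mrestr d (T : measurableType d) R
    (m : {measure set T -> \bar R}) (A : set T) (mA : measurable A) (f : T -> \bar R) :
  measurable_fun setT f -> (forall x, (0 <= f x)%E) ->
  (\int[mrestr m mA]_x f x = \int[m]_(x in A) f x)%E.
Proof.
move=> mf f0; have mAC : measurable (~` A) by exact: measurableC.
rewrite -(setUv A) ge0_integral_setU//; first last.
- by apply/disj_setPS; rewrite setICr.
- by rewrite setUv.
rewrite [X in (_ + X)%E]null_set_integral ?adde0//; first last.
- by change (m (~` A `&` A) = 0)%E; rewrite setICl measure0.
- exact: measurable_funTS.
apply: eq_measure_integral => B mB BA.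
by rewrite /= /mrestr (setIidl BA).
Qed.

Lemma ge0_integral_indep d d1 d2 (T : measurableType d) (T1 : measurableType d1)
    (T2 : measurableType d2) R (P : probability T R)
    (Q : probability T2 R) (A : set T) (U : T -> T1) (V : T -> T2)
    (f : T1 * T2 -> \bar R) :
  measurable A -> measurable_fun setT U -> measurable_fun setT V ->
  (forall B C, measurable B -> measurable C ->
    P (A `&` U @^-1` B `&` V @^-1` C) = P (A `&` U @^-1` B) * Q C)%E ->
  measurable_fun setT f -> (forall z, (0 <= f z)%E) ->
  (\int[P]_(w in A) f (U w, V w) = \int[P]_(w in A) \int[Q]_v f (U w, v))%E.
Proof.
move=> mA mU mV H mf f0.
have mUV : measurable_fun setT (fun w => (U w, V w)) by exact: measurable_fun_pair.
have mfQ : measurable_fun setT (fun u => \int[Q]_v f (u, v))%E.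
  exact: (measurable_fun_fubini_tonelli_F (m2 := Q) f).
have fQ0 u : (0 <= \int[Q]_v f (u, v))%E by exact: integral_ge0.
transitivity (\int[restricted_law P mA mUV]_z f z)%E.
  rewrite [RHS](@ge0_integral_pushforward _ _ _ _ _ _ mUV (mrestr P mA))// ge0_integral_mrestr//;
    by [exact: measurableT_comp|move=> x /=].
transitivity (\int[restricted_law P mA mU]_u \int[Q]_v f (u, v))%E; last first.
  rewrite (@ge0_integral_pushforward _ _ _ _ _ _ mU (mrestr P mA))// ge0_integral_mrestr//;
    by [exact: measurableT_comp|move=> x /=].
transitivity (\int[(restricted_law P mA mU \x Q)%E]_z f z)%E; last first.
  by rewrite fubini_tonelli1.
apply: eq_measure_integral => X mX _; apply/esym; apply: product_measure_unique => // B C mB mC.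
transitivity (P (A `&` U @^-1` B `&` V @^-1` C)).
  by congr (P _); apply/seteqP; split => w /=; tauto.
by rewrite H// setIC.
Qed.

Lemma measurable_integral_in d1 d2 (T1 : measurableType d1) (T2 : measurableType d2)
    R (m2 : {sigma_finite_measure set T2 -> \bar R}) (A : set T1) (B : set T2)
    (f : T1 -> T2 -> \bar R) : measurable A -> measurable B ->
  measurable_fun (A `*` B) (fun z => f z.1 z.2) ->
  (forall x y, A x -> B y -> 0 <= f x y)%E ->
  measurable_fun A (fun x => \int[m2]_(y in B) f x y)%E.
Proof.
move=> mA mB mf f0.
pose F := (fun z : T1 * T2 => f z.1 z.2) \_ (A `*` B).
have mF : measurable_fun setT F.
  by apply/(measurable_restrictT _ _).1 => //; exact: measurableX.
have F0 z : (0 <= F z)%E.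
  by apply: erestrict_ge0 => -[x y] [/= Ax By]; exact: f0.
have := measurable_fun_fubini_tonelli_F (m2 := m2) F mF F0.
move=> /(measurable_funTS (D := A)); apply: eq_measurable_fun => x Ax.
rewrite /fubini_F [RHS]integral_mkcond; apply: eq_integral => y _.
by rewrite /F /patch in_setX /= Ax.
Qed.

(** * The killed semigroup of a Wiener process *)

(* The expectation of [f] at time [t] for the Wiener process started at [x] and killed at 0. *)
Definition killed R (b w : R) (f : R -> R) (t x : R) : \bar R :=
  (\int[leb]_(z in `]0%R, +oo[) (alpha_hat b w z t x * f z)%:E)%E.

Lemma killed_ge0 R (b w : R) (f : R -> R) (t x : R) :
  w != 0 -> 0 < t -> 0 <= x -> (forall z, 0 <= f z) -> (0 <= killed b w f t x)%E.
Proof.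
move=> w0 t0 x0 f0; apply: integral_ge0 => z /=; rewrite in_itv/= andbT => z0.
by rewrite lee_fin mulr_ge0// alpha_hat_ge0// ltW.
Qed.

Lemma killed_le R (b w : R) (f : R -> R) (t x : R) :
  w != 0 -> 0 < t -> 0 <= x -> measurable_fun setT f ->
  (forall z, 0 <= f z <= 1) -> (killed b w f t x <= 1)%E.
Proof.
move=> w0 t0 x0 mf f01.
rewrite -(integral_normal_pdf (x + b * t) (w * Num.sqrt t)).
rewrite /killed integral_mkcond; apply: ge0_le_integral => //=.
- move=> z _; apply: erestrict_ge0 => z' /=; rewrite in_itv/= andbT => z0.
  by have /andP[fz _] := f01 z'; rewrite lee_fin mulr_ge0// alpha_hat_ge0// ltW.
- apply/(measurable_restrictT _ _).1 => //; apply: measurable_funTS.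
  by apply/measurable_EFinP; apply: measurable_funM => //; exact: measurable_alpha_hat.
- by apply/measurable_EFinP; exact: measurable_normal_pdf.
- move=> z _; rewrite /patch; case: ifPn; rewrite ?lee_fin ?normal_pdf_ge0// inE /= in_itv/= andbT => z0.
  have /andP[fz0 fz1] := f01 z.
  by rewrite (le_trans _ (alpha_hat_le b z x w0 t0))// ler_piMr// alpha_hat_ge0// ltW.
Qed.

Lemma killed_fin_num R (b w : R) (f : R -> R) (t x : R) :
  w != 0 -> 0 < t -> 0 <= x -> measurable_fun setT f ->
  (forall z, 0 <= f z <= 1) -> killed b w f t x \is a fin_num.
Proof.
move=> w0 t0 x0 mf f01; rewrite ge0_fin_numE; last first.
  by apply: killed_ge0 => // z; case/andP: (f01 z).
by rewrite (le_lt_trans (killed_le b w0 t0 x0 mf f01)) ?ltry.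
Qed.

Lemma measurable_killed R (b w : R) (f : R -> R) (t : R) :
  w != 0 -> 0 < t -> measurable_fun setT f -> (forall z, 0 <= f z) ->
  measurable_fun (`[0, +oo[%classic : set R) (killed b w f t).
Proof.
move=> w0 t0 mf f0.
apply: (measurable_integral_in leb) => //.
  apply: measurable_funTS; apply/measurable_EFinP.
  apply: measurable_funM; last exact: measurableT_comp.
  exact: measurable_alpha_hat.
move=> x z /=; rewrite !in_itv/= !andbT => x0 z0.
by rewrite lee_fin mulr_ge0// alpha_hat_ge0// ltW.
Qed.

Lemma killed_semigroup R (b w : R) (f : R -> R) (h r x : R) :
  w != 0 -> 0 < h -> 0 < r -> 0 <= x -> measurable_fun setT f -> (forall z, 0 <= f z) ->
  (\int[leb]_(z in `]0%R, +oo[) ((alpha_hat b w z h x)%:E * killed b w f r z) =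
   killed b w f (h + r) x)%E.
Proof.
move=> w0 h0 r0 x0 mf f0.
pose F z v := ((alpha_hat b w z h x)%:E * (alpha_hat b w v r z * f v)%:E)%E.
transitivity (\int[leb]_(z in `]0%R, +oo[)
    \int[leb]_(v in `]0%R, +oo[) F z v)%E.
  apply: eq_integral => z; rewrite inE /= in_itv/= andbT => z0.
  rewrite ge0_integralZl//.
  - apply: measurable_funTS; apply/measurable_EFinP; apply: measurable_funM => //.
    exact: measurable_alpha_hat.
  - move=> v /=; rewrite in_itv/= andbT => v0.
    by rewrite lee_fin mulr_ge0// alpha_hat_ge0// ltW.
  - by rewrite lee_fin alpha_hat_ge0// ltW.
rewrite fubini_tonelli_in//.
- apply: eq_integral => v; rewrite inE /= in_itv/= andbT => v0.
  rewrite /F.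
  under eq_integral do rewrite -EFinM mulrA mulrC EFinM.
  rewrite ge0_integralZl//.
  + by rewrite alpha_hat_chapman_kolmogorov// ?ltW// -EFinM mulrC.
  + apply: measurable_funTS; apply/measurable_EFinP; apply: measurable_funM.
      exact: measurable_alpha_hat.
    exact: measurable_alpha_hat.
  + move=> z /=; rewrite in_itv/= andbT => z0.
    by rewrite lee_fin mulr_ge0// alpha_hat_ge0// ltW.
  + by rewrite lee_fin.
- apply: measurable_funTS; apply/measurable_EFinP; apply: measurable_funM.
    exact: measurable_alpha_hat.
  apply: measurable_funM; last exact: measurableT_comp.
  exact: measurable_alpha_hat.
- move=> z v /=; rewrite !in_itv/= !andbT => z0 v0.
  have := alpha_hat_ge0 b w0 h0 x0 (ltW z0); have := alpha_hat_ge0 b w0 r0 (ltW z0) (ltW v0).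
  by move=> ? ?; rewrite /F -EFinM lee_fin; apply: mulr_ge0 => //; exact: mulr_ge0.
Qed.

(** Zero steps are a separate case because [alpha_hat] at time 0 evaluates to 0, the inverse of 0
    being 0, instead of acting as the identity. *)
Definition killed_steps R (b w : R) (f : R -> R) (h : R) (m : nat) (x : R) : \bar R :=
  if m is 0%N then (f x)%:E else killed b w f (m%:R * h) x.

Lemma killed_steps_ge0 R (b w : R) (f : R -> R) (h : R) m (x : R) :
  w != 0 -> 0 < h -> 0 <= x -> (forall z, 0 <= f z) -> (0 <= killed_steps b w f h m x)%E.
Proof.
move=> w0 h0 x0 f0; case: m => [|m] /=; first by rewrite lee_fin.
by apply: killed_ge0 => //; rewrite mulr_gt0.
Qed.

Lemma killed_steps_le R (b w : R) (f : R -> R) (h : R) m (x : R) :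
  w != 0 -> 0 < h -> 0 <= x -> measurable_fun setT f ->
  (forall z, 0 <= f z <= 1) -> (killed_steps b w f h m x <= 1)%E.
Proof.
move=> w0 h0 x0 mf f01; case: m => [|m] /=; first by rewrite lee_fin; case/andP: (f01 x).
by apply: killed_le => //; rewrite mulr_gt0.
Qed.

Lemma measurable_killed_steps R (b w : R) (f : R -> R) (h : R) m :
  w != 0 -> 0 < h -> measurable_fun setT f -> (forall z, 0 <= f z) ->
  measurable_fun (`[0, +oo[%classic : set R) (killed_steps b w f h m).
Proof.
move=> w0 h0 mf f0; case: m => [|m].
  by apply: measurable_funTS; exact/measurable_EFinP.
by apply: measurable_killed => //; rewrite mulr_gt0.
Qed.

Lemma killed_stepsS R (b w : R) (f : R -> R) (h : R) m (x : R) :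
  w != 0 -> 0 < h -> 0 <= x -> measurable_fun setT f -> (forall z, 0 <= f z) ->
  (\int[leb]_(z in `]0%R, +oo[) ((alpha_hat b w z h x)%:E * killed_steps b w f h m z) =
   killed_steps b w f h m.+1 x)%E.
Proof.
move=> w0 h0 x0 mf f0; case: m => [|m]; first by rewrite /= mul1r.
have mh : 0 < m.+1%:R * h by rewrite mulr_gt0.
have -> : killed_steps b w f h m.+2 x = killed b w f (h + m.+1%:R * h) x.
  by rewrite /killed_steps -[m.+2%:R]nat1r mulrDl mul1r.
exact: killed_semigroup.
Qed.

(** Dropping the image term enlarges the kernel to the free Gaussian: testing the endpoint only
    kills less than absorption does. *)
Lemma killed_steps_lower R (b w : R) (f : R -> R) (h : R) m (x : R) :
  w != 0 -> 0 < h -> 0 <= x -> measurable_fun setT f -> (forall z, 0 <= f z) ->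
  (killed_steps b w f h m.+1 x <=
   \int[leb]_(z in `[0%R, +oo[)
     ((normal_pdf (x + b * h) (w * Num.sqrt h) z)%:E * killed_steps b w f h m z))%E.
Proof.
move=> w0 h0 x0 mf f0; rewrite -killed_stepsS//.
have S : `]0, +oo[%classic `<=` (`[0, +oo[%classic : set R).
  by move=> z /=; rewrite !in_itv/= !andbT => /ltW.
have mV : measurable_fun (`[0, +oo[%classic : set R) (fun z => ((normal_pdf (x + b * h) (w * Num.sqrt h) z)%:E *
    killed_steps b w f h m z))%E.
  apply: emeasurable_funM; last exact: measurable_killed_steps.
  by apply: measurable_funTS; apply/measurable_EFinP; exact: measurable_normal_pdf.
have V0 z : `[0, +oo[%classic z -> (0 <= (normal_pdf (x + b * h) (w * Num.sqrt h) z)%:E *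
    killed_steps b w f h m z)%E.
  move=> /=; rewrite in_itv/= andbT => z0.
  by rewrite mule_ge0 ?lee_fin ?normal_pdf_ge0// killed_steps_ge0.
apply: (@le_trans _ _ (\int[leb]_(z in `]0%R, +oo[)
     ((normal_pdf (x + b * h) (w * Num.sqrt h) z)%:E * killed_steps b w f h m z))%E).
  apply: ge0_le_integral => //.
  - move=> z /= z0; rewrite mule_ge0//.
      rewrite lee_fin; apply: alpha_hat_ge0 => //.
      by move: z0; rewrite in_itv/= andbT => /ltW.
    by apply: killed_steps_ge0 => //; move: z0; rewrite in_itv/= andbT => /ltW.
  - apply: emeasurable_funM.
      by apply: measurable_funTS; apply/measurable_EFinP; exact: measurable_alpha_hat.
    exact: (measurable_funS _ S (measurable_killed_steps b m w0 h0 mf f0)).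
  - exact: (measurable_funS _ S mV).
  - move=> z /=; rewrite in_itv/= andbT => z0.
    by apply: lee_wpmul2r; [apply: killed_steps_ge0 => //; exact: ltW|rewrite lee_fin alpha_hat_le].
exact: ge0_subset_integral.
Qed.

Lemma ge0_integral_itv_shift R (e : R) (f : R -> \bar R) :
  measurable_fun (`[e, +oo[%classic : set R) f -> (forall z, e <= z -> (0 <= f z)%E) ->
  (\int[leb]_(z in `[0%R, +oo[) f (z + e)%R =
   \int[leb]_(z in `[e, +oo[) f z)%E.
Proof.
move=> mf f0; rewrite [RHS]integral_mkcond (@ge0_integral_affine _ 1 e)//.
- rewrite mul1e [LHS]integral_mkcond; apply: eq_integral => z _.
  by rewrite /patch !mem_setE /= !in_itv/= !andbT mul1r lerDr.
- by apply/(measurable_restrictT _ _).1.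
- by move=> z; apply: erestrict_ge0 => y /=; rewrite in_itv/= andbT; exact: f0.
Qed.

Lemma normal_pdf_shift R (m s z e : R) : s != 0 ->
  normal_pdf (m + e) s (z + e) = normal_pdf m s z.
Proof. by move=> s0; rewrite !normal_pdf_expE// (_ : z + e - (m + e) = z - m)//; ring. Qed.

(** After clearing the denominator 2 w^2 h, the exponents differ by 2bxh + 2xz + x^2 - e^2/2. The
    condition on [h] gives 2bxh >= -ex/2, and x^2 - ex/2 - e^2/2 = (x - e)(x + e/2) is nonnegative
    for x >= e. *)
Lemma reflected_normal_pdf_le R (b w h e x z : R) : w != 0 -> 0 < h ->
  0 < e -> e <= x -> 0 <= z -> 4 * `|b| * h <= e ->
  expR (- (2 * b * x / w ^+ 2)) * normal_pdf (- x + b * h) (w * Num.sqrt h) z <=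
  expR (- (e ^+ 2 / (4 * w ^+ 2 * h))) * normal_pdf (b * h) (w * Num.sqrt h) z.
Proof.
move=> w0 h0 e0 ex z0 bh.
rewrite !normal_pdf_expE ?scale_sqrt_neq0// !(mulrCA (expR _)).
rewrite ler_wpM2l ?invr_ge0 ?sqrtr_ge0// -!expRD ler_expR (sqr_scale_sqrt _ (ltW h0)).
have h1 : h != 0 by rewrite gt_eqF.
rewrite -subr_ge0 [X in 0 <= X](_ : _ =
  (2 * b * x * h + 2 * x * z + x ^+ 2 - e ^+ 2 / 2) / (2 * (w ^+ 2 * h))); last first.
  by field; rewrite w0 h1.
rewrite divr_ge0//; last by rewrite mulr_ge0// mulr_ge0 ?sqr_ge0// ltW.
have bh' : - e <= 4 * (b * h).
  have : - `|b| <= b by rewrite lerNl; rewrite -normrN ler_norm.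
  by move=> /(ler_wpM2r (ltW h0)); move: bh; rewrite -mulrA; lra.
nra.
Qed.

Lemma lee_affine_unit R (q a c : R) (v : \bar R) :
  (0 <= v)%E -> (v <= 1)%E -> (forall u, 0 <= u -> u <= 1 -> q * u <= a * u + c) ->
  (q%:E * v <= a%:E * v + c%:E)%E.
Proof.
case: v => [v| |]// v0 v1 H.
by rewrite -!EFinM -EFinD lee_fin H// -lee_fin.
Qed.

(* If only the endpoint of a step is tested, a path may dip below 0 during the step unnoticed.
   Raising the path by [e] makes up for this, up to the exponentially small image term. *)
Lemma killed_steps_upper R (b w : R) (f : R -> R) (h : R) m (e x : R) :
  w != 0 -> 0 < h -> 0 < e -> 4 * `|b| * h <= e -> 0 <= x ->
  measurable_fun setT f -> (forall z, 0 <= f z <= 1) ->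
  (\int[leb]_(z in `[0%R, +oo[)
     ((normal_pdf (x + b * h) (w * Num.sqrt h) z)%:E * killed_steps b w f h m (z + e)%R) <=
   killed_steps b w f h m.+1 (x + e)%R + (expR (- (e ^+ 2 / (4 * w ^+ 2 * h))))%:E)%E.
Proof.
move=> w0 h0 e0 bh x0 mf f01.
have f0 z : 0 <= f z by case/andP: (f01 z).
set s := w * Num.sqrt h; have s0 : s != 0 by exact: scale_sqrt_neq0.
pose F (m' : R) z := ((normal_pdf m' s z)%:E * killed_steps b w f h m z)%E.
have mF m' : measurable_fun (`[0, +oo[%classic : set R) (F m').
  apply: emeasurable_funM; last exact: measurable_killed_steps.
  by apply: measurable_funTS; apply/measurable_EFinP; exact: measurable_normal_pdf.
have F0 m' z : 0 <= z -> (0 <= F m' z)%E.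
  by move=> z0; rewrite mule_ge0 ?lee_fin ?normal_pdf_ge0// killed_steps_ge0.
have Se : `[e, +oo[%classic `<=` (`[0, +oo[%classic : set R).
  by move=> z /=; rewrite !in_itv/= !andbT; apply: le_trans; exact: ltW.
have Se' : `[e, +oo[%classic `<=` (`]0, +oo[%classic : set R).
  by move=> z /=; rewrite !in_itv/= !andbT; apply: lt_le_trans.
have S : `]0, +oo[%classic `<=` (`[0, +oo[%classic : set R).
  by move=> z /=; rewrite !in_itv/= !andbT => /ltW.
have xe0 : 0 <= x + e by rewrite addr_ge0// ltW.
set dl := expR (- (e ^+ 2 / (4 * w ^+ 2 * h))).
have dl0 : 0 <= dl by exact: expR_ge0.
(* Raising the start by [e] shifts the domain to [[e, +oo[], away from the boundary. *)
rewrite (_ : (\int[leb]_(z in `[0%R, +oo[) _)%E =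
    (\int[leb]_(z in `[e, +oo[) F (x + e + b * h)%R z)%E); last first.
  rewrite -ge0_integral_itv_shift.
  - apply: eq_integral => z _; rewrite /F (_ : x + e + b * h = x + b * h + e); last by ring.
    by rewrite normal_pdf_shift.
  - exact: (measurable_funS _ Se).
  - by move=> z ez; apply: F0; exact: le_trans (ltW e0) ez.
(* The free Gaussian is the absorbed kernel plus its image term. The image term is at most [dl]
   times a Gaussian of mass 1 and the remaining factor is at most 1, so the excess integrates to at
   most [dl]. *)
pose G z := ((alpha_hat b w z h (x + e))%:E * killed_steps b w f h m z +
    (dl * normal_pdf (b * h) s z)%:E)%E.
have mA : measurable_fun (`]0, +oo[%classic : set R)
    (fun z => (alpha_hat b w z h (x + e))%:E * killed_steps b w f h m z)%E.
  apply: emeasurable_funM.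
    by apply: measurable_funTS; apply/measurable_EFinP; exact: measurable_alpha_hat.
  exact: (measurable_funS _ S (measurable_killed_steps b m w0 h0 mf f0)).
have A0 z : 0 < z -> (0 <= (alpha_hat b w z h (x + e))%:E * killed_steps b w f h m z)%E.
  move=> z0; apply: mule_ge0; last by apply: killed_steps_ge0 => //; exact: ltW.
  by rewrite lee_fin; apply: alpha_hat_ge0 => //; exact: ltW.
have mN : measurable_fun setT (fun z : R => (dl * normal_pdf (b * h) s z)%:E).
  by apply/measurable_EFinP; apply: measurable_funM => //; exact: measurable_normal_pdf.
have N0 z : (0 <= (dl * normal_pdf (b * h) s z)%:E)%E.
  by rewrite lee_fin mulr_ge0// normal_pdf_ge0.
have mG : measurable_fun (`]0, +oo[%classic : set R) G.
  by apply: emeasurable_funD => //; exact: measurable_funTS.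
have G0 z : 0 < z -> (0 <= G z)%E by move=> z0; rewrite adde_ge0// A0.
apply: (@le_trans _ _ (\int[leb]_(z in `[e, +oo[) G z)%E).
  apply: ge0_le_integral => //.
  - move=> z /=; rewrite in_itv/= andbT => ez.
    by apply: F0; exact: le_trans (ltW e0) ez.
  - exact: (measurable_funS _ Se).
  - exact: (measurable_funS _ Se').
  - move=> z /=; rewrite in_itv/= andbT => ez.
    have z0 : 0 < z by exact: lt_le_trans ez.
    have zV0 := killed_steps_ge0 b m w0 h0 (ltW z0) f0.
    have zV1 := killed_steps_le b m w0 h0 (ltW z0) mf f01.
    rewrite /F /G alpha_hatE//.
    apply: lee_affine_unit => // v v0 v1.
    have ex : e <= x + e by rewrite lerDr.
    have := reflected_normal_pdf_le w0 h0 e0 ex (ltW z0) bh.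
    rewrite -/s -/dl.
    have := normal_pdf_ge0 (- (x + e) + b * h) s z.
    have := expR_ge0 (- (2 * b * (x + e) / w ^+ 2)).
    move: (expR _) (normal_pdf (- (x + e) + b * h) s z) => c q c0 q0 H.
    have : c * q * v <= dl * normal_pdf (b * h) s z.
      by apply: le_trans H; rewrite ler_piMr// mulr_ge0.
    lra.
apply: (@le_trans _ _ (\int[leb]_(z in `]0%R, +oo[) G z)%E).
  apply: ge0_subset_integral => //.
  by move=> z /=; rewrite in_itv/= andbT; exact: G0.
rewrite ge0_integralD//; first last.
- exact: measurable_funTS.
- by move=> z /=; rewrite in_itv/= andbT; exact: A0.
rewrite killed_stepsS// leeD2l//.
rewrite -[leRHS]mule1 -(integral_normal_pdf (b * h) s) -ge0_integralZl//.
- under [leRHS]eq_integral do rewrite -EFinM.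
  by apply: ge0_subset_integral.
- by apply/measurable_EFinP; exact: measurable_normal_pdf.
- by move=> z _; rewrite lee_fin normal_pdf_ge0.
Qed.

(** The Radon-Nikodym derivative of [m] has the same integrals over measurable sets as [g], hence
    equals it almost everywhere. *)
Lemma ge0_integral_density R (m : {finite_measure set (measurableTypeR R) -> \bar R})
    (g : R -> R) (f : R -> \bar R) :
  leb.-integrable setT (EFin \o g) -> (forall x, 0 <= g x) ->
  (forall A, measurable A -> m A = \int[leb]_(x in A) (g x)%:E)%E ->
  measurable_fun setT f -> (forall x, (0 <= f x)%E) ->
  (\int[m]_x f x = \int[leb]_x ((g x)%:E * f x))%E.
Proof.
move=> ig g0 mE mf f0; have mg := measurable_int _ ig.
have m_mu : m `<< (@leb R).
  apply/null_content_dominatesP => A mA A0; rewrite mE//.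
  by apply: null_set_integral => //; exact: measurable_funTS.
rewrite -(Radon_Nikodym_SigmaFinite.change_of_variables m_mu)//.
transitivity (\int[leb]_x (f x * (g x)%:E))%E; last first.
  by apply: eq_integral => x _; rewrite muleC.
apply: ge0_ae_eq_integral => //.
- apply: emeasurable_funM => //.
  by apply: measurable_int; exact: (Radon_Nikodym_SigmaFinite.f_integrable m_mu).
- exact: emeasurable_funM.
- by move=> x _; rewrite mule_ge0// (Radon_Nikodym_SigmaFinite.f_ge0 m_mu).
- by move=> x _; rewrite mule_ge0// lee_fin.
apply: ae_eqe_mul2l; apply: integral_ae_eq => //.
- exact: (Radon_Nikodym_SigmaFinite.f_integrable m_mu).
- by move=> A _ mA; rewrite -(Radon_Nikodym_SigmaFinite.f_integral m_mu)// mE.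
Qed.

Lemma ge0_integral_normal_prob R (m s : R) (f : R -> \bar R) :
  measurable_fun setT f -> (forall x, (0 <= f x)%E) ->
  (\int[normal_prob m s]_x f x =
   \int[leb]_x ((normal_pdf m s x)%:E * f x))%E.
Proof.
apply: (@ge0_integral_density _ (normal_prob m s) (normal_pdf m s)) => //.
- exact: integrable_normal_pdf.
- by move=> x; exact: normal_pdf_ge0.
Qed.

Lemma measurable_comp_nneg d (T : measurableType d) R (D : set T)
    (g : T -> R) (f : R -> \bar R) : measurable_fun (`[0, +oo[%classic : set R) f ->
  measurable_fun D g -> (forall x, D x -> 0 <= g x) -> measurable_fun D (fun x => f (g x)).
Proof.
move=> mf mg g0; apply: (measurable_comp _ _ mf mg) => //.
by move=> _ [x Dx <-]; rewrite /= in_itv/= andbT; exact: g0.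
Qed.

(** For fixed [D], both sides are finite measures in [C] that agree on a pi-system containing the
    whole space. *)
Lemma prob_indep_generated d (T : measurableType d) R (P : probability T R)
    (G : set (set T)) (D C : set T) : G `<=` measurable -> setI_closed G -> G setT ->
  measurable D -> (forall B, G B -> P (D `&` B) = P D * P B)%E ->
  <<s G >> C -> (P (D `&` C) = P D * P C)%E.
Proof.
move=> GM GI GT mD DG sC; have c0 : 0 <= fine (P D) by exact: fine_ge0.
have cov : \bigcup_(k : nat) (fun=> [set: T]) k = setT by apply/seteqP; split => // x _; exists 0%N.
have := @g_sigma_algebra_measure_unique _ R T _ GM (fun=> setT) (fun=> GT) cov
  (mrestr P mD) (mscale (NngNum c0) P) GI _ _ C sC.
rewrite /= /mrestr /mscale/= fineK ?fin_num_measure// [C `&` _]setIC; apply.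
- by move=> B GB; rewrite setIC DG.
- by move=> _; rewrite setTI; apply: le_lt_trans (probability_le1 _ _) (ltry _).
Qed.

(** * Sampling a Wiener path on a grid *)

Definition increment_cylinders (T : Type) R (W : R -> T -> R) (h : R) (n : nat) :
    set (set T) :=
  [set A | exists2 B : nat -> set R, (forall k, measurable (B k)) &
    A = [set w | forall k, (k < n)%N -> B k (W (k.+1%:R * h) w - W (k%:R * h) w)]].

Definition grid_nneg (T : Type) R (W : R -> T -> R) (h : R) (n : nat) (x : R) : set T :=
  [set o | forall k, (k <= n)%N -> 0 <= x + W (k%:R * h) o].

Section grid.
Context d (T : measurableType d) R (P : probability T R) (b w : R)
  (W : R -> T -> R) (h : R).
Hypothesis hW : wiener_process P b w W.
Hypothesis h0 : 0 < h.

Let tk (k : nat) : 0 <= k%:R * h.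
Proof. by rewrite mulr_ge0// ltW. Qed.

Let mincr k : measurable_fun setT (fun x => W (k.+1%:R * h) x - W (k%:R * h) x).
Proof. by apply: measurable_funB; exact: (wiener_measurable hW). Qed.

Let Gm n : increment_cylinders W h n `<=` measurable.
Proof.
move=> A [B mB ->].
rewrite (_ : [set _ | _] = \bigcap_(k in [set k | (k < n)%N])
   ((fun x => W (k.+1%:R * h) x - W (k%:R * h) x) @^-1` B k)); last first.
  by apply/seteqP; split => x.
have [->|n0] := eqVneq n 0%N.
  by rewrite (_ : [set k | _] = set0) ?bigcap_set0//; apply/seteqP; split => k //=.
apply: bigcap_measurable => [|k _]; first by exists 0%N; rewrite /= lt0n.
by rewrite -[X in measurable X]setTI; exact: mincr.
Qed.

Let GT n : increment_cylinders W h n setT.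
Proof. by exists (fun=> setT) => //; apply/seteqP; split. Qed.

Let GI n : setI_closed (increment_cylinders W h n).
Proof.
move=> A A' [B mB ->] [B' mB' ->]; exists (fun k => B k `&` B' k).
  by move=> k; exact: measurableI.
apply/seteqP; split => x.
- by move=> [H H'] k kn; split; [exact: H|exact: H'].
- by move=> H; split => k kn; case: (H _ kn).
Qed.

Lemma increment_prob k C : measurable C ->
  P [set x | C (W (k.+1%:R * h) x - W (k%:R * h) x)] =
  normal_prob (b * h) (w * Num.sqrt h) C.
Proof.
move=> mC; have kk : k%:R * h < k.+1%:R * h by rewrite ltr_pM2r// ltr_nat.
have := wiener_increment hW (tk k) kk mC => ->.
by rewrite -natr1 mulrDl mul1r addrAC subrr add0r.
Qed.

Let mcyl n k C : (k < n)%N -> measurable C ->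
  increment_cylinders W h n ((fun x => W (k.+1%:R * h) x - W (k%:R * h) x) @^-1` C).
Proof.
move=> kn mC; exists (fun j => if j == k then C else setT).
  by move=> j; case: ifP.
apply/seteqP; split => x /= H; first by move=> j jn; case: eqP => [->|].
by have := H k kn; rewrite eqxx.
Qed.

Let cyl_indep n A (C : set R) : increment_cylinders W h n A -> measurable C ->
  (P (A `&` [set x | C (W (n.+1%:R * h) x - W (n%:R * h) x)%R]) =
   P A * normal_prob (b * h) (w * Num.sqrt h) C)%E.
Proof.
move=> [B mB ->] mC.
pose B' k := if (k < n)%N then B k else C.
have mB' k : measurable (B' k) by rewrite /B'; case: ifP.
have tS (k : nat) : k%:R * h <= k.+1%:R * h by rewrite ler_pM2r// ler_nat.
have t0 : 0 <= 0%:R * h by rewrite mul0r.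
have := wiener_independent hW n.+1 t0 tS mB'.
have B'n : B' n = C by rewrite /B' ltnn.
rewrite big_ord_recr /= B'n increment_prob// => E1.
have := wiener_independent hW n t0 tS mB => ->.
rewrite [X in P X](_ : _ =
  [set x | forall k, (k < n.+1)%N -> B' k (W (k.+1%:R * h) x - W (k%:R * h) x)]).
  rewrite E1; congr (_ * _)%E; apply: eq_bigr => i _.
  by rewrite /B' ltn_ord.
apply/seteqP; split => x /=.
- move=> [H Cx] k; rewrite ltnS leq_eqVlt /B' => /predU1P[->|kn]; first by rewrite ltnn.
  by rewrite kn; exact: H.
- move=> H; split.
    by move=> k kn; have := H k (ltnW kn); rewrite /B' kn.
  by have := H n (ltnSn n); rewrite /B' ltnn.
Qed.

(** The axiom on independent increments covers cylinders only; these form a pi-system, so the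
    statement extends to the sigma-algebra of the first [n] increments. *)
Lemma past_increment_indep n A (C : set R) : <<s increment_cylinders W h n >> A -> measurable C ->
  (P (A `&` [set x | C (W (n.+1%:R * h) x - W (n%:R * h) x)%R]) =
   P A * normal_prob (b * h) (w * Num.sqrt h) C)%E.
Proof.
move=> sA mC.
have mD : measurable [set x | C (W (n.+1%:R * h) x - W (n%:R * h) x)].
  by rewrite -[X in measurable X]setTI; exact: mincr.
have PD : P [set x | C (W (n.+1%:R * h) x - W (n%:R * h) x)] = _ := increment_prob n mC.
rewrite -PD setIC muleC; apply: (prob_indep_generated (@Gm n) (@GI n) (GT n) mD) => // X GX.
by rewrite setIC cyl_indep// PD muleC.
Qed.

Let T' n := g_sigma_algebraType (increment_cylinders W h n).

(** The path starts at 0, so its grid values are sums of increments and belong to the past generated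
    by the increments alone. *)
Lemma measurable_past n k : (k <= n)%N -> @measurable_fun _ _ (T' n) _ setT (W (k%:R * h)).
Proof.
elim: k => [_|k IH kn].
  rewrite mul0r (_ : W 0 = cst 0) ; first exact: measurable_cst.
  by apply/funext => x; rewrite (wiener_start hW).
rewrite (_ : W _ = (fun x => (W (k.+1%:R * h) x - W (k%:R * h) x) + W (k%:R * h) x)).
  apply: measurable_funD; last by apply: IH; exact: ltnW.
  move=> _ C mC; rewrite setTI; apply: sub_sigma_algebra; exact: mcyl.
by apply/funext => x; rewrite subrK.
Qed.

Lemma measurable_past_nneg n (x : R) :
  <<s increment_cylinders W h n >> (grid_nneg W h n x).
Proof.
change (@measurable _ (T' n) (grid_nneg W h n x)).
rewrite (_ : grid_nneg W h n x = \bigcap_(k in [set k | (k <= n)%N])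
   ((fun o => x + W (k%:R * h) o) @^-1` `[0, +oo[)); last first.
  by apply/seteqP; split => o /= H k /= kn; have := H k kn; rewrite /= in_itv/= andbT.
apply: bigcap_measurable => [|k /= kn]; first by exists 0%N.
have : @measurable_fun _ _ (T' n) _ setT (fun o => x + W (k%:R * h) o).
  by apply: measurable_funD; [exact: measurable_cst|exact: measurable_past].
by move=> /(_ measurableT _ (measurable_itv `[0, +oo[)); rewrite setTI.
Qed.

Lemma increment_cylinders_measurable n A :
  <<s increment_cylinders W h n >> A -> measurable A.
Proof. by apply: smallest_sub; [exact: sigma_algebra_measurable|exact: Gm]. Qed.

Let measurable_grid n x : measurable (grid_nneg W h n x).
Proof. exact: increment_cylinders_measurable (@measurable_past_nneg n x). Qed.

Let measurable_comp_grid n x (g : R -> \bar R) : measurable_fun (`[0, +oo[%classic : set R) g ->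
  measurable_fun (grid_nneg W h n x) (fun o => g (x + W (n%:R * h) o)).
Proof.
move=> mg; apply: (measurable_comp_nneg mg) => [|o]; last by apply.
by apply: measurable_funTS; apply: measurable_funD => //; exact: (wiener_measurable hW).
Qed.

Let grid_nneg0 x : 0 <= x -> grid_nneg W h 0 x = setT.
Proof.
move=> x0; apply/seteqP; split => // o _ k; rewrite leqn0 => /eqP ->.
by rewrite mul0r (wiener_start hW) addr0.
Qed.

(** The Markov property for one grid step: the last increment is integrated out under its normal
    law, with the past frozen on the survival event. *)
Lemma killed_grid_step n (x : R) (psi : R -> \bar R) :
  w != 0 -> measurable_fun (`[0, +oo[%classic : set R) psi ->
  (forall z, 0 <= z -> (0 <= psi z)%E) ->
  (\int[P]_(o in grid_nneg W h n.+1 x)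
     psi (x + W (n.+1%:R * h) o)%R =
   \int[P]_(o in (grid_nneg W h n x))
     \int[leb]_(z in `[0%R, +oo[)
       ((normal_pdf (x + W (n%:R * h) o + b * h) (w * Num.sqrt h) z)%:E * psi z))%E.
Proof.
move=> w0 mpsi psi0; set s := w * Num.sqrt h.
have s0 : s != 0 by exact: scale_sqrt_neq0.
(* Extension by 0 encodes the last sign test, so the domain of integration shrinks from n + 1 to n
   tests and belongs to the past. *)
pose phi := psi \_ `[0, +oo[.
have mphi : measurable_fun [set: R] phi by apply/(measurable_restrictT _ _).1.
have phi0 z : (0 <= phi z)%E.
  by apply: erestrict_ge0 => y /=; rewrite in_itv/= andbT; exact: psi0.
pose f (z : R * R) := phi (x + z.1 + z.2).
have mf : measurable_fun setT f.
  by apply: measurableT_comp => //; apply: measurable_funD => //; apply: measurable_funD.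
set A := grid_nneg W h n x.
have sA : <<s increment_cylinders W h n >> A by exact: measurable_past_nneg.
have mA : measurable A by exact: increment_cylinders_measurable sA.
have := @ge0_integral_indep _ _ _ T _ _ R P (normal_prob (b * h) s) A (W (n%:R * h))
  (fun o => W (n.+1%:R * h) o - W (n%:R * h) o) f mA (wiener_measurable hW (tk n)) (mincr n) _ mf _.
move=> H; transitivity (\int[P]_(o in A) f (W (n%:R * h) o, W (n.+1%:R * h) o - W (n%:R * h) o)%R)%E.
  rewrite integral_mkcond [RHS]integral_mkcond; apply: eq_integral => o _.
  rewrite /patch /f /= (_ : x + W (n%:R * h) o + _ = x + W (n.+1%:R * h) o); last by ring.
  rewrite /phi /patch.
  rewrite !mem_setE /= in_itv/= andbT.
  case: ifPn => [/set_mem /= Ho|Ho].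
    rewrite Ho// ifT// inE /A /= => k kn; exact/Ho/ltnW.
  case: ifPn => // /set_mem HA; case: ifPn => // Hn.
  move/negP : Ho; case; apply/mem_set => k; rewrite leq_eqVlt => /predU1P[->//|].
  by rewrite ltnS; exact: HA.
rewrite H; last 2 first.
- move=> B C mB mC; apply: past_increment_indep => //.
  change (@measurable _ (T' n) (A `&` W (n%:R * h) @^-1` B)).
  apply: measurableI => //.
  by have /(_ measurableT B mB) := measurable_past (leqnn n); rewrite setTI.
- by move=> z; exact: phi0.
apply: eq_integral => o _.
rewrite ge0_integral_normal_prob//; last 2 first.
- exact: measurableT_comp.
- by move=> z; exact: phi0.
rewrite [RHS]integral_mkcond.
rewrite [RHS](@ge0_integral_affine _ 1 (x + W (n%:R * h) o))//; last 2 first.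
- apply/(measurable_restrictT _ _).1 => //; apply: emeasurable_funM => //.
  by apply: measurable_funTS; apply/measurable_EFinP; exact: measurable_normal_pdf.
- move=> z; apply: erestrict_ge0 => y /=; rewrite in_itv/= andbT => y0.
  by rewrite mule_ge0 ?psi0// lee_fin normal_pdf_ge0.
rewrite mul1e; apply: eq_integral => z _; rewrite /f /phi /patch /= mul1r.
rewrite [z + _]addrC; case: ifPn => _; last by rewrite mule0.
by congr (_%:E * _)%E; rewrite [_ + b * h]addrC [_ + z]addrC normal_pdf_shift.
Qed.

(** Interpolates by hybrids: m steps of the sampled path followed by n - m steps of the absorbed
    kernel. Each exchange of one absorbed step for a sampled one can only increase the
    expectation. *)
Lemma killed_grid_lower n (x : R) (f : R -> R) : w != 0 -> 0 <= x ->
  measurable_fun setT f -> (forall z, 0 <= f z) ->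
  (killed_steps b w f h n x <=
   \int[P]_(o in (grid_nneg W h n x))
     (f (x + W (n%:R * h) o))%:E)%E.
Proof.
move=> w0 x0 mf f0.
pose A m := grid_nneg W h m x.
have mA m : measurable (A m) by exact: measurable_grid.
have mfA m := @measurable_comp_grid m x.
suff H m : (m <= n)%N -> (killed_steps b w f h n x <=
   \int[P]_(o in A m) killed_steps b w f h (n - m) (x + W (m%:R * h) o)%R)%E.
  by have := H n (leqnn n); rewrite subnn.
elim: m => [_|m IH mn].
  rewrite /A grid_nneg0//.
  rewrite subn0; under eq_integral do rewrite mul0r (wiener_start hW) addr0.
  by rewrite integral_cst// [X in (_ * X)%E]probability_setT mule1.
apply: (le_trans (IH (ltnW mn))).
rewrite killed_grid_step//; last 2 first.
- exact: measurable_killed_steps.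
- by move=> z z0; exact: killed_steps_ge0.
have nm : (n - m = (n - m.+1).+1)%N by rewrite subnSK.
apply: ge0_le_integral => //.
- by move=> o Ao; apply: killed_steps_ge0 => //; exact: Ao.
- by apply: (mfA m (killed_steps b w f h (n - m))); exact: measurable_killed_steps.
- apply: (mfA m (fun y => \int[leb]_(z in `[0%R, +oo[)
     ((normal_pdf (y + b * h) (w * Num.sqrt h) z)%:E * killed_steps b w f h (n - m.+1) z))%E).
  apply: (measurable_integral_in leb) => //.
    apply: emeasurable_funM.
      apply: measurable_funTS; apply/measurable_EFinP; apply: measurable_normal_pdf2 => //.
        exact: scale_sqrt_neq0.
      exact: measurable_funD.
    apply: (measurable_comp_nneg (g := fun z => z.2) (f := killed_steps b w f h (n - m.+1))).
    - exact: measurable_killed_steps.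
    - by apply: measurable_funTS; exact: measurable_snd.
    - by move=> [u v] [/= _]; rewrite in_itv/= andbT.
  move=> y z /= _; rewrite in_itv/= andbT => z0.
  by rewrite mule_ge0 ?killed_steps_ge0// lee_fin normal_pdf_ge0.
- by move=> o Ao; rewrite nm; apply: killed_steps_lower => //; exact: Ao.
Qed.

(** The same hybrids, with the absorbed part started [e] higher. Each exchange costs at most [dl] on
    an event of probability at most 1, whence the factor n. *)
Lemma killed_grid_upper n (x e : R) (f : R -> R) : w != 0 -> 0 <= x ->
  0 < e -> 4 * `|b| * h <= e ->
  measurable_fun setT f -> (forall z, 0 <= f z <= 1) ->
  (\int[P]_(o in grid_nneg W h n x) (f (x + W (n%:R * h) o + e))%:E <=
   killed_steps b w f h n (x + e)%R +
     (n%:R * expR (- (e ^+ 2 / (4 * w ^+ 2 * h))))%:E)%E.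
Proof.
move=> w0 x0 e0 bh mf f01; have f0 z : 0 <= f z by case/andP: (f01 z).
set dl := expR _.
pose A m := grid_nneg W h m x.
have mA m : measurable (A m) by exact: measurable_grid.
have mfA m := @measurable_comp_grid m x.
have mV m : measurable_fun (`[0, +oo[%classic : set R) (fun z => killed_steps b w f h m (z + e)).
  apply: (measurable_comp_nneg (g := fun z : R => z + e) (f := killed_steps b w f h m)).
  - exact: measurable_killed_steps.
  - by apply: measurable_funTS; exact: measurable_funD.
  - by move=> z /=; rewrite in_itv/= andbT => z0; rewrite addr_ge0// ltW.
have V0 m z : 0 <= z -> (0 <= killed_steps b w f h m (z + e)%R)%E.
  by move=> z0; apply: killed_steps_ge0 => //; rewrite addr_ge0// ltW.
suff H m : (m <= n)%N ->
   (\int[P]_(o in A m) killed_steps b w f h (n - m) (x + W (m%:R * h) o + e)%R <=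
    killed_steps b w f h n (x + e)%R + (m%:R * dl)%:E)%E.
  by have := H n (leqnn n); rewrite subnn.
elim: m => [_|m IH mn].
  rewrite /A grid_nneg0//.
  rewrite subn0; under eq_integral do rewrite mul0r (wiener_start hW) addr0.
  by rewrite integral_cst// [X in (_ * X)%E]probability_setT mule1 mul0r adde0.
rewrite (@killed_grid_step m x (fun z => killed_steps b w f h (n - m.+1) (z + e)) w0 (mV _) (V0 _)) -/(A m).
have nm : (n - m = (n - m.+1).+1)%N by rewrite subnSK.
rewrite -natr1 mulrDl mul1r EFinD addeA.
apply: (@le_trans _ _ (\int[P]_(o in A m) (killed_steps b w f h (n - m) (x + W (m%:R * h) o + e)%R + dl%:E))%E).
  apply: ge0_le_integral => //.
  - move=> o Ao; apply: integral_ge0 => z /=; rewrite in_itv/= andbT => z0.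
    by rewrite mule_ge0 ?V0// lee_fin normal_pdf_ge0.
  - apply: (mfA m (fun y => \int[leb]_(z in `[0%R, +oo[)
     ((normal_pdf (y + b * h) (w * Num.sqrt h) z)%:E * killed_steps b w f h (n - m.+1) (z + e)%R))%E).
    apply: (measurable_integral_in leb) => //.
      apply: emeasurable_funM.
        apply: measurable_funTS; apply/measurable_EFinP; apply: measurable_normal_pdf2 => //.
          exact: scale_sqrt_neq0.
        exact: measurable_funD.
      apply: (measurable_comp_nneg (g := fun z => z.2)
        (f := fun z => killed_steps b w f h (n - m.+1) (z + e))) => //.
        by apply: measurable_funTS; exact: measurable_snd.
      by move=> [u v] [/= _]; rewrite in_itv/= andbT.
    move=> y z /= _; rewrite in_itv/= andbT => z0.
    by rewrite mule_ge0 ?V0// lee_fin normal_pdf_ge0.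
  - apply: emeasurable_funD => //.
    exact: (mfA m (fun z => killed_steps b w f h (n - m) (z + e))).
  - by move=> o Ao; rewrite nm; apply: killed_steps_upper => //; exact: Ao.
rewrite ge0_integralD//; first last.
- by move=> o Ao; rewrite lee_fin expR_ge0.
- exact: (mfA m (fun z => killed_steps b w f h (n - m) (z + e))).
- by move=> o Ao; apply: V0; exact: Ao.
apply: leeD; first exact: (IH (ltnW mn)).
rewrite integral_cst// -[leRHS]mule1; apply: lee_wpmul2l; first by rewrite lee_fin expR_ge0.
exact: probability_le1.
Qed.
End grid.

(** One Gaussian dominates a whole neighbourhood of parameters. The ratio of the normalising
    constants is at most sqrt 8 <= 3; for the exponents, (z - c0)^2 <= 2 (z - c)^2 + 2, and the
    constant is absorbed in exp(1 / s0^2). *)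
Lemma normal_pdf_dominated R (c c0 s s0 z : R) : s0 != 0 ->
  `|c - c0| <= 1 -> s0 ^+ 2 / 2 <= s ^+ 2 -> s ^+ 2 <= 2 * s0 ^+ 2 ->
  normal_pdf c s z <= 3 * expR ((s0 ^+ 2)^-1) * normal_pdf c0 (2 * s0) z.
Proof.
move=> s00 cc ss ss'.
have h0 : 0 < s0 ^+ 2 by rewrite exprn_even_gt0.
have h : 0 < s ^+ 2 by apply: lt_le_trans ss; rewrite divr_gt0.
have s_0 : s != 0 by apply: contraTneq h => ->; rewrite expr0n/= ltxx.
have t0 : 2 * s0 != 0 by rewrite mulf_neq0// pnatr_eq0.
rewrite !normal_pdf_expE// [leRHS]mulrACA -expRD; apply: ler_pM.
- by rewrite invr_ge0 sqrtr_ge0.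
- exact: expR_ge0.
- rewrite -[leLHS]mul1r ler_pdivrMr ?sqrtr_gt0; last by rewrite mulr_gt0// mulr_gt0// pi_gt0.
  rewrite mulrAC ler_pdivlMr ?sqrtr_gt0; last first.
    by rewrite mulr_gt0 ?exprn_even_gt0// mulr_gt0// pi_gt0.
  rewrite mul1r -[X in _ <= X * _](_ : Num.sqrt 9 = 3); last first.
    by rewrite (_ : 9 = 3 ^+ 2) ?sqrtr_sqr ?ger0_norm//; ring.
  rewrite -sqrtrM// ler_wsqrtr//.
  rewrite exprMn (_ : _ * (2 ^+ 2 * _) = 2 * pi * (4 * s0 ^+ 2)); last by ring.
  rewrite [leRHS]mulrCA ler_pM2l ?mulr_gt0 ?pi_gt0//; lra.
- rewrite ler_expR.
  have cc2 : (c - c0) ^+ 2 <= 1 by rewrite -[leRHS](expr1n _ 2) -real_normK ?num_real// lerXn2r// ?nnegrE.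
  have H1 : - ((z - c) ^+ 2 / (2 * s ^+ 2)) <= - ((z - c) ^+ 2 / (4 * s0 ^+ 2)).
    rewrite lerN2 ler_wpM2l ?sqr_ge0// lef_pV2 ?posrE; lra.
  apply: (le_trans H1); rewrite -subr_ge0.
  rewrite [X in 0 <= X](_ : _ =
     (8 + 2 * (z - c) ^+ 2 - (z - c0) ^+ 2) / (8 * s0 ^+ 2)); last by field.
  rewrite divr_ge0//; last by rewrite mulr_ge0// ltW.
  have : 0 <= ((z - c) - (c - c0)) ^+ 2 by exact: sqr_ge0.
  nra.
Qed.

Lemma cvg_sqr R (I : Type) (F : set_system I) {FF : Filter F} (u : I -> R) (l : R) :
  u @ F --> l -> u n ^+ 2 @[n --> F] --> l ^+ 2.
Proof. by move=> ul; rewrite expr2; under eq_fun do rewrite expr2; exact: cvgM. Qed.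

(** From exp u = exp(u/2)^2 and exp(u/2) >= 1 + u/2. It beats the number of grid steps in the error
    term. *)
Lemma sqr_le_expR R (u : R) : 0 <= u -> u ^+ 2 <= 4 * expR u.
Proof.
move=> u0; have -> : expR u = expR (u / 2) ^+ 2.
  by rewrite expr2 -expRD -splitr.
have := expR_ge1Dx (u / 2); have := expR_ge0 (u / 2); nra.
Qed.

Lemma cvg_alpha_hat R (I : Type) (F : set_system I) {FF : Filter F}
    (b w z t x : R) (z_ t_ x_ : I -> R) :
  w != 0 -> 0 < t -> z_ @ F --> z -> t_ @ F --> t -> x_ @ F --> x ->
  alpha_hat b w (z_ n) (t_ n) (x_ n) @[n --> F] --> alpha_hat b w z t x.
Proof.
move=> w0 t0 zz tt xx; rewrite /alpha_hat.
have w2 : 0 < w ^+ 2 by rewrite exprn_even_gt0.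
have q0 : 2 * w ^+ 2 * t != 0 by rewrite gt_eqF// mulr_gt0// mulr_gt0.
have cq : (fun n => 2 * w ^+ 2 * t_ n) @ F --> 2 * w ^+ 2 * t.
  by apply: cvgM => //; exact: cvg_cst.
apply: cvgM.
  apply: cvgV; first by rewrite gt_eqF// sqrtr_gt0 mulr_gt0// mulr_gt0// mulr_gt0// pi_gt0.
  apply: continuous_cvg; first exact: sqrt_continuous.
  by apply: cvgM => //; exact: cvg_cst.
apply: cvgB.
  apply: continuous_cvg; [exact: continuous_expR|apply: cvgN].
  apply: cvgM; last exact: cvgV.
  apply: cvg_sqr.
  apply: cvgB; last by apply: cvgM => //; exact: cvg_cst.
  exact: cvgB.
apply: cvgM.
  apply: continuous_cvg; [exact: continuous_expR|apply: cvgN].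
  by apply: cvgM; [apply: cvgM => //|]; exact: cvg_cst.
apply: continuous_cvg; [exact: continuous_expR|apply: cvgN].
apply: cvgM; last exact: cvgV.
apply: cvg_sqr.
apply: cvgB; last by apply: cvgM => //; exact: cvg_cst.
exact: cvgD.
Qed.

(** Joint continuity in time, start and test function; the test functions vary because they will
    depend on the remaining time or on the shift [e]. *)
Lemma cvg_killed R (b w t x : R) (f : R -> R) (t_ x_ : nat -> R)
    (f_ : nat -> R -> R) : w != 0 -> 0 < t -> (forall n, 0 <= x_ n) ->
  t_ @ \oo --> t -> x_ @ \oo --> x ->
  (forall n, measurable_fun setT (f_ n)) -> (forall n z, 0 <= f_ n z <= 1) ->
  (forall z, 0 < z -> f_ n z @[n --> \oo] --> f z) ->
  killed b w (f_ n) (t_ n) (x_ n) @[n --> \oo] --> killed b w f t x.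
Proof.
move=> w0 t0 x0 tt xx mf f01 ff.
have s0 : w * Num.sqrt t != 0 by exact: scale_sqrt_neq0.
have [N _ HN] : \forall n \near \oo, [/\ t / 2 <= t_ n, t_ n <= 2 * t &
    `|(x_ n + b * t_ n) - (x + b * t)| <= 1].
  have c1 : (fun n => x_ n + b * t_ n) @ \oo --> x + b * t.
    by apply: cvgD => //; apply: cvgM => //; exact: cvg_cst.
  near=> n; split.
  - near: n; apply: (cvgr_ge t) => //; lra.
  - near: n; apply: (cvgr_le t) => //; lra.
  - rewrite distrC; near: n; move/cvgrPdist_le : c1; exact.
(* The domination only holds from rank [N] on, so the sequence is shifted. *)
rewrite -(cvg_shiftn N).
pose g z := (3 * expR (((w * Num.sqrt t) ^+ 2)^-1) *
  normal_pdf (x + b * t) (2 * (w * Num.sqrt t)) z)%:E.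
apply: (@dominated_cvg _ _ _ leb _ (measurable_itv `]0, +oo[) _ _ g).
- move=> n; apply: measurable_funTS; apply/measurable_EFinP; apply: measurable_funM; last exact: mf.
  exact: measurable_alpha_hat.
- move=> z /=; rewrite in_itv/= andbT => z0.
  apply: cvg_EFin; first exact: nearW.
  rewrite (cvg_shiftn N (fun n => alpha_hat b w z (t_ n) (x_ n) * f_ n z)).
  by apply: cvgM; [apply: cvg_alpha_hat => //; exact: cvg_cst|exact: ff].
- by [].
- apply: (integrableS measurableT) => //.
  rewrite /g; under eq_fun do rewrite EFinM.
  apply: integrableZl => //; exact: integrable_normal_pdf.
- move=> n z /=; rewrite in_itv/= andbT => z0.
  have /= [h1 h2 h3] := HN (n + N)%N (leq_addl _ _).
  have tn0 : 0 < t_ (n + N)%N by apply: lt_le_trans h1; rewrite divr_gt0.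
  have /andP[f0 f1] := f01 (n + N)%N z.
  have a0 : 0 <= alpha_hat b w z (t_ (n + N)%N) (x_ (n + N)%N).
    by apply: alpha_hat_ge0 => //; exact: ltW.
  rewrite lee_fin ger0_norm; last exact: mulr_ge0.
  apply: (@le_trans _ _ (alpha_hat b w z (t_ (n + N)%N) (x_ (n + N)%N))).
    by rewrite ler_piMr.
  apply: (le_trans (alpha_hat_le _ _ _ w0 tn0)).
  have w2 : 0 < w ^+ 2 by rewrite exprn_even_gt0.
  apply: normal_pdf_dominated => //; rewrite (sqr_scale_sqrt _ (ltW t0)) (sqr_scale_sqrt _ (ltW tn0)).
    by rewrite -mulrA ler_pM2l.
  by rewrite mulrCA ler_pM2l.
Unshelve. all: by end_near. Qed.

Definition stays_nneg (T : Type) R (z : R -> T -> R) (t : R) : set T :=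
  [set o | forall u, 0 <= u <= t -> 0 <= z u o].

Lemma within_nneg_continuous_lt R (z : R -> R) (u c : R) :
  {within `[0, +oo[, continuous z} -> 0 <= u -> z u < c ->
  \forall v \near u, 0 <= v -> z v < c.
Proof.
move=> /subspace_continuousP cz u0 zu.
have := cz u; rewrite /= in_itv/= andbT => /(_ u0) /cvgr_lt /(_ _ zu).
rewrite near_withinE; apply: filterS => v /= H v0; apply: H.
by rewrite /= in_itv/= andbT.
Qed.

(** By continuity a strict violation spreads to a neighbourhood and is seen at a rational time.
    Clamping to [0, t] lets the intersection run over all rationals. *)
Lemma measurable_stays_nneg d (T : measurableType d) R (z : R -> T -> R) (t : R) :
  0 <= t -> (forall u, 0 <= u -> measurable_fun setT (z u)) ->
  (forall o, {within `[0, +oo[, continuous (fun u => z u o)}) ->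
  measurable (stays_nneg z t).
Proof.
move=> t0 mz cz.
have v0 (q : R) : 0 <= Num.min (Num.max 0 q) t by rewrite le_min t0 le_max lexx.
rewrite (_ : stays_nneg z t = \bigcap_(q : rat)
   ((z (Num.min (Num.max 0 (ratr q)) t)) @^-1` `[0, +oo[)).
  rewrite -[X in measurable X]setCK setC_bigcap; apply: measurableC.
  apply: bigcupT_measurable_rat => q; apply: measurableC.
  by rewrite -[X in measurable X]setTI; apply: mz.
apply/seteqP; split => o /= H.
  by move=> q _; rewrite /= in_itv/= andbT; apply: H; rewrite v0 ge_min lexx orbT.
move=> u /andP[u0 ut]; rewrite leNgt; apply/negP => zu.
have /nbhs_ballP[e e0 He] := within_nneg_continuous_lt (cz o) u0 zu.
have [q] : exists q, ratr q \in `]u - e, u + e[.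
  by apply: rat_in_itvoo; rewrite ltrD2l -subr_gt0 opprK addr_gt0.
rewrite in_itv/= => /andP[q1 q2].
have := H q I; rewrite /= in_itv/= andbT leNgt => /negP; apply.
apply: He => //; rewrite /ball/= ltr_distl.
by case: (leP t _) => h1; move: h1; case: (leP _ (ratr q)) => h2 h1; apply/andP; split; lra.
Qed.

Lemma within_nneg_continuous_addl R (c : R) (z : R -> R) :
  {within `[0, +oo[, continuous z} -> {within `[0, +oo[, continuous (fun u => c + z u)}.
Proof.
move=> cz; apply: (@within_continuousD _ _ _ _ (cst c) z) => //.
by apply: continuous_subspaceT; exact: cst_continuous.
Qed.


Lemma measurable_stays_nneg_addl d (T : measurableType d) R (P : probability T R)
    (b w : R) (W : R -> T -> R) (x t : R) : wiener_process P b w W -> 0 <= t ->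
  measurable (stays_nneg (fun u o => x + W u o) t).
Proof.
move=> hW t0; apply: measurable_stays_nneg => // [u u0|o].
  by apply: measurable_funD => //; exact: (wiener_measurable hW).
exact/within_nneg_continuous_addl/(wiener_continuous hW).
Qed.

Section killed_law.
Context d (T : measurableType d) R (P : probability T R) (b w : R)
  (W : R -> T -> R).
Hypothesis hW : wiener_process P b w W.
Hypothesis w0 : w != 0.

Let hn (t : R) (n : nat) := t / n.+1%:R.

Let hnE t n : n.+1%:R * hn t n = t.
Proof. by rewrite /hn mulrC divfK// pnatr_eq0. Qed.

Let grid_le (t : R) (n k : nat) : 0 < t -> (k <= n.+1)%N -> 0 <= k%:R * hn t n <= t.
Proof.
move=> t0 kn; have h0 : 0 < hn t n by rewrite divr_gt0.
rewrite mulr_ge0 ?(ltW h0)//=.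
by rewrite -[leRHS](hnE t n) ler_pM2r// ler_nat.
Qed.

(** A violating path is negative on a ball around some [u]; once the mesh is below its radius, the
    last grid point before [u] lies in that ball. *)
Let grid_escape (x t : R) o : 0 < t ->
  ~ stays_nneg (fun u o => (x + W u o)%R) t o ->
  \forall n \near \oo, ~ grid_nneg W (hn t n) n.+1 x o.
Proof.
move=> t0 /existsNP[u /not_implyP[/andP[u0 ut] /negP]]; rewrite -ltNge => xu.
have xu' : W u o < - x by rewrite -ltrBrDl sub0r in xu.
have := within_nneg_continuous_lt (@wiener_continuous _ _ _ _ _ _ _ hW o) u0 xu'.
move=> /nbhs_ballP[e /= e0 He].
have [N _ HN] : \forall n \near \oo, hn t n < e.
  near=> n; rewrite /hn ltr_pdivrMr// mulrC -ltr_pdivrMr//.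
  near: n.
  have := @cvgry_gt _ _ _ _ _ (@cvgr_idn R) (t / e).
  case=> N _ HN; exists N => // n Nn.
  by apply: (lt_trans (HN n Nn)); rewrite ltr_nat.
exists N => // n Nn /= Hg.
have hn0 : 0 < hn t n by rewrite divr_gt0.
pose k := Num.truncn (u / hn t n).
have /andP[k1 k2] : k%:R <= u / hn t n < k.+1%:R.
  by apply: truncn_itv; rewrite divr_ge0// ltW.
have ku : k%:R * hn t n <= u by rewrite -ler_pdivlMr.
have uk : u < k.+1%:R * hn t n by rewrite -ltr_pdivrMr.
have kn : (k <= n.+1)%N.
  rewrite -(ler_nat R) -(ler_pM2r hn0) hnE; exact: le_trans ut.
have := Hg k kn; apply/negP; rewrite -ltNge -ltrBrDl sub0r; apply: He.
  rewrite /ball/= ger0_norm ?subr_ge0//.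
  rewrite ltrBlDl; apply: (lt_trans uk).
  by rewrite -natr1 mulrDl mul1r ltrD2l; exact: HN.
by rewrite mulr_ge0// ltW.
Unshelve. all: by end_near. Qed.

Let stay_grid (x t : R) : 0 < t ->
  stays_nneg (fun u o => (x + W u o)%R) t = \bigcap_n grid_nneg W (hn t n) n.+1 x.
Proof.
move=> t0; apply/seteqP; split => o.
  by move=> Ho n _ k kn; apply: Ho; exact: grid_le.
move=> Ho; apply: contrapT => /(grid_escape t0)[N _ HN].
by apply: (HN N (leqnn N)); exact: Ho.
Qed.

Lemma killed_law (x t : R) (f : R -> R) : 0 <= x -> 0 < t ->
  measurable_fun setT f -> (forall z, 0 <= f z <= 1) -> (forall z, 0 < z -> {for z, continuous f}) ->
  (\int[P]_(o in stays_nneg (fun u o => (x + W u o)%R) t) (f (x + W t o))%:E =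
   killed b w f t x)%E.
Proof.
move=> x0 t0 mf f01 cf; have f0 z : 0 <= f z by case/andP: (f01 z).
set S := stays_nneg _ t; have mS : measurable S.
  exact: (measurable_stays_nneg_addl x hW (ltW t0)).
have hn0 n : 0 < hn t n by rewrite divr_gt0.
have mA n : measurable (grid_nneg W (hn t n) n.+1 x).
  exact: (increment_cylinders_measurable hW (hn0 n) (@measurable_past_nneg _ _ _ _ _ _ _ _ hW n.+1 x)).
have SA n : S `<=` grid_nneg W (hn t n) n.+1 x.
  by rewrite /S stay_grid// => o; exact.
have mfW : measurable_fun setT (fun o => (f (x + W t o))%:E).
  apply/measurable_EFinP; apply: measurableT_comp => //; apply: measurable_funD => //.
  by apply: (wiener_measurable hW); exact: ltW.
apply/eqP; rewrite eq_le; apply/andP; split; last first.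
  have lower n : (killed b w f t x <=
      \int[P]_(o in grid_nneg W (hn t n) n.+1 x) (f (x + W t o))%:E)%E.
    have := killed_grid_lower hW (hn0 n) n.+1 w0 x0 mf f0.
    by rewrite /= hnE.
  (* The grids are not nested, so the grid events need not decrease; their indicators still converge
     pointwise, which is enough for dominated convergence. *)
  have cv : (\int[P]_o ((fun o => (f (x + W t o))%:E) \_ (grid_nneg W (hn t n) n.+1 x)) o)%E
      @[n --> \oo] --> (\int[P]_o ((fun o => (f (x + W t o))%:E) \_ S) o)%E.
    apply: (@dominated_cvg _ _ _ _ _ measurableT _ _ (cst 1%E)) => //.
    - by move=> n; apply/(measurable_restrictT _ _).1 => //; exact: measurable_funTS.
    - move=> o _; have [So|nSo] := pselect (S o).
        rewrite /patch mem_set//.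
        by apply: cvg_near_cst; apply: nearW => n; rewrite mem_set//; exact: SA.
      rewrite /patch (memNset nSo).
      apply: cvg_near_cst; have := grid_escape t0 nSo.
      by apply: filterS => n Hn; rewrite memNset.
    - by apply: finite_measure_integrable_cst.
    - move=> n o _; rewrite /patch; case: ifPn => _; rewrite ?abse0//.
      by rewrite gee0_abs ?lee_fin//; case/andP: (f01 (x + W t o)).
  rewrite [leRHS]integral_mkcond; apply: (cvge_to_ge cv).
  by apply: nearW => n; rewrite -integral_mkcond.
(* The test function is shifted back by [e], so that the raised path is tested at its true
   endpoint. *)
have upper n e : 0 < e -> 4 * `|b| * hn t n <= e ->
   (\int[P]_(o in S) (f (x + W t o))%:E <= killed b w (fun z => f (z - e)%R) t (x + e)%R +
    (n.+1%:R * expR (- (e ^+ 2 / (4 * w ^+ 2 * hn t n))))%:E)%E.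
  move=> e0 be.
  have := @killed_grid_upper _ _ _ _ _ _ _ _ hW (hn0 n) n.+1 x e (fun z => f (z - e)%R) w0 x0 e0 be.
  rewrite /= hnE => H; apply: le_trans (H _ _).
  - under [leRHS]eq_integral do rewrite addrK.
    apply: ge0_subset_integral => //.
    + exact: measurable_funTS.
    + by move=> o _; rewrite lee_fin.
  - by apply: measurableT_comp => //; exact: measurable_funD.
  - by move=> z; exact: f01.
have small e : 0 < e -> (n.+1%:R * expR (- (e ^+ 2 / (4 * w ^+ 2 * hn t n)))) @[n --> \oo] --> (0 : R).
  move=> e0.
  (* With N = n + 1 steps the error is N exp(-c N), bounded by 4 / (c^2 N). *)
  pose c := e ^+ 2 / (4 * w ^+ 2 * t).
  have c0 : 0 < c by rewrite divr_gt0 ?exprn_gt0// mulr_gt0// mulr_gt0// exprn_even_gt0.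
  apply: (@squeeze_cvgr _ _ _ _ (fun=> 0) (fun n => (4 / c ^+ 2) * n.+1%:R^-1)); last 2 first.
  - exact: cvg_cst.
  - rewrite -[X in _ --> X](mulr0 (4 / c ^+ 2)); apply: cvgMr.
    exact: cvg_harmonic.
  near=> n; rewrite mulr_ge0 ?expR_ge0//=.
  have -> : e ^+ 2 / (4 * w ^+ 2 * hn t n) = c * n.+1%:R.
    have : n.+1%:R != 0 :> R by rewrite pnatr_eq0.
    by rewrite /c /hn; move: n.+1%:R => N N0; field; rewrite w0 (gt_eqF t0) N0.
  have : 0 < n.+1%:R :> R by [].
  move: n.+1%:R => N n1.
  have cn0 : 0 <= c * N by rewrite mulr_ge0// ltW.
  rewrite expRN ler_pdivrMr ?expR_gt0//.
  rewrite [leRHS](_ : _ = (4 * expR (c * N)) / (c ^+ 2 * N)); last first.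
    by field; rewrite (gt_eqF c0) (gt_eqF n1).
  rewrite ler_pdivlMr; last by rewrite mulr_gt0// exprn_gt0.
  rewrite (_ : _ * (_ * _) = (c * N) ^+ 2); last by ring.
  exact: sqr_le_expR.
have upper' e : 0 < e ->
   (\int[P]_(o in S) (f (x + W t o))%:E <= killed b w (fun z => f (z - e)%R) t (x + e)%R)%E.
  move=> e0.
  have cv : ((killed b w (fun z => f (z - e)%R) t (x + e)%R +
    (n.+1%:R * expR (- (e ^+ 2 / (4 * w ^+ 2 * hn t n))))%:E)%E @[n --> \oo] -->
    (killed b w (fun z => f (z - e)%R) t (x + e)%R + 0%:E)%E).
    apply: cvgeD; first exact: fin_num_adde_defl.
      exact: cvg_cst.
    by apply: cvg_EFin; [exact: nearW|exact: small].
  rewrite -[leRHS]adde0; apply: (cvge_to_ge cv).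
  near=> n; apply: upper => //.
  rewrite /hn mulrA ler_pdivrMr// -ler_pdivrMl// mulrC.
  near: n.
  have := @cvgry_ge _ _ _ _ _ (@cvgr_idn R) (4 * `|b| * t / e).
  case=> N _ HN; exists N => // n Nn.
  by apply: (le_trans (HN n Nn)); rewrite ler_nat.
(* The mesh is already gone; now the shift e = 1 / (n + 1) tends to 0. *)
have cv : killed b w (fun z => f (z - n.+1%:R^-1)) t (x + n.+1%:R^-1) @[n --> \oo] --> killed b w f t x.
  have ch : n.+1%:R^-1 @[n --> \oo] --> (0 : R) by exact: cvg_harmonic.
  apply: (@cvg_killed _ b w t x f (fun=> t) (fun n => x + n.+1%:R^-1)
    (fun n z => f (z - n.+1%:R^-1))) => //.
  - by move=> n; rewrite addr_ge0// invr_ge0.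
  - exact: cvg_cst.
  - by rewrite -[X in _ --> X]addr0; apply: cvgD => //; exact: cvg_cst.
  - by move=> n; apply: measurableT_comp => //; exact: measurable_funD.
  - move=> z z0; apply: continuous_cvg; first exact: cf.
    by rewrite -[X in _ --> X]subr0; apply: cvgB => //; exact: cvg_cst.
apply: (cvge_to_ge cv).
by apply: nearW => n; apply: upper'; rewrite invr_gt0.
Unshelve. all: by end_near. Qed.
End killed_law.

(** * The survival probability of a Wiener process *)

(** For integrands that are singular or degenerate at [a]: the interval is exhausted by [[e n, c]],
    and the primitive is only asked for a right limit at [a]. *)
Lemma ge0_FTC2_right_open R (f F : R -> R) (a c l : R) : a < c ->
  (forall x, a < x -> 0 <= f x) -> (forall x, a < x -> {for x, continuous f}) ->
  (forall x, a < x -> is_derive x 1 F (f x)) ->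
  F x @[x --> a^'+] --> l ->
  (\int[leb]_(x in `]a, c]) (f x)%:E = (F c - l)%:E)%E.
Proof.
move=> ac f0 cf dF Fl; set h := c - a; have h0 : 0 < h by rewrite subr_gt0.
pose e n := a + h / n.+2%:R.
have ea n : a < e n by rewrite ltrDl divr_gt0.
have ec n : e n < c by rewrite -ltrBrDl ltr_pdivrMr// ltr_pMr// ltr1n.
have e_to : e n @[n --> \oo] --> a.
  rewrite -[X in _ --> X]addr0; apply: cvgD; first exact: cvg_cst.
  rewrite -[X in _ --> X](mulr0 h); apply: cvgM; first exact: cvg_cst.
  have := @cvg_harmonic R; rewrite -(cvg_shiftn 1).
  by under eq_fun do rewrite /harmonic addn1.
have e_le m n : (m <= n)%N -> e n <= e m.
  by move=> mn; rewrite lerD2l ler_pM2l// lef_pV2 ?posrE// ler_nat ltnS ltnS.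
have cF x : a < x -> {for x, continuous F}.
  move=> ax; apply: differentiable_continuous; apply/derivable1_diffP.
  by case: (dF x ax).
have cFl : (F c - F (e n))%:E @[n --> \oo] --> (F c - l)%:E.
  apply: cvg_EFin; first exact: nearW.
  apply: cvgB; first exact: cvg_cst.
  by have /cvg_at_rightP := Fl; apply; split.
pose g n := (fun x => (f x)%:E) \_ `[e n, c].
have mf : measurable_fun (`]a, c]%classic : set R) (fun x => (f x)%:E).
  apply/measurable_EFinP.
  have : measurable_fun (`]a, +oo[%classic : set R) f.
    apply: open_continuous_measurable_fun; first exact: interval_open.
    by move=> x; rewrite inE/= in_itv/= andbT; exact: cf.
  by apply: measurable_funS => // x /=; rewrite !in_itv/= andbT => /andP[].
have mg n : measurable_fun (`]a, c]%classic : set R) (g n).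
  by apply/measurable_restrict => //; apply: measurable_funS mf.
have int_g n : (\int[leb]_(x in `]a, c]) g n x = (F c - F (e n))%:E)%E.
  rewrite -integral_mkcondr setIidr; last first.
    by move=> x /=; rewrite !in_itv/= => /andP[ex ->]; rewrite (lt_le_trans (ea n) ex).
  rewrite (@continuous_FTC2 _ f F)//.
  - apply: continuous_in_subspaceT => x; rewrite inE/= in_itv/= => /andP[ex _].
    by apply: cf; exact: lt_le_trans ex.
  - split.
    + move=> x; rewrite in_itv/= => /andP[ex _].
      by have [] := dF x (lt_trans (ea n) ex).
    + by apply: cvg_at_right_filter; exact: cF.
    + by apply: cvg_at_left_filter; apply: cF.
  - move=> x; rewrite in_itv/= => /andP[ex _].
    by rewrite derive1E; have [_ ->] := dF x (lt_trans (ea n) ex).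
have := @cvg_monotone_convergence _ _ R leb _ (measurable_itv `]a, c]) g mg _ _.
move=> H.
suff cv : (F c - F (e n))%:E @[n --> \oo] --> (\int[leb]_(x in `]a, c]) (f x)%:E)%E.
  by rewrite -(cvg_lim _ cFl)// -(cvg_lim _ cv).
under eq_cvg do rewrite -int_g.
rewrite (_ : (\int[leb]_(x in `]a, c]) _ =
  \int[leb]_(x in `]a, c]) limn (g ^~ x))%E).
  apply: H.
  - by move=> n x _; apply: erestrict_ge0 => y /=; rewrite in_itv/= lee_fin => /andP[ey _];
      apply: f0; exact: lt_le_trans ey.
  - move=> x /=; rewrite in_itv/= => /andP[ax xc] m n mn.
    rewrite /g /patch !mem_setE/= !in_itv/= xc !andbT.
    case: ifPn => emx; first by rewrite (le_trans (e_le _ _ mn)).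
    by case: ifPn => // _; rewrite lee_fin f0.
apply: eq_integral => x; rewrite inE/= in_itv/= => /andP[ax xc].
apply/esym/cvg_lim => //; apply: cvg_near_cst.
have : \forall n \near \oo, e n < x by apply: (cvgr_lt a).
by apply: filterS => n /ltW en; rewrite /g /patch mem_setE/= in_itv/= en xc.
Qed.

Definition std_normal_cdf R (a : R) : R :=
  (\int[leb]_(u in `]-oo, a]) normal_pdf 0 1 u)%R.

(** The identity as a random variable on the line: under [normal_prob 0 1] its [cdf] is
    [std_normal_cdf], which yields the limits at both infinities. *)
Definition measurable_idfun R : measurableTypeR R -> R := idfun.

HB.instance Definition _ (R : realType) :=
  @isMeasurableFun.Build _ _ (measurableTypeR R) R (@measurable_idfun R) (@measurable_id _ _ setT).

Lemma std_normal_cdfE R (a : R) :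
  (std_normal_cdf a)%:E = (\int[leb]_(u in `]-oo, a]) (normal_pdf 0 1 u)%:E)%E.
Proof.
rewrite /std_normal_cdf /Rintegral fineK//.
by have : normal_prob 0 1 `]-oo, a] \is a fin_num by exact: fin_num_measure.
Qed.

Lemma std_normal_cdf_prob R (a : R) :
  (std_normal_cdf a)%:E = cdf (P := normal_prob 0 1) (@measurable_idfun R) a.
Proof. by rewrite std_normal_cdfE. Qed.

Lemma cvg_std_normal_cdfy R : std_normal_cdf a @[a --> +oo] --> (1 : R).
Proof.
have := cvg_cdfy1 (P := normal_prob 0 1) (@measurable_idfun R).
under eq_cvg do rewrite -std_normal_cdf_prob.
by move=> /fine_cvgP[].
Qed.

Lemma cvg_std_normal_cdfNy R : std_normal_cdf a @[a --> -oo] --> (0 : R).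
Proof.
have := cvg_cdfNy0 (P := normal_prob 0 1) (@measurable_idfun R).
under eq_cvg do rewrite -std_normal_cdf_prob.
by move=> /fine_cvgP[].
Qed.

Lemma is_derive_std_normal_cdf R (a : R) :
  is_derive a 1 (@std_normal_cdf R) (normal_pdf 0 1 a).
Proof.
have a1 : a < a + 1 by rewrite ltrDl.
have iN : leb.-integrable [set` Interval -oo%O (BRight (a + 1))] (EFin \o normal_pdf 0 1).
  by apply: (integrableS measurableT) => //; exact: integrable_normal_pdf.
have cN : {for a, continuous (normal_pdf (0 : R) 1)}.
  by apply: continuous_normal_pdf; rewrite oner_eq0.
have [H1 H2] := @continuous_FTC1 R (normal_pdf 0 1) -oo%O a (a + 1) a1 iN (ltNyr a) cN.
by apply: DeriveDef; [exact: H1|rewrite -derive1E; exact: H2].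
Qed.

Lemma normal_pdf_gt0_mass R (m s : R) : 0 < s ->
  (\int[leb]_(z in `]0%R, +oo[) (normal_pdf m s z)%:E =
   (std_normal_cdf (m / s))%:E)%E.
Proof.
move=> s0; have sn0 : s != 0 by rewrite gt_eqF.
have mp : measurable_fun [set: R] ((fun z => (normal_pdf m s z)%:E) \_ `]0, +oo[).
  apply/(measurable_restrictT _ _).1 => //; apply: measurable_funTS.
  by apply/measurable_EFinP; exact: measurable_normal_pdf.
have p0 z : (0 <= ((fun z => (normal_pdf m s z)%:E) \_ `]0%R, +oo[) z)%E.
  by apply: erestrict_ge0 => y _; rewrite lee_fin normal_pdf_ge0.
rewrite std_normal_cdfE -integral_itv_bndo_bndc; last first.
  by apply: measurable_funTS; apply/measurable_EFinP; exact: measurable_normal_pdf.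
rewrite integral_mkcond (ge0_integral_affine m s0 mp p0) -ge0_integralZl//; last first.
  by rewrite lee_fin ltW.
  apply: measurableT_comp => //; apply: measurable_funD => //; exact: measurable_funM.
rewrite -ge0_integral_oppr.
- rewrite [RHS]integral_mkcond; apply: eq_integral => u _.
  rewrite /patch !mem_setE /= !in_itv/= andbT mulrN addrC subr_gt0 mulrC -ltr_pdivlMr//.
  case: ifPn => _; last by rewrite mule0.
  rewrite -EFinM; congr EFin; rewrite !normal_pdf_expE ?oner_eq0// !subr0 expr1n !mulr1.
  rewrite (_ : (m - u * s - m) ^+ 2 / (2 * s ^+ 2) = u ^+ 2 / 2); last by field.
  rewrite mulrA; congr (_ * _).
  rewrite sqrtrM ?mulr_ge0 ?pi_ge0// sqrtr_sqr gtr0_norm// invfM mulrCA mulfV// mulr1.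
  by [].
- apply: emeasurable_funM => //; apply: measurableT_comp => //.
  by apply: measurable_funD => //; exact: measurable_funM.
- by move=> u; apply: mule_ge0; [rewrite lee_fin ltW|exact: p0].
Qed.

Lemma normal_pdf_norm R (m s z : R) : s != 0 ->
  normal_pdf m `|s| z = normal_pdf m s z.
Proof. by move=> s0; rewrite !normal_pdf_expE ?normr_eq0// real_normK ?num_real. Qed.

(** The Bachelier-Levy formula, obtained by integrating the two images over the half-line. *)
Lemma killed_one_cdf R (b w t x : R) : w != 0 -> 0 < t ->
  killed b w (cst 1) t x =
  (std_normal_cdf ((x + b * t) / (`|w| * Num.sqrt t)) -
   expR (- (2 * b * x / w ^+ 2)) * std_normal_cdf ((- x + b * t) / (`|w| * Num.sqrt t)))%:E.
Proof.
move=> w0 t0; have s0 := scale_sqrt_neq0 w0 t0.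
have sE : `|w| * Num.sqrt t = `|w * Num.sqrt t|.
  by rewrite normrM [`|Num.sqrt t|]ger0_norm ?sqrtr_ge0.
have sp : 0 < `|w| * Num.sqrt t by rewrite sE normr_gt0.
have I m : leb.-integrable (`]0, +oo[%classic : set R)
    (fun z => (normal_pdf m (w * Num.sqrt t) z)%:E).
  by apply: (integrableS measurableT) => //; exact: integrable_normal_pdf.
have E m : (\int[leb]_(z in `]0%R, +oo[) (normal_pdf m (w * Num.sqrt t) z)%:E =
   (std_normal_cdf (m / (`|w| * Num.sqrt t)))%:E)%E.
  rewrite -(normal_pdf_gt0_mass m sp); apply: eq_integral => z _.
  by rewrite sE normal_pdf_norm.
rewrite /killed; under eq_integral do rewrite /= mulr1 alpha_hatE// EFinB EFinM.
rewrite integralB//; last exact: integrableZl.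
by rewrite integralZl// !E -EFinM -EFinB.
Qed.

Lemma cvg_g_hat R (I : Type) (F : set_system I) {FF : Filter F}
    (b w t x : R) (t_ x_ : I -> R) :
  w != 0 -> 0 < t -> t_ @ F --> t -> x_ @ F --> x ->
  g_hat b w (t_ n) (x_ n) @[n --> F] --> g_hat b w t x.
Proof.
move=> w0 t0 tt xx; rewrite /g_hat.
have w2 : 0 < w ^+ 2 by rewrite exprn_even_gt0.
have q0 : 2 * w ^+ 2 * t != 0 by rewrite gt_eqF// mulr_gt0// mulr_gt0.
apply: cvgM.
  apply: cvgM => //; apply: cvgV.
    by rewrite gt_eqF// sqrtr_gt0 mulr_gt0 ?exprn_gt0// mulr_gt0// mulr_gt0// pi_gt0.
  apply: continuous_cvg; first exact: sqrt_continuous.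
  apply: cvgM; first exact: cvg_cst.
  rewrite exprS; under eq_fun do rewrite exprS.
  by apply: cvgM => //; exact: cvg_sqr.
apply: continuous_cvg; [exact: continuous_expR|apply: cvgN].
apply: cvgM; last first.
  by apply: cvgV => //; apply: cvgM => //; exact: cvg_cst.
by apply: cvg_sqr; apply: cvgD => //; apply: cvgM => //; exact: cvg_cst.
Qed.

Lemma g_hat_ge0 R (b w t x : R) : 0 <= x -> 0 <= g_hat b w t x.
Proof. by move=> x0; rewrite /g_hat mulr_ge0 ?expR_ge0// divr_ge0 ?sqrtr_ge0. Qed.

(** The factor [k] turns the Gaussian density at the second argument into that at the first ([kE]).
    The drift parts of the two derivatives then cancel and the parts in [x] add up. *)
Lemma is_derive_survival R (b w t x : R) : w != 0 -> 0 < t ->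
  is_derive t 1 (fun s => std_normal_cdf ((x + b * s) / (`|w| * Num.sqrt s)) -
   expR (- (2 * b * x / w ^+ 2)) * std_normal_cdf ((- x + b * s) / (`|w| * Num.sqrt s)))
   (- g_hat b w t x).
Proof.
move=> w0 t0; set r := Num.sqrt t; have r0 : 0 < r by rewrite sqrtr_gt0.
have tE : t = r ^+ 2 by rewrite sqr_sqrtr// ltW.
have aw : 0 < `|w| by rewrite normr_gt0.
have wE : w ^+ 2 = `|w| ^+ 2 by rewrite real_normK ?num_real.
have dr : is_derive t 1 Num.sqrt (2 * r)^-1 by exact: is_derive1_sqrt.
have dA (c : R) : is_derive t 1 (fun s => (c + b * s) / (`|w| * Num.sqrt s))
    (b / (2 * `|w| * r) - c / (2 * `|w| * r ^+ 3)).
  have d1 : is_derive t 1 (fun s => c + b * s) b.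
    have : is_derive t 1 (fun s => c + b * s) (0 + (b *: 1 + t *: 0)) by exact: is_deriveD.
    by rewrite scaler0 addr0 add0r -[b *: 1]/(b * 1) mulr1.
  have d2 : is_derive t 1 (fun s => `|w| * Num.sqrt s) (`|w| * (2 * r)^-1).
    have : is_derive t 1 (fun s => `|w| * Num.sqrt s) (`|w| *: (2 * r)^-1 + Num.sqrt t *: 0).
      exact: is_deriveM.
    by rewrite scaler0 addr0.
  have d3 : is_derive t 1 (fun s => (`|w| * Num.sqrt s)^-1) (- (`|w| * r) ^- 2 *: (`|w| * (2 * r)^-1)).
    by apply: (@is_deriveV _ (fun s => `|w| * Num.sqrt s)) => //; rewrite gt_eqF// mulr_gt0.
  have d4 := is_deriveM d1 d3.
  have d5 : is_derive t 1 (fun s => (c + b * s) / (`|w| * Num.sqrt s))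
    ((c + b * t) *: (- (`|w| * r) ^- 2 *: (`|w| * (2 * r)^-1)) + (`|w| * Num.sqrt t)^-1 *: b) by exact: d4.
  apply: (is_derive_eq d5).
  rewrite -/r /GRing.scale /= {1}tE; field.
  by rewrite (gt_eqF r0) (gt_eqF aw).
have dC (c : R) : is_derive t 1 (fun s => std_normal_cdf ((c + b * s) / (`|w| * Num.sqrt s)))
    (normal_pdf 0 1 ((c + b * t) / (`|w| * r)) * (b / (2 * `|w| * r) - c / (2 * `|w| * r ^+ 3))).
  apply: (@is_derive1_comp _ (@std_normal_cdf R) (fun s => (c + b * s) / (`|w| * Num.sqrt s))) => //.
  exact: is_derive_std_normal_cdf.
set k := expR _.
have kE : k * normal_pdf 0 1 ((- x + b * t) / (`|w| * r)) = normal_pdf 0 1 ((x + b * t) / (`|w| * r)).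
  rewrite !normal_pdf_expE ?oner_eq0// mulrCA; congr (_ * _).
  rewrite -expRD; congr expR; rewrite !subr0 wE tE; field.
  by rewrite (gt_eqF r0) (gt_eqF aw).
have d : is_derive t 1 (fun s => std_normal_cdf ((x + b * s) / (`|w| * Num.sqrt s)) -
   k * std_normal_cdf ((- x + b * s) / (`|w| * Num.sqrt s))) _ :=
  is_deriveB (dC x) (is_deriveZ k (dC (- x))).
apply: (is_derive_eq d).
rewrite -[k *: _]/(k * _) [k * (_ * _)]mulrA kE -mulrBr /g_hat.
have -> : Num.sqrt (2 * pi * w ^+ 2 * t ^+ 3) = Num.sqrt (2 * pi) * (`|w| * r ^+ 3).
  rewrite -mulrA sqrtrM ?mulr_ge0 ?pi_ge0//; congr (_ * _).
  rewrite wE tE -exprM (mulnC 2) exprM -exprMn sqrtr_sqr ger0_norm//.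
  by rewrite mulr_ge0 ?exprn_ge0// ltW.
rewrite normal_pdf_expE ?oner_eq0// subr0 expr1n !mulr1.
have -> : ((x + b * t) / (`|w| * r)) ^+ 2 / 2 = (x + b * t) ^+ 2 / (2 * w ^+ 2 * t).
  by rewrite wE tE; field; rewrite (gt_eqF r0) (gt_eqF aw).
have : 0 < Num.sqrt (2 * pi) :> R by rewrite sqrtr_gt0 mulr_gt0// pi_gt0.
move: (Num.sqrt (2 * pi)) (expR _) => c e c0; field.
by rewrite (gt_eqF c0) (gt_eqF r0) (gt_eqF aw).
Qed.

(** Both arguments of the normal distribution function diverge as the time decreases to 0, to +oo
    and -oo, so survival tends to 1. This is where x > 0 enters. *)
Lemma g_hat_survival R (b w t x : R) : w != 0 -> 0 < t -> 0 < x ->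
  (\int[leb]_(s in `]0%R, t[) (g_hat b w s x)%:E =
   1 - killed b w (cst 1%R) t x)%E.
Proof.
move=> w0 t0 x0; have aw : 0 < `|w| by rewrite normr_gt0.
rewrite integral_itv_bndo_bndc; last first.
  apply: measurable_funTS; apply/measurable_EFinP.
  by apply: measurable_g_hat.
rewrite killed_one_cdf// -EFinB.
pose G s := std_normal_cdf ((x + b * s) / (`|w| * Num.sqrt s)) -
   expR (- (2 * b * x / w ^+ 2)) * std_normal_cdf ((- x + b * s) / (`|w| * Num.sqrt s)).
have dG (s : R) : 0 < s -> is_derive s 1 (\- G) (g_hat b w s x).
  move=> s0; rewrite -[g_hat _ _ _ _]opprK; apply: is_deriveN; exact: is_derive_survival.
rewrite (@ge0_FTC2_right_open _ _ (\- G) 0 t (- 1))//.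
- by rewrite opprK addrC.
- by move=> s s0; apply: g_hat_ge0; exact: ltW.
- move=> s s0; apply: cvg_g_hat => //; exact: cvg_cst.
- apply: cvgN.
  have ct : Num.sqrt s @[s --> (0:R)^'+] --> (0 : R).
    rewrite -[X in _ --> X](@sqrtr0 R); apply: cvg_at_right_filter.
    exact: sqrt_continuous.
  have pinv : (`|w| * Num.sqrt s)^-1 @[s --> (0 : R)^'+] --> +oo.
    apply/cvgrVy.
      by near=> s; rewrite mulr_gt0// sqrtr_gt0.
    rewrite -[X in _ --> X](mulr0 `|w|).
    by apply: cvgM => //; exact: cvg_cst.
  have lin (c : R) : (c + b * s) @[s --> (0 : R)^'+] --> c.
    rewrite (_ : nbhs c = nbhs (c + b * 0)); last by rewrite mulr0 addr0.
    apply: cvgD; first exact: cvg_cst.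
    by apply: cvg_at_right_filter; apply: cvgM; [exact: cvg_cst|exact: cvg_id].
  rewrite /G (_ : nbhs (1 : R) = nbhs (1 - expR (- (2 * b * x / w ^+ 2)) * 0 : R)); last by rewrite mulr0 subr0.
  apply: cvgB.
    apply: (cvg_comp _ _ _ (@cvg_std_normal_cdfy R)).
    apply: (ger_cvgy (f := fun s => x / 2 * (`|w| * Num.sqrt s)^-1)).
      near=> s; rewrite ler_wpM2r ?invr_ge0 ?mulr_ge0 ?sqrtr_ge0//.
      near: s; apply: (cvgr_ge x (lin x)).
      by rewrite ltr_pdivrMr// ltr_pMr// ltr1n.
    by apply: gt0_cvgMry => //; rewrite divr_gt0.
  apply: cvgM; first exact: cvg_cst.
  apply: (cvg_comp _ _ _ (@cvg_std_normal_cdfNy R)).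
  apply: (ler_cvgNy (f := fun s => - (x / 2 * (`|w| * Num.sqrt s)^-1))).
    near=> s; rewrite -mulNr ler_wpM2r ?invr_ge0 ?mulr_ge0 ?sqrtr_ge0//.
    near: s; apply: (cvgr_le (- x) (lin (- x))).
    by rewrite ltrN2 ltr_pdivrMr// ltr_pMr// ltr1n.
  by apply/cvgNrNy; apply: gt0_cvgMry => //; rewrite divr_gt0.
Unshelve. all: by end_near. Qed.

(** Time is rounded up to the next multiple of 1 / (n + 1), strictly to the right, so that right
    continuity gives the limit; for each n only countably many times occur. [Num.max 0] restricts to
    the times that are constrained. *)
Lemma measurable_right_continuous d (T : measurableType d) R (f : R -> T -> R) :
  (forall t, 0 <= t -> measurable_fun setT (f t)) ->
  (forall t o, 0 <= t -> f s o @[s --> t^'+] --> f t o) ->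
  measurable_fun setT (fun p : R * T => f (Num.max 0 p.1) p.2).
Proof.
move=> mf cf.
pose c (n : nat) (x : R) : nat := Num.truncn (n.+1%:R * Num.max 0 x).
have m0 (x : R) : 0 <= Num.max 0 x by rewrite le_max lexx.
have cP n x : (c n x)%:R <= n.+1%:R * Num.max 0 x < (c n x).+1%:R.
  by apply: truncn_itv; rewrite mulr_ge0.
apply: (@measurable_fun_cvg _ _ _ _
  (fun n (p : R * T) => f ((c n p.1).+1%:R / n.+1%:R) p.2)) => [n|[x o] _ /=].
  move=> _ B mB; rewrite setTI.
  rewrite [X in measurable X](_ : _ = \bigcup_(k : nat) (((c n) @^-1` [set k]) `*`
      ((f (k.+1%:R / n.+1%:R)) @^-1` B))); last first.
    apply/seteqP; split => [[x o] /= H|[x o] [k _ [/= <-]]//].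
    by exists (c n x).
  apply: bigcupT_measurable => k; apply: measurableX; last first.
    by rewrite -[X in measurable X]setTI; apply: mf.
  rewrite (_ : c n @^-1` [set k] = (fun x => n.+1%:R * Num.max 0 x) @^-1` `[k%:R, k.+1%:R[); last first.
    apply/seteqP; split => x /=; first by move=> <-; rewrite in_itv/=; exact: cP.
    by rewrite in_itv/= => xk; apply/eqP; rewrite truncn_eq// mulr_ge0.
  rewrite -[X in measurable X]setTI; suff : measurable_fun setT (fun x : R => n.+1%:R * Num.max 0 x).
    by apply => //; exact: measurable_itv.
  by apply: measurable_funM => //; apply: measurable_maxr.
have /cvg_at_rightP := cf (Num.max 0 x) o (m0 x); apply; split => [n|].
  by rewrite ltr_pdivlMr// mulrC; case/andP: (cP n x).
apply: (@squeeze_cvgr _ _ _ _ (cst (Num.max 0 x)) (fun n => Num.max 0 x + n.+1%:R^-1)).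
- near=> n; have /andP[c1 c2] := cP n x; rewrite /= ler_pdivlMr// mulrC ltW//=.
  by rewrite -natr1 mulrDl mul1r lerD2r ler_pdivrMr// mulrC.
- exact: cvg_cst.
- rewrite -[X in _ --> X]addr0; apply: cvgD; first exact: cvg_cst.
  exact: cvg_harmonic.
Unshelve. all: by end_near. Qed.

Lemma measurable_time_change d (T : measurableType d) R (f : R -> T -> R)
    (g : T -> R) :
  (forall t, 0 <= t -> measurable_fun setT (f t)) ->
  (forall t o, 0 <= t -> f s o @[s --> t^'+] --> f t o) ->
  measurable_fun setT g -> (forall o, 0 <= g o) ->
  measurable_fun setT (fun o => f (g o) o).
Proof.
move=> mf cf mg g0.
rewrite (_ : (fun o => _) = (fun p : R * T => f (Num.max 0 p.1) p.2) \o (fun o => (g o, o))).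
  apply: measurableT_comp; first exact: measurable_right_continuous.
  exact: measurable_fun_pair.
by apply/funext => o /=; rewrite max_r.
Qed.

Lemma within_nneg_continuous_right R (z : R -> R) (t : R) :
  {within `[0, +oo[, continuous z} -> 0 <= t -> z s @[s --> t^'+] --> z t.
Proof.
move=> /subspace_continuousP cz t0.
have := cz t; rewrite /= in_itv/= andbT => /(_ t0) H.
apply/cvgrPdist_lt => e e0; move/cvgrPdist_lt: H => /(_ e e0).
rewrite near_withinE => H; rewrite near_withinE; apply: filterS H => s /= Hs ts.
by apply: Hs; rewrite in_itv/= andbT (le_trans t0)// ltW.
Qed.

(** * The environment *)

Section transition.
Variables (R : realType) (eta : env -> R) (q : R -> env -> env -> R).
Hypothesis hq : transition_function eta q.

Lemma transition_le1 t i j : 0 <= t -> q t i j <= 1.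
Proof.
move=> t0; have := transition_sum1 hq i t0.
by case: j; have := transition_ge0 hq i env1 t0; have := transition_ge0 hq i env2 t0; lra.
Qed.

(** The return probability is subadditive in time, hence at most n q(t / n), and a zero rate makes
    this bound tend to 0. *)
Lemma transition_absorbing t : eta env2 = 0 -> 0 <= t -> q t env2 env1 = 0.
Proof.
move=> eta0; rewrite le_eqVlt => /predU1P[<-|t0].
  have := transition_sum1 hq env2 (lexx 0); rewrite (transition_id hq env2); lra.
have sub s u : 0 <= s -> 0 <= u -> q (s + u) env2 env1 <= q s env2 env1 + q u env2 env1.
  move=> s0 u0; rewrite (transition_semigroup hq)//; apply: lerD.
    by rewrite ler_piMr ?transition_le1// (transition_ge0 hq).
  by rewrite ler_piMl ?transition_le1// (transition_ge0 hq).
have subn (h : R) (n : nat) : 0 <= h -> q (n%:R * h) env2 env1 <= n%:R * q h env2 env1.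
  move=> h0; elim: n => [|n IH].
    by have := transition_sum1 hq env2 (lexx 0); rewrite !mul0r (transition_id hq env2); lra.
  rewrite -natr1 !mulrDl !mul1r (le_trans (sub _ _ _ _))// ?mulr_ge0// lerD2r//.
have cv : t * (q (t / n.+1%:R) env2 env1 / (t / n.+1%:R)) @[n --> \oo] --> t * 0.
  apply: cvgM; first exact: cvg_cst.
  have := transition_rate hq (i := env2) (j := env1); rewrite eta0 => /(_ _) /cvg_at_rightP.
  apply=> //; split => [n|]; first by rewrite divr_gt0.
  by rewrite -[X in _ --> X](mulr0 t); apply: cvgM; [exact: cvg_cst|exact: cvg_harmonic].
apply/eqP; rewrite eq_le (transition_ge0 hq) ?(ltW t0)// andbT -(mulr0 t).
apply: (cvgr_to_ge cv); apply: nearW => n.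
have cE (c x : R) : 0 < c -> t * (x / (t / c)) = c * x.
  by move=> c0; field; rewrite (gt_eqF c0) (gt_eqF t0).
rewrite cE//.
apply: le_trans (subn _ n.+1 _); last by rewrite divr_ge0// ltW.
by rewrite mulrCA divff ?mulr1// pnatr_eq0.
Qed.

(** Without returns [a] is multiplicative, so a(t) = a(t / n)^n with (1 - a(h)) / h tending to the
    rate. Neither continuity nor differentiability of [q] at positive times is presupposed; a(t) is
    squeezed between exponentials. The upper bound is a <= exp(-(1 - a)). *)
Lemma transition_stay t : eta env2 = 0 -> 0 <= t ->
  q t env1 env1 = expR (- (eta env1 * t)).
Proof.
move=> eta0; rewrite le_eqVlt => /predU1P[<-|t0].
  by rewrite mulr0 oppr0 expR0 (transition_id hq).
pose a s := q s env1 env1.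
have aM s u : 0 <= s -> 0 <= u -> a (s + u) = a s * a u.
  by move=> s0 u0; rewrite /a (transition_semigroup hq)// (transition_absorbing eta0 u0) mulr0 addr0.
have aX (h : R) (n : nat) : 0 <= h -> a (n%:R * h) = a h ^+ n.
  move=> h0; elim: n => [|n IH]; first by rewrite mul0r expr0 /a (transition_id hq).
  by rewrite -natr1 mulrDl mul1r aM ?mulr_ge0// IH exprSr.
have q12 s : 0 <= s -> 1 - a s = q s env1 env2.
  by move=> s0; have := transition_sum1 hq env1 s0; rewrite /a; lra.
have h0 n : 0 < t / n.+1%:R by rewrite divr_gt0.
have cvh : t / n.+1%:R @[n --> \oo] --> 0.
  by rewrite -[X in _ --> X](mulr0 t); apply: cvgM; [exact: cvg_cst|exact: cvg_harmonic].
have cvq : (1 - a (t / n.+1%:R)) / (t / n.+1%:R) @[n --> \oo] --> eta env1.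
  under eq_fun do rewrite q12 ?(ltW (h0 _))//.
  have := transition_rate hq (i := env1) (j := env2) => /(_ _) /cvg_at_rightP.
  by apply=> //; split => // n.
have cva : a (t / n.+1%:R) @[n --> \oo] --> (1 : R).
  have : 1 - (1 - a (t / n.+1%:R)) / (t / n.+1%:R) * (t / n.+1%:R) @[n --> \oo] --> 1 - eta env1 * 0.
    by apply: cvgB; [exact: cvg_cst|exact: cvgM].
  rewrite mulr0 subr0; apply: cvg_trans; apply: near_eq_cvg; apply: nearW => n.
  by rewrite divfK ?gt_eqF// opprB addrC subrK.
have tE n : a t = a (t / n.+1%:R) ^+ n.+1.
  by rewrite -aX ?ltW// mulrCA divff ?mulr1// pnatr_eq0.
have uE n : (1 - a (t / n.+1%:R)) / (t / n.+1%:R) * t = n.+1%:R * (1 - a (t / n.+1%:R)).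
  have cE (c x : R) : 0 < c -> x / (t / c) * t = c * x.
    by move=> c0; field; rewrite (gt_eqF c0) (gt_eqF t0).
  by rewrite cE.
apply/eqP; rewrite eq_le; apply/andP; split.
  have cv : expR (- ((1 - a (t / n.+1%:R)) / (t / n.+1%:R) * t)) @[n --> \oo] --> expR (- (eta env1 * t)).
    apply: continuous_cvg; first exact: continuous_expR.
    by apply: cvgN; apply: cvgM => //; exact: cvg_cst.
  apply: (cvgr_to_ge cv); apply: nearW => n.
  rewrite uE -[q t _ _]/(a t) (tE n) -mulrN expRM_natl lerXn2r ?nnegrE ?expR_ge0//.
    by apply: (transition_ge0 hq); rewrite ltW.
  by have := expR_ge1Dx (- (1 - a (t / n.+1%:R))); lra.
(* The lower bound comes from 1 / a <= exp((1 - a) / a), valid once a(t / n) > 0. *)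
have cv : expR (- ((1 - a (t / n.+1%:R)) / (t / n.+1%:R) * t / a (t / n.+1%:R))) @[n --> \oo] -->
    expR (- (eta env1 * t / 1)).
  apply: continuous_cvg; first exact: continuous_expR.
  apply: cvgN; apply: cvgM; last exact: cvgV.
  by apply: cvgM => //; exact: cvg_cst.
rewrite divr1 in cv; apply: (cvgr_to_le cv); near=> n.
have a0 : 0 < a (t / n.+1%:R) by near: n; exact: (cvgr_gt 1).
rewrite uE -[q t _ _]/(a t) (tE n) -mulrA -mulrN expRM_natl lerXn2r ?nnegrE ?expR_ge0 ?(ltW a0)//.
rewrite expRN -[leRHS]invrK lef_pV2 ?posrE ?expR_gt0 ?invr_gt0//.
apply: le_trans (expR_ge1Dx _).
by rewrite mulrBl mul1r divff ?gt_eqF// addrC subrK.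
Unshelve. all: by end_near. Qed.
End transition.

(** * Occupation times as clocks *)

Lemma lebesgue_bounded_itv R (b1 b2 : bool) (x y : R) : x <= y ->
  leb [set` Interval (BSide b1 x) (BSide b2 y)] = (y - x)%:E.
Proof.
move=> xy; rewrite lebesgue_measure_itv/= lte_fin; case: ltP => //= yx.
by apply/esym/eqP; rewrite eqe subr_eq0 eq_le xy yx.
Qed.

Lemma measurable_occupation_set d (T : measurableType d) R (E : R -> T -> env)
    (i : env) (t : R) :
  (forall s, 0 <= s -> measurable [set w | E s w = i]) ->
  (forall s w, 0 <= s -> \forall u \near s^'+, E u w = E s w) ->
  measurable [set x : R * T | 0 <= x.1 <= t /\ E x.1 x.2 = i].
Proof.
move=> mE rE.
have mf : measurable_fun setT (fun x : R * T => \1_[set w | E (Num.max 0 x.1) w = i] x.2 : R).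
  apply: (@measurable_right_continuous _ _ _ (fun s w => \1_[set w | E s w = i] w)).
    by move=> s s0; apply: measurable_indic; exact: mE.
  move=> s w s0; apply: cvg_near_cst; near=> u; rewrite !indicE.
  have Eu : E u w = E s w by near: u; exact: rE.
  by congr (_ %:R); congr nat_of_bool; apply/idP/idP; rewrite !inE/= Eu.
rewrite (_ : [set x | _] = (`[0, t] `*` setT) `&` [set x | E (Num.max 0 x.1) x.2 = i]).
  apply: measurableI; first by apply: measurableX => //; exact: measurable_itv.
  rewrite (_ : [set x | _] = (fun x : R * T => \1_[set w | E (Num.max 0 x.1) w = i] x.2 : R) @^-1` [set 1]).
    by rewrite -[X in measurable X]setTI; exact: mf.
  apply/seteqP; split => -[s w] /=; rewrite indicE.
    by move=> Es; rewrite mem_set.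
  by case: (boolP (w \in _)) => [/set_mem//|_ /eqP]; rewrite eq_sym oner_eq0.
apply/seteqP; split => -[s w] /=; rewrite in_itv/=.
  by move=> [/andP[s0 st]] <-; rewrite max_r// s0.
by move=> [[/andP[s0 st] _]]; rewrite max_r// => ->; rewrite s0.
Unshelve. all: by end_near. Qed.

Lemma measurable_occupation_time d (T : measurableType d) R (E : R -> T -> env)
    (i : env) (t : R) :
  (forall s, 0 <= s -> measurable [set w | E s w = i]) ->
  (forall s w, 0 <= s -> \forall u \near s^'+, E u w = E s w) ->
  measurable_fun setT (occupation_time E i t).
Proof.
move=> mE rE; have mA := measurable_occupation_set t mE rE.
have := measurable_fun_ysection (leb : {measure set (measurableTypeR R) -> \bar R}) mA.
move=> /(measurableT_comp (fine_measurable measurableT)).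
rewrite (_ : _ \o _ = occupation_time E i t)//.
apply/funext => w; rewrite /occupation_time/=; congr (fine (leb _)).
by apply/seteqP; split => s; rewrite /ysection/= inE.
Qed.

Section occupation_time.
Context d (T : measurableType d) R (E : R -> T -> env) (i : env) (w : T).
Hypotheses (mE : forall s, 0 <= s -> measurable [set w | E s w = i])
  (rE : forall s w, 0 <= s -> \forall u \near s^'+, E u w = E s w).

Let mA (t : R) : measurable [set s : R | 0 <= s <= t /\ E s w = i].
Proof.
have := measurable_ysection w (measurable_occupation_set t mE rE); congr measurable.
by apply/seteqP; split => s; rewrite /ysection/= inE.
Qed.

Let leA (t : R) : 0 <= t ->
  (leb [set s : R | (0 <= s <= t)%R /\ E s w = i] <= t%:E)%E.
Proof.
move=> t0; have Lt : leb (`[0, t]%classic : set R) = t%:E.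
  by rewrite (lebesgue_bounded_itv true false t0) subr0.
rewrite -Lt; apply: le_measure; [by rewrite inE; exact: mA|by rewrite inE; exact: measurable_itv|].
by move=> s [st _]; rewrite /= in_itv.
Qed.

Let fA (t : R) : 0 <= t ->
  leb [set s : R | 0 <= s <= t /\ E s w = i] \is a fin_num.
Proof. by move=> t0; rewrite ge0_fin_numE// (le_lt_trans (leA t0))// ltry. Qed.

Lemma occupation_time_le t : 0 <= t -> occupation_time E i t w <= t.
Proof. by move=> t0; rewrite -lee_fin fineK ?fA// leA. Qed.

Lemma occupation_time_lipschitz u v : 0 <= u -> u <= v ->
  occupation_time E i u w <= occupation_time E i v w <= occupation_time E i u w + (v - u).
Proof.
move=> u0 uv; have v0 := le_trans u0 uv.
rewrite /occupation_time -!lee_fin EFinD !fineK ?fA//; apply/andP; split.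
  apply: le_measure; [by rewrite inE; exact: mA|by rewrite inE; exact: mA|move=> s [/andP[s0 su] es]; split => //].
  by rewrite s0 (le_trans su).
have muv : measurable (`[u, v]%classic : set R) by exact: measurable_itv.
rewrite -(lebesgue_bounded_itv true false uv); apply: le_trans (measureU2 _ _ _); [|exact: mA|exact: muv].
apply: le_measure; [by rewrite inE; exact: mA|by rewrite inE; apply: measurableU; [exact: mA|]|].
move=> s [/andP[s0 sv] es]; have [su|us] := leP s u; first by left; rewrite /= s0.
by right; rewrite /= in_itv/= (ltW us).
Qed.
End occupation_time.

Lemma monotone_switch R (e : R -> env) (t : R) :
  (forall s, 0 <= s -> \forall u \near s^'+, e u = e s) ->
  (forall r s, 0 <= r -> r <= s -> e r = env2 -> e s = env2) -> 0 <= t ->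
  exists2 c, 0 <= c & forall s, 0 <= s <= t -> (e s = env1 <-> s < c).
Proof.
(* The sentinel [t + 1] keeps [A] nonempty when no switch occurs, and being strictly beyond [t] it
   does not interfere on [0, t]. Right continuity excludes environment 1 at the infimum when that
   lies in [0, t]. *)
move=> re me t0; pose A := [set s | 0 <= s /\ (e s = env2 \/ t + 1 <= s)].
have At : A (t + 1) by split; [rewrite addr_ge0|right].
have lA : lbound A 0 by move=> s [].
have hA : has_inf A by split; [exists (t + 1)|exists 0].
exists (inf A); first by apply: lb_le_inf => //; exists (t + 1).
move=> s /andP[s0 st]; split => [es|sA].
  rewrite ltNge; apply/negP => As.
  have H := re s s0.
  have [u [su ut eu]] : exists u, [/\ s < u, u < t + 1 & e u = env1].
    near s^'+ => u; exists u; split; first by near: u; exact: nbhs_right_gt.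
      by near: u; apply: nbhs_right_lt; rewrite (le_lt_trans st)// ltrDl.
    by rewrite -es; near: u; exact: re.
  have [v [v0 ev] vu] := inf_lt (proj1 hA) (le_lt_trans As su).
  have {}ev : e v = env2 by case: ev => // tv; have := lt_trans (le_lt_trans tv vu) ut; rewrite ltxx.
  by have := me v u v0 (ltW vu) ev; rewrite eu.
case es : (e s) => //; exfalso; move: sA; rewrite ltNge => /negP; apply.
by apply: ge_inf; [exists 0|split => //; left].
Unshelve. all: by end_near. Qed.

Lemma occupation_switch (T : Type) R (E : R -> T -> env) (w : T) (t : R) :
  (forall s, 0 <= s -> \forall u \near s^'+, E u w = E s w) ->
  (forall r s, 0 <= r -> r <= s -> E r w = env2 -> E s w = env2) -> 0 <= t ->
  exists2 c, 0 <= c &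
    (forall s, 0 <= s <= t -> (E s w = env1 <-> s < c)) /\
    (forall u, 0 <= u <= t -> occupation_time E env1 u w = Num.min u c /\
                              occupation_time E env2 u w = u - Num.min u c).
Proof.
move=> rE mE t0; have [c c0 cP] := monotone_switch rE mE t0; exists c => //; split => //.
move=> u /andP[u0 ut]; split; rewrite /occupation_time; have [uc|cu] := ltP u c.
- rewrite (_ : [set s | _] = `[0, u]%classic) ?lebesgue_bounded_itv ?subr0//.
  apply/seteqP; split => s /=; rewrite in_itv/=; first by case.
  by move=> /andP[s0 sv]; split; [rewrite s0|apply/cP; [rewrite s0 (le_trans sv)|exact: le_lt_trans uc]].
- rewrite (_ : [set s | _] = `[0, c[%classic) ?lebesgue_bounded_itv ?subr0//.
  apply/seteqP; split => s /=; rewrite in_itv/=.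
    by move=> [/andP[s0 sv] /cP]; rewrite s0 => ->//; rewrite (le_trans sv).
  move=> /andP[s0 sc]; have sv := le_trans (ltW sc) cu.
  by split; [rewrite s0|apply/cP => //; rewrite s0 (le_trans sv)].
- rewrite (_ : [set s | _] = set0) ?measure0 ?subrr//.
  apply/seteqP; split => s //= [/andP[s0 su] es].
  have /cP[_ /(_ (le_lt_trans su uc))] : 0 <= s <= t by rewrite s0 (le_trans su).
  by rewrite es.
rewrite (_ : [set s | _] = `[c, u]%classic) ?lebesgue_bounded_itv//.
apply/seteqP; split => s /=; rewrite in_itv/=.
  move=> [/andP[s0 su] es]; rewrite su andbT leNgt; apply/negP => sc.
  have /cP[_ /(_ sc)] : 0 <= s <= t by rewrite s0 (le_trans su).
  by rewrite es.
move=> /andP[cs su]; have s0 := le_trans c0 cs; split; first by rewrite s0.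
have /cP[+ _] : 0 <= s <= t by rewrite s0 (le_trans su).
by case: (E s w) => // /(_ erefl); rewrite ltNge cs.
Qed.

Section environment.
Context d (T : measurableType d) R (P : probability T R) (eta : env -> R)
  (p : R) (E : R -> T -> env).
Hypothesis hE : environment_process P eta p E.
Hypothesis eta2 : eta env2 = 0.

Lemma environment_prob s : 0 <= s ->
  P [set w | E s w = env1] = (p * expR (- (eta env1 * s)))%:E.
Proof.
move=> s0; have [q hq law] := environment_law hE.
have joint i : P [set w | E 0 w = i /\ E s w = env1] =
    ((if i is env1 then p else 1 - p) * q s i env1)%:E.
  have := law 1%N (fun k => if k is 0%N then 0 else s) (fun k => if k is 0%N then i else env1) erefl.
  rewrite /= big_ord1 subr0 => H; rewrite -H; last by case.
  congr (P _); apply/seteqP; split => w /=; first by move=> [w0 ws] [|[|]].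
  by move=> {}H; split; [exact: (H 0%N)|exact: (H 1%N)].
have mE i : measurable [set w | E 0 w = i /\ E s w = env1].
  by apply: measurableI; apply: (environment_measurable hE).
rewrite (_ : [set w | _] = [set w | E 0 w = env1 /\ E s w = env1] `|`
    [set w | E 0 w = env2 /\ E s w = env1]).
  rewrite measureU//; last first.
    by apply/seteqP; split => w //= [[-> _] []].
  rewrite [X in (X + _)%E](joint env1) [X in (_ + X)%E](joint env2).
  by rewrite (transition_absorbing hq)// mulr0 adde0 (transition_stay hq).
apply/seteqP; split => w /=; last by case=> -[].
by case E0 : (E 0 w) => ws; [left|right].
Qed.

Lemma environment_no_return r s : 0 <= r -> r <= s ->
  P [set w | E r w = env2 /\ E s w = env1] = 0%E.
Proof.
move=> r0 rs; have [q hq law] := environment_law hE.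
have s0 := le_trans r0 rs.
have joint i : P [set w | [/\ E 0 w = i, E r w = env2 & E s w = env1]] = 0%E.
  have := law 2%N (fun k => match k with 0%N => 0 | 1%N => r | _ => s end)
    (fun k => match k with 0%N => i | 1%N => env2 | _ => env1 end) erefl.
  rewrite !big_ord_recl/= big_ord0 (transition_absorbing hq)// ?subr_ge0//.
  rewrite mul0r !mulr0 => H; rewrite -[RHS]H; last by case => [|[|]].
  congr (P _); apply/seteqP; split => w /=; first by move=> [w0 wr ws] [|[|[|]]].
  by move=> {}H; split; [exact: (H 0%N)|exact: (H 1%N)|exact: (H 2%N)].
have mE i : measurable [set w | [/\ E 0 w = i, E r w = env2 & E s w = env1]].
  rewrite (_ : [set w | _] = [set w | E 0 w = i] `&` [set w | E r w = env2] `&` [set w | E s w = env1]).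
    by apply: measurableI; [apply: measurableI|]; apply: (environment_measurable hE).
  by apply/seteqP; split => w /= [] // [].
rewrite (_ : [set w | _] = [set w | [/\ E 0 w = env1, E r w = env2 & E s w = env1]] `|`
    [set w | [/\ E 0 w = env2, E r w = env2 & E s w = env1]]).
  rewrite measureU//; last by apply/seteqP; split => w //= [[-> _ _] []].
  by rewrite [X in (X + _)%E](joint env1) [X in (_ + X)%E](joint env2) adde0.
apply/seteqP; split => w /=; last by case=> -[].
by case E0 : (E 0 w) => -[wr ws]; [left|right].
Qed.

(** Each fixed pair of times contributes a null event, and only rational pairs are collected in [N].
    Right continuity moves an arbitrary return from [r] to [s] to rational times just after [r] and
    just after [s]. *)
Lemma environment_monotone : exists N : set T, [/\ measurable N, P N = 0%E &
  forall w, ~ N w -> forall r s, 0 <= r -> r <= s -> E r w = env2 -> E s w = env2].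
Proof.
pose B (x : rat * rat) : set T := if (0 <= x.1) && (x.1 <= x.2) then
  [set w | E (ratr x.1) w = env2 /\ E (ratr x.2) w = env1] else set0.
have mB x : measurable (B x).
  rewrite /B; case: ifPn => // /andP[x1 x2].
  have y1 : 0 <= ratr x.1 :> R by rewrite ler0q.
  have y2 : ratr x.1 <= ratr x.2 :> R by rewrite ler_rat.
  by apply: measurableI; apply: (environment_measurable hE) => //; exact: le_trans y2.
have B0 x : P (B x) = 0%E.
  rewrite /B; case: ifPn => [/andP[x1 x2]|_]; last exact: measure0.
  by apply: environment_no_return; rewrite ?ler0q ?ler_rat.
exists (\bigcup_(n : nat) B (odflt (0, 0) (unpickle n))); split.
- by apply: bigcupT_measurable => n.
- apply/eqP; rewrite -measure_le0.
  apply: le_trans (measure_sigma_subadditive _ _ _ (@subset_refl _ _)) _ => //.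
    by apply: bigcupT_measurable => n.
  by rewrite eseries0 => [|n _ _]; [exact: lexx|exact: B0].
- move=> w Nw r s r0 rs er; case es : (E s w) => //; exfalso; apply: Nw.
  have rs' : r < s by rewrite lt_neqAle rs andbT; apply: contraPneq es => <-; rewrite er.
  have s0 := le_trans r0 rs.
  have right_rat (x y : R) : 0 <= x -> x < y -> exists q : rat,
      [/\ x < ratr q, ratr q < y & E (ratr q) w = E x w].
    move=> x0 xy; have := environment_right hE w x0.
    rewrite near_withinE => /nbhs_ballP[e e0 He].
    have [q] : exists q, ratr q \in `]x, Num.min y (x + e)[.
      by apply: rat_in_itvoo; rewrite lt_min xy ltrDl.
    rewrite in_itv/= lt_min => /and3P[xq qy qe]; exists q; split => //.
    by apply: He => //; rewrite /ball/= ltr_distlC ?ltrBlDr; apply/andP; split; lra.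
  have [q1 [rq1 q1s eq1]] := right_rat _ _ r0 rs'.
  have s1 : s < s + 1 by rewrite ltrDl.
  have [q2 [sq2 _ eq2]] := right_rat s (s + 1) s0 s1.
  have Bq : B (q1, q2) w.
    rewrite /B -(ler0q R) -(ler_rat R) (le_trans r0 (ltW rq1)) (le_trans (ltW q1s) (ltW sq2)).
    by split; rewrite ?eq1 ?eq2.
  apply: (@bigcup_sup _ _ (pickle (q1, q2)) setT (fun n => B (odflt (0, 0) (unpickle n))) I).
  by rewrite pickleK.
Qed.
End environment.

(** * The censored exponential law *)

Lemma integral_exponential_itvy R (c s : R) : 0 < c -> 0 <= s ->
  (\int[leb]_(x in `]s, +oo[) (exponential_pdf c x)%:E = (expR (- (c * s)))%:E)%E.
Proof.
move=> c0 s0.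
have mEex : measurable_fun setT (EFin \o exponential_pdf c).
  by apply/measurable_EFinP; exact: measurable_exponential_pdf.
rewrite integral_itv_obnd_cbnd; last exact: measurable_funTS.
rewrite (@ge0_continuous_FTC2y _ _ (fun x => - expR (- c * x)) _ 0)//.
- by rewrite EFinN oppeK add0e mulNr.
- by move=> x xs; rewrite exponential_pdf_ge0// ltW.
- apply: (@continuous_subspaceW R^o _ _ [set` `[0, +oo[%R]).
    by move=> x /=; rewrite !in_itv/= !andbT; exact: le_trans.
  exact: within_continuous_exponential_pdf.
- rewrite -oppr0; apply: cvgN.
  rewrite (_ : (fun x => expR (- c * x)) = (fun z => expR (- z)) \o (fun z => c * z)); last first.
    by apply: eq_fun => x; rewrite mulNr.
  apply: (@cvg_comp _ _ _ _ _ _ (pinfty_nbhs R)); last exact: cvgr_expR.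
  exact: gt0_cvgMry.
- apply: cvgN; apply/cvg_at_right_filter; apply: continuous_cvg; first exact: continuous_expR.
  by apply: cvgM; [exact: cvg_cst|exact: cvg_id].
- move=> x; rewrite in_itv/= andbT => sx; apply: derive1_exponential_pdf.
  by rewrite in_itv/= andbT (le_lt_trans s0).
Qed.

Section censored_exponential.
Context d (T : measurableType d) R (P : probability T R) (S : T -> R) (c p t : R).
Hypotheses (mS : measurable_fun setT S) (c0 : 0 < c) (t0 : 0 < t) (p0 : 0 <= p)
  (St : forall o, 0 <= S o <= t)
  (tailS : forall s, 0 <= s < t -> P [set o | s < S o] = (p * expR (- (c * s)))%:E).

(** On S > 0 the law of [S] is [p] times that of min(x, t) with x exponential: both measures have
    the same values on rays, a pi-system generating the Borel sets. *)
Lemma censored_exponential_tail (f : R -> \bar R) :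
  measurable_fun setT f -> (forall s, (0 <= f s)%E) ->
  (\int[P]_(o in [set o | (0 < S o)%R]) f (S o) =
   p%:E * \int[leb]_x ((exponential_pdf c x)%:E * f (Num.min x t)))%E.
Proof.
move=> mf f0.
have mA : measurable [set o | 0 < S o].
  rewrite (_ : [set o | _] = S @^-1` `]0, +oo[); last first.
    by apply/seteqP; split => o /=; rewrite in_itv/= andbT.
  by rewrite -[X in measurable X]setTI; apply: mS.
pose Q : probability (measurableTypeR R) R :=
  exponential_distribution_exponential_prob__canonical__probability_measure_Probability c0.
have mm : measurable_fun (setT : set (measurableTypeR R)) (fun x : R => Num.min x t : measurableTypeR R).
  exact: measurable_minr.
have mS' : measurable_fun setT (S : T -> measurableTypeR R) by [].
pose m1 := restricted_law P mA mS'.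
pose m2 := mscale (NngNum p0) (restricted_law Q measurableT mm).
have m1E B : m1 B = P (S @^-1` B `&` [set o | 0 < S o]) by [].
have m2E B : m2 B = (p%:E * exponential_prob c ((fun x => Num.min x t) @^-1` B))%E.
  by rewrite -[in RHS](setIT (_ @^-1` _)).
have Eu (B : set (measurableTypeR R)) : measurable B -> m1 B = m2 B.
  move=> mB; have cov : \bigcup_(k : nat) `]- k%:R, +oo[%classic = [set: R].
    apply/seteqP; split => // x _; exists (Num.truncn (- x)).+1 => //=.
    by rewrite in_itv/= andbT ltrNl truncnS_gt.
  apply: (@g_sigma_algebra_measure_unique _ R (measurableTypeR R) (@RGenOInfty.G R) _
    (fun k => `]- k%:R, +oo[%classic) _ cov m1 m2) => //.
  - by move=> _ [x ->]; exact: measurable_itv.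
  - by move=> k; eexists.
  - move=> _ _ [x ->] [x' ->]; exists (Num.max x x').
    by apply/seteqP; split => z /=; rewrite !in_itv/= !andbT gt_max => /andP.
  - move=> _ [s ->]; change (m1 `]s, +oo[%classic = m2 `]s, +oo[%classic); rewrite m1E m2E.
    (* Rays from a negative [s] must be matched too; on S > 0 they coincide with the ray from 0. *)
    rewrite (_ : _ `&` _ = [set o | Num.max 0 s < S o]); last first.
      by apply/seteqP; split => o /=; rewrite in_itv/= andbT gt_max; [move=> [-> ->]|move=> /andP[]].
    have [st|ts] := ltP s t.
      rewrite tailS; last by rewrite le_max lexx gt_max t0 st.
      rewrite (_ : _ @^-1` _ = `]s, +oo[%classic); last first.
        by apply/seteqP; split => x /=; rewrite !in_itv/= !andbT lt_min st andbT.
      rewrite EFinM; congr (_ * _)%E; rewrite /exponential_prob.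
      have [s0|s0] := leP 0 s; first by rewrite integral_exponential_itvy.
      rewrite mulr0 oppr0 expR0; apply/esym/eqP; rewrite eq_le; apply/andP; split.
        exact: (probability_le1 Q (measurable_itv _)).
      rewrite -[leLHS]/((1 : R)%:E) -expR0 -oppr0 -(mulr0 c) -integral_exponential_itvy//.
      apply: ge0_subset_integral => //.
      - by apply/measurable_EFinP/measurable_funTS; exact: measurable_exponential_pdf.
      - by move=> x _; rewrite lee_fin exponential_pdf_ge0// ltW.
      - by apply: subset_itvr; rewrite bnd_simp ltW.
    rewrite (_ : [set o | _] = set0); last first.
      apply/seteqP; split => o //=; rewrite gt_max => /andP[_ sS]; have /andP[_] := St o.
      by rewrite leNgt (le_lt_trans ts sS).
    rewrite (_ : _ @^-1` _ = set0) ?measure0 ?mule0//.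
    by apply/seteqP; split => x //=; rewrite in_itv/= andbT lt_min => /andP[_]; rewrite ltNge ts.
  - by move=> k; apply: le_lt_trans (probability_le1 P _) (ltry _); apply: measurableI => //;
       rewrite -[X in measurable X]setTI; apply: mS.
  - by move: mB; rewrite RGenOInfty.measurableE.
rewrite -(@ge0_integral_mrestr _ _ _ P _ mA (fun o => f (S o)))//; last exact: measurableT_comp.
transitivity (\int[m1]_x f x)%E.
  by rewrite /m1 [RHS](@ge0_integral_pushforward _ _ _ _ _ _ mS' (mrestr P mA)).
rewrite (eq_measure_integral m2); last by move=> B mB _; exact: Eu.
rewrite ge0_integral_mscale//=; congr (_ * _)%E.
rewrite (@ge0_integral_pushforward _ _ _ _ _ _ mm (mrestr Q measurableT))//.
have mfm : measurable_fun (setT : set (measurableTypeR R)) (fun x => f (Num.min x t)).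
  exact: (measurableT_comp mf mm).
rewrite preimage_setT ge0_integral_mrestr//; last by move=> x; exact: f0.
rewrite (@ge0_integral_density _ Q (exponential_pdf c) (fun x => f (Num.min x t)))//.
- exact: integrable_exponential_pdf.
- by move=> x; rewrite exponential_pdf_ge0// ltW.
Qed.

(** There are two atoms: mass 1 - p at 0, for an environment that starts in state 2, and mass p
    exp(-c t) at [t], for one that has not switched yet. *)
Lemma censored_exponential_law (f : R -> \bar R) : p <= 1 ->
  measurable_fun setT f -> (forall s, (0 <= f s)%E) ->
  (\int[P]_o f (S o) = (1 - p)%:E * f 0%R + (p * expR (- (c * t)))%:E * f t +
    p%:E * \int[leb]_(s in `]0%R, t[) ((c * expR (- (c * s)))%:E * f s))%E.
Proof.
move=> p1 mf f0.
have mA : measurable [set o | 0 < S o].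
  rewrite (_ : [set o | _] = S @^-1` `]0, +oo[); last first.
    by apply/seteqP; split => o /=; rewrite in_itv/= andbT.
  by rewrite -[X in measurable X]setTI; apply: mS.
have PA : P [set o | 0 < S o] = p%:E by rewrite tailS ?lexx// mulr0 oppr0 expR0 mulr1.
have mfS : measurable_fun setT (fun o => f (S o)) by exact: measurableT_comp.
have E0 : (\int[P]_(o in ~` [set o | (0 < S o)%R]) f (S o) = (1 - p)%:E * f 0%R)%E.
  rewrite (eq_integral (cst (f 0%R))); last first.
    move=> o; rewrite inE /= => /negP; rewrite -leNgt => So.
    by congr (f _); apply/eqP; rewrite eq_le So; case/andP: (St o).
  rewrite integral_cst//; last exact: measurableC.
  by rewrite muleC; congr (_ * _)%E; have := @probability_setC _ _ _ P _ mA; rewrite PA.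
pose h x := ((exponential_pdf c x)%:E * f (Num.min x t))%E.
have mh : measurable_fun setT h.
  apply: emeasurable_funM; first by apply/measurable_EFinP; exact: measurable_exponential_pdf.
  by apply: measurableT_comp => //; exact: measurable_minr.
have h0 x : (0 <= h x)%E by rewrite mule_ge0// lee_fin exponential_pdf_ge0// ltW.
have Eh : (\int[leb]_x h x = \int[leb]_(x in `[0%R, +oo[) h x)%E.
  rewrite [RHS]integral_mkcond; apply: eq_integral => x _; rewrite patchE.
  case: ifPn => //; rewrite notin_setE/= in_itv/= andbT => /negP; rewrite -ltNge => x0.
  by rewrite /h lt0_exponential_pdf// mul0e.
have E1 : (\int[leb]_(x in `[0%R, t[) h x =
    \int[leb]_(s in `]0%R, t[) ((c * expR (- (c * s)))%:E * f s))%E.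
  rewrite -integral_itv_obnd_cbnd; last exact: measurable_funTS.
  apply: eq_integral => x; rewrite inE/= in_itv/= => /andP[x0 xt].
  by rewrite /h min_l ?ltW// exponential_pdfE ?ltW// mulNr.
have E2 : (\int[leb]_(x in `[t, +oo[) h x = (expR (- (c * t)))%:E * f t)%E.
  rewrite -integral_itv_obnd_cbnd; last exact: measurable_funTS.
  transitivity (\int[leb]_(x in `]t, +oo[) (f t * (exponential_pdf c x)%:E))%E.
    by apply: eq_integral => x; rewrite inE/= in_itv/= andbT => tx; rewrite /h min_r ?ltW// muleC.
  rewrite ge0_integralZl//; first by rewrite integral_exponential_itvy ?ltW// muleC.
    by apply/measurable_EFinP/measurable_funTS; exact: measurable_exponential_pdf.
  by move=> x _; rewrite lee_fin exponential_pdf_ge0// ltW.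
have E3 : (\int[leb]_(x in `[0%R, +oo[) h x =
    \int[leb]_(x in `[0%R, t[) h x + \int[leb]_(x in `[t, +oo[) h x)%E.
  rewrite (_ : `[0%R, +oo[%classic = `[0%R, t[%classic `|` `[t, +oo[%classic); last first.
    by rewrite -itv_bndbnd_setU// bnd_simp ltW.
  rewrite ge0_integral_setU//.
  - exact: measurable_funTS.
  - apply/disj_setPS => x [/=]; rewrite !in_itv/= andbT => /andP[_ xt].
    by rewrite leNgt xt.
transitivity (\int[P]_(o in ~` [set o | (0 < S o)%R]) f (S o) +
    \int[P]_(o in [set o | (0 < S o)%R]) f (S o))%E.
  rewrite -ge0_integral_setU//.
  - by rewrite setUC setUv.
  - exact: measurableC.
  - exact: measurable_funTS.
  - by apply/disj_setPS; rewrite setIC setICr.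
rewrite E0 censored_exponential_tail// -/h Eh E3 E1 E2 muleDr ?ge0_adde_def ?inE ?integral_ge0//.
- by rewrite EFinM muleA [X in (_ + X = _)%E]addeC addeA.
- by move=> x _; rewrite mule_ge0// lee_fin mulr_ge0 ?expR_ge0// ltW.
- by rewrite mule_ge0// lee_fin expR_ge0.
Qed.
End censored_exponential.

(** * The path switched at an independent time *)

(** Freezing lemma. The sample point is a second variable, living in the same set with the coarser
    sigma-algebra [<<s G >>], so that an event about a whole path can be conditioned on [U] without
    a space of paths. *)
Lemma prob_indep_sigma d d1 (T : measurableType d) (T1 : measurableType d1) R
    (P : probability T R) (A : set T) (U : T -> T1) (G : set (set T)) (H : T1 -> set T) :
  measurable A -> measurable_fun setT U -> G `<=` measurable ->
  (forall B C, measurable B -> <<s G >> C ->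
    P (A `&` U @^-1` B `&` C) = P (A `&` U @^-1` B) * P C)%E ->
  measurable [set z : T1 * g_sigma_algebraType G | H z.1 z.2] ->
  P (A `&` [set o | H (U o) o]) = (\int[P]_(o in A) P (H (U o)))%E.
Proof.
move=> mA mU GM indep mH.
have sGM C : <<s G >> C -> measurable C.
  by apply: smallest_sub => //; exact: sigma_algebra_measurable.
have mV : measurable_fun setT (id : T -> g_sigma_algebraType G).
  by move=> _ C mC; rewrite setTI; exact: sGM.
pose Q : probability _ R := distribution P (mfun_Sub (mem_set mV)).
have mf : measurable_fun setT (fun z : T1 * g_sigma_algebraType G =>
    (\1_[set z : T1 * g_sigma_algebraType G | H z.1 z.2] z)%:E : \bar R).
  by apply/measurable_EFinP; exact: measurable_indic.
have f0 (z : T1 * g_sigma_algebraType G) :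
    (0 <= (\1_[set z : T1 * g_sigma_algebraType G | H z.1 z.2] z)%:E :> \bar R)%E.
  by rewrite lee_fin indicE.
have mUV : measurable_fun setT (fun o => (U o, o : g_sigma_algebraType G)).
  exact: measurable_fun_pair.
have mHU : measurable [set o | H (U o) o].
  by rewrite -[X in measurable X]setTI; exact: (mUV measurableT _ mH).
have := @ge0_integral_indep _ _ _ _ _ _ R P Q A U _ _ mA mU mV _ mf f0.
move=> /(_ _)/= E; rewrite setIC -(integral_indic P mA mHU).
transitivity (\int[P]_(w in A) (\1_[set z : T1 * g_sigma_algebraType G | H z.1 z.2] (U w, w))%:E)%E.
  by apply: eq_integral => o _; congr (_%:E); rewrite !indicE; congr (_ %:R); apply/idP/idP;
    rewrite !inE.
rewrite E; last by move=> B C mB mC; exact: indep.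
apply: eq_integral => o _.
have mHo : measurable (H (U o) : set (g_sigma_algebraType G)).
  have := measurable_xsection (U o) mH; congr measurable.
  by apply/seteqP; split => v; rewrite /xsection/= inE.
rewrite -[RHS]/(Q (H (U o))) -(setIT (H (U o))) -(integral_indic Q measurableT mHo).
by apply: eq_integral => v _; congr (_%:E); rewrite !indicE; congr (_ %:R); apply/idP/idP;
    rewrite !inE.
Qed.

Lemma within_nneg_continuous_comp R (z h : R -> R) :
  {within `[0, +oo[, continuous z} -> {within `[0, +oo[, continuous h} ->
  (forall u, 0 <= u -> 0 <= h u) -> {within `[0, +oo[, continuous (z \o h)}.
Proof.
move=> /subspace_continuousP cz /subspace_continuousP ch h0; apply/subspace_continuousP => u u0.
have hu : `[0, +oo[%classic (h u).
  by move: u0; rewrite /= !in_itv/= !andbT; exact: h0.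
apply/cvgrPdist_lt => e e0; have /cvgrPdist_lt/(_ e e0) := cz _ hu.
rewrite near_withinE => Hz; rewrite near_withinE.
have Hh : nbhs u (fun v => `[0, +oo[%classic v -> `[0, +oo[%classic (h v) -> `|z (h u) - z (h v)| < e).
  exact: (ch u u0 _ Hz).
apply: filterS Hh => v /= Hv v0; apply: Hv => //.
by move: v0; rewrite /= !in_itv/= !andbT; exact: h0.
Qed.

Definition process_events (T : Type) R (W : R -> T -> R) : set (set T) :=
  [set A | exists (t : R) (B : set R), [/\ 0 <= t, measurable B & A = W t @^-1` B]].

Lemma measurable_process (T : pointedType) R (W : R -> T -> R) (t : R) : 0 <= t ->
  measurable_fun (setT : set (g_sigma_algebraType (process_events W))) (W t).
Proof.
move=> t0 _ B mB; rewrite setTI; apply: sub_sigma_algebra.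
by exists t, B.
Qed.

Lemma process_events_measurable d (T : measurableType d) R (P : probability T R)
    (b w : R) (W : R -> T -> R) : wiener_process P b w W -> process_events W `<=` measurable.
Proof.
move=> hW _ [t [B [t0 mB ->]]]; rewrite -[X in measurable X]setTI.
exact: (wiener_measurable hW).
Qed.

(* The probability of staying above 0 up to time [t], extended to all [t] and [x] so as to be
   bounded and measurable. *)
Definition survival R (b w t x : R) : R :=
  if t <= 0 then 1 else fine (killed b w (cst 1) t (Num.max 0 x)).

Section survival.
Variables (R : realType) (b w : R).
Hypothesis w0 : w != 0.

Let x0 (x : R) : 0 <= Num.max 0 x. Proof. by rewrite le_max lexx. Qed.

Lemma survival_killed t x : 0 < t -> 0 <= x -> (survival b w t x)%:E = killed b w (cst 1) t x.
Proof.
move=> t0 xx; rewrite /survival leNgt t0/= max_r// fineK//.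
by apply: killed_fin_num => // z; rewrite ler01 lexx.
Qed.

Lemma survival_itv t x : 0 <= survival b w t x <= 1.
Proof.
rewrite /survival; case: (leP t 0) => [_|t0]; first by rewrite ler01 lexx.
have F : killed b w (cst 1) t (Num.max 0 x) \is a fin_num.
  by apply: killed_fin_num => // z; rewrite ler01 lexx.
rewrite fine_ge0 ?killed_ge0//= -lee_fin fineK//.
by apply: killed_le => // z; rewrite ler01 lexx.
Qed.

Lemma measurable_survival t : measurable_fun setT (survival b w t).
Proof.
rewrite /survival; case: (leP t 0) => [_|t0]; first exact: measurable_cst.
apply: measurableT_comp; first exact: fine_measurable.
have mk : measurable_fun (`[0, +oo[%classic : set R) (killed b w (cst 1) t).
  exact: measurable_killed.
have mm : measurable_fun setT (fun x : R => Num.max 0 x) by exact: measurable_maxr.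
by apply: (measurable_comp_nneg mk mm).
Qed.

Lemma cvg_survival (t x : R) (t_ x_ : nat -> R) : 0 < t -> t_ @ \oo --> t -> x_ @ \oo --> x ->
  survival b w (t_ n) (x_ n) @[n --> \oo] --> survival b w t x.
Proof.
move=> t0 tt xx.
have mx : Num.max 0 (x_ n) @[n --> \oo] --> Num.max 0 x.
  under eq_fun do rewrite maxr_absE; rewrite maxr_absE.
  apply: cvgM; last exact: cvg_cst.
  by apply: cvgD; [apply: cvgD => //; exact: cvg_cst|apply: cvg_norm; apply: cvgB => //; exact: cvg_cst].
have := @cvg_killed R b w t (Num.max 0 x) (cst 1) t_ (fun n => Num.max 0 (x_ n)) (fun=> cst 1)
  w0 t0 _ tt mx _ _ _.
move=> /(_ _ _ _ _) H.
have K : killed b w (cst 1) t (Num.max 0 x) = (survival b w t x)%:E.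
  rewrite /survival leNgt t0/= fineK//.
  by apply: killed_fin_num => // z; rewrite ler01 lexx.
have {}H : fine (killed b w (cst 1) (t_ n) (Num.max 0 (x_ n))) @[n --> \oo] --> survival b w t x.
  apply: fine_cvg; rewrite -K; apply: H => //.
  - by move=> n z; rewrite ler01 lexx.
  - by move=> z _; exact: cvg_cst.
apply: cvg_trans H; apply: near_eq_cvg; near=> n; rewrite /survival leNgt ifF//; apply/negbF; near: n.
exact: (cvgr_gt t).
Unshelve. all: by end_near. Qed.

Lemma continuous_survival t x : {for x, continuous (survival b w t)}.
Proof.
have [t0|t0] := ltP 0 t; last first.
  by rewrite /prop_for /continuous_at /survival t0; exact: cvg_cst.
suff : survival b w t z @[z --> x] --> survival b w t x by [].
apply/(@cvg_nbhsP _ R^o) => u ux; apply: cvg_survival => //; exact: cvg_cst.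
Qed.
End survival.

Section two_phase.
Context d (T : measurableType d) R (P : probability T R)
  (b1 w1 b2 w2 : R) (W1 W2 : R -> T -> R).
Hypotheses (hW1 : wiener_process P b1 w1 W1) (hW2 : wiener_process P b2 w2 W2)
  (w10 : w1 != 0) (w20 : w2 != 0)
  (indep : forall A B, process_sigma W1 A -> process_sigma W2 B -> P (A `&` B) = (P A * P B)%E).

Definition two_phase_path (x s u : R) (o : T) : R :=
  x + W1 (Num.min u s) o + W2 (u - Num.min u s) o.

(* The probability that the path from [x], switching at time [s], does not pass before [t]. *)
Definition two_phase_survival (t x s : R) : \bar R :=
  if s <= 0 then (survival b2 w2 t x)%:E
  else if t <= s then (survival b1 w1 t x)%:E
  else killed b1 w1 (survival b2 w2 (t - s)) s x.

Lemma survival_law b w (W : R -> T -> R) t x : w != 0 -> wiener_process P b w W -> 0 < t -> 0 <= x ->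
  P (stays_nneg (fun u o => x + W u o) t) = (survival b w t x)%:E.
Proof.
move=> w0 hW t0 x0; rewrite survival_killed// -(killed_law hW)//; last first.
- by move=> z _; exact: cvg_cst.
- by move=> z /=; rewrite ler01 lexx.
- by rewrite /= integral_cst ?mul1e//; exact: (measurable_stays_nneg_addl x hW (ltW t0)).
Qed.

Lemma measurable_stays_nneg_sigma (W : R -> T -> R) b w (t : R) : 0 <= t ->
  wiener_process P b w W -> forall G, process_events W `<=` <<s G >> ->
  measurable [set z : R * g_sigma_algebraType G |
     stays_nneg (fun u o => z.1 + W u o) t z.2].
Proof.
move=> t0 hW G WG.
rewrite (_ : [set z | _] = stays_nneg (fun u (z : R * g_sigma_algebraType G) => z.1 + W u z.2) t)//.
apply: measurable_stays_nneg => //.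
  move=> u u0; apply: measurable_funD; first exact: measurable_fst.
  apply: measurableT_comp; last exact: measurable_snd.
  by move=> _ B mB; rewrite setTI; apply: WG; exists u, B.
by move=> z; exact/within_nneg_continuous_addl/(wiener_continuous hW).
Qed.

(** The Markov property at the deterministic time [s]: the event splits into survival of the first
    path up to [s] and survival of the second from the point reached, the latter frozen by
    independence of the paths. The ends s = 0 and s = t involve one path only. *)
Lemma two_phase_law t x s : 0 < t -> 0 <= x -> 0 <= s <= t ->
  P (stays_nneg (two_phase_path x s) t) = two_phase_survival t x s.
Proof.
move=> t0 x0 /andP[s0 st]; rewrite /two_phase_survival.
have [s0'|s0'] := leP s 0.
  have -> : s = 0 by apply/eqP; rewrite eq_le s0 s0'.
  rewrite -(survival_law w20 hW2)//; congr (P _); apply/seteqP; split => o H u ut; have := H u ut;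
    by case/andP: ut => u0 _; rewrite /two_phase_path min_r// (wiener_start hW1) addr0 subr0.
have [ts|st'] := leP t s.
  have -> : s = t by apply/eqP; rewrite eq_le st ts.
  rewrite -(survival_law w10 hW1)//; congr (P _); apply/seteqP; split => o H u ut; have := H u ut;
    by case/andP: ut => u0 ut; rewrite /two_phase_path min_l// subrr (wiener_start hW2) addr0.
have ts0 : 0 < t - s by rewrite subr_gt0.
have sf z : 0 <= survival b2 w2 (t - s) z <= 1 by exact: survival_itv.
rewrite -(killed_law hW1)//; first last.
- by move=> z _; exact: continuous_survival.
- exact: measurable_survival.
have -> : stays_nneg (two_phase_path x s) t =
    stays_nneg (fun u o => x + W1 u o) s `&`
    [set o | stays_nneg (fun u o => x + W1 s o + W2 u o) (t - s) o].
  apply/seteqP; split => o.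
    move=> H; split => u /andP[u0 us].
      have := H u; rewrite u0 (le_trans us)// /two_phase_path min_l// subrr (wiener_start hW2) addr0.
      exact.
    have := H (u + s); rewrite /two_phase_path min_r ?lerDr// addrK; apply.
    by rewrite addr_ge0//= -lerBrDr.
  move=> [H1 H2] u /andP[u0 ut]; rewrite /two_phase_path; have [us|su] := leP u s.
    by rewrite subrr (wiener_start hW2) addr0; apply: H1; rewrite u0.
  by apply: H2; rewrite subr_ge0 (ltW su) lerB.
have mU : measurable_fun setT (fun o => x + W1 s o).
  by apply: measurable_funD => //; exact: (wiener_measurable hW1).
have mA : measurable (stays_nneg (fun u o => x + W1 u o) s).
  exact: (measurable_stays_nneg_addl x hW1).
rewrite (@prob_indep_sigma _ _ T R R P _ (fun o => x + W1 s o) (process_events W2)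
  (fun z o => stays_nneg (fun u o => z + W2 u o) (t - s) o))//.
- apply: eq_integral => o; rewrite inE => Ho; apply: (survival_law w20 hW2) => //.
  by apply: Ho; rewrite s0 lexx.
- exact: (process_events_measurable hW2).
- move=> B C mB mC; apply: indep => //.
  change (@measurable _ (g_sigma_algebraType (process_events W1))
    (stays_nneg (fun u o => x + W1 u o) s `&` (fun o => x + W1 s o) @^-1` B)).
  apply: measurableI.
    apply: measurable_stays_nneg => //.
      by move=> u u0; apply: measurable_funD => //; exact: measurable_process.
    by move=> o; exact/within_nneg_continuous_addl/(wiener_continuous hW1).
  rewrite -[X in measurable X]setTI.
  suff : measurable_fun (setT : set (g_sigma_algebraType (process_events W1))) (fun o => x + W1 s o).
    exact.
  by apply: measurable_funD => //; exact: measurable_process.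
- by apply: (@measurable_stays_nneg_sigma W2 b2 w2) => //; exact: ltW.
Qed.

Lemma two_phase_path_continuous x s o : 0 <= s ->
  {within `[0, +oo[, continuous (fun u => two_phase_path x s u o)}.
Proof.
move=> s0; have cm : continuous (fun u : R => Num.min u s).
  by move=> u; apply: continuous_min; [exact: cvg_id|exact: cvg_cst].
apply: (@within_continuousD _ _ _ _ (fun u => x + W1 (Num.min u s) o) (fun u => W2 (u - Num.min u s) o)).
  apply: within_nneg_continuous_addl.
  apply: (@within_nneg_continuous_comp _ (fun u => W1 u o) (fun u => Num.min u s)).
  - exact: (wiener_continuous hW1).
  - exact: continuous_subspaceT.
  - by move=> u u0; rewrite le_min u0.
apply: (@within_nneg_continuous_comp _ (fun u => W2 u o) (fun u => u - Num.min u s)).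
- exact: (wiener_continuous hW2).
- by apply: continuous_subspaceT => u; apply: cvgB; [exact: cvg_id|exact: cm].
- by move=> u u0; rewrite subr_ge0 ge_min lexx.
Qed.

Variable S : T -> R.
Hypotheses (mS : measurable_fun setT S)
  (indepS : forall B C1 C2, measurable B -> process_sigma W1 C1 -> process_sigma W2 C2 ->
     P (S @^-1` B `&` C1 `&` C2) = (P (S @^-1` B) * P C1 * P C2)%E).

Let G : set (set T) := [set C | exists C1 C2,
  [/\ process_sigma W1 C1, process_sigma W2 C2 & C = C1 `&` C2]].

Let sigma_sub W b w C : wiener_process P b w W -> process_sigma W C -> measurable C.
Proof.
move=> hW; apply: smallest_sub; first exact: sigma_algebra_measurable.
exact: (process_events_measurable hW).
Qed.

Let GM : G `<=` measurable.
Proof.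
move=> _ [C1 [C2 [s1 s2 ->]]].
by apply: measurableI; [exact: (sigma_sub hW1)|exact: (sigma_sub hW2)].
Qed.

Let sT (W : R -> T -> R) : process_sigma W (setT : set T).
Proof. exact: (@measurableT _ (g_sigma_algebraType (process_events W))). Qed.

Let GT : G setT.
Proof. by exists setT, setT; split => //; rewrite setIT. Qed.

(** Pairwise intersections of events of the two paths form a pi-system, which lifts the threefold
    independence to their joint sigma-algebra. *)
Let indepG B C : measurable B -> <<s G >> C -> P (S @^-1` B `&` C) = (P (S @^-1` B) * P C)%E.
Proof.
move=> mB sC; have mD : measurable (S @^-1` B) by rewrite -[X in measurable X]setTI; exact: mS.
apply: (prob_indep_generated GM _ GT mD) => //.
  move=> _ _ [C1 [C2 [s1 s2 ->]]] [C1' [C2' [s1' s2' ->]]].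
  exists (C1 `&` C1'), (C2 `&` C2'); split; last by rewrite setIACA.
    exact: (@measurableI _ (g_sigma_algebraType (process_events W1))).
  exact: (@measurableI _ (g_sigma_algebraType (process_events W2))).
by move=> _ [C1 [C2 [s1 s2 ->]]]; rewrite setIA indepS// -muleA indep.
Qed.

Lemma switched_law t x : 0 < t -> 0 <= x -> (forall o, 0 <= S o <= t) ->
  measurable (stays_nneg (fun u o => two_phase_path x (S o) u o) t) /\
  P (stays_nneg (fun u o => two_phase_path x (S o) u o) t) =
  (\int[P]_o two_phase_survival t x (S o))%E.
Proof.
move=> t0 x0 St.
pose H s := stays_nneg (two_phase_path x (Num.max 0 s)) t.
have HE : stays_nneg (fun u o => two_phase_path x (S o) u o) t = [set o | H (S o) o].
  apply/seteqP; split => o Ho u /Ho; rewrite max_r//; by case/andP: (St o).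
have mH : measurable [set z : R * g_sigma_algebraType G | H z.1 z.2].
  rewrite (_ : [set z | _] = stays_nneg
    (fun u (z : R * g_sigma_algebraType G) => two_phase_path x (Num.max 0 z.1) u z.2) t)//.
  have m0 (v : R) : 0 <= Num.max 0 v by rewrite le_max lexx.
  have mm : measurable_fun setT (fun z : R * g_sigma_algebraType G => Num.max 0 z.1).
    by apply: measurable_maxr => //; exact: measurable_fst.
  have mW (W : R -> T -> R) b w v : wiener_process P b w W ->
      process_events W `<=` <<s G >> -> 0 <= v ->
      measurable_fun setT (fun z : R * g_sigma_algebraType G => W v z.2).
    move=> hW WG v0; apply: measurableT_comp; last exact: measurable_snd.
    by move=> _ B mB; rewrite setTI; apply: WG; exists v, B.
  have G1 : process_events W1 `<=` <<s G >>.
    move=> C s1; apply: sub_sigma_algebra; exists C, setT; rewrite setIT; split => //.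
    exact: sub_sigma_algebra.
  have G2 : process_events W2 `<=` <<s G >>.
    move=> C s1; apply: sub_sigma_algebra; exists setT, C; rewrite setTI; split => //.
    exact: sub_sigma_algebra.
  have mn u : measurable_fun setT (fun z : R * g_sigma_algebraType G => Num.min u (Num.max 0 z.1)).
    exact: measurable_minr.
  apply: measurable_stays_nneg; first exact: ltW.
    move=> u u0; apply: measurable_funD.
      apply: measurable_funD => //.
      apply: (@measurable_time_change _ _ _ (fun v (z : R * g_sigma_algebraType G) => W1 v z.2)) => //.
      - by move=> v v0; exact: (mW _ _ _ _ hW1).
      - move=> v z v0; apply: (@within_nneg_continuous_right _ (fun v => W1 v z.2)) => //.
        exact: (wiener_continuous hW1).
      - by move=> z; rewrite le_min u0 m0.
    apply: (@measurable_time_change _ _ _ (fun v (z : R * g_sigma_algebraType G) => W2 v z.2)) => //.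
    - by move=> v v0; exact: (mW _ _ _ _ hW2).
    - move=> v z v0; apply: (@within_nneg_continuous_right _ (fun v => W2 v z.2)) => //.
      exact: (wiener_continuous hW2).
    - by apply: measurable_funB.
    - by move=> z; rewrite subr_ge0 ge_min lexx.
  by move=> z; exact: two_phase_path_continuous.
split.
  rewrite HE.
  have mUV : measurable_fun setT (fun o => (S o, o : g_sigma_algebraType G)).
    apply: measurable_fun_pair => // _ C mC; rewrite setTI; move: mC.
    by apply: smallest_sub => //; exact: sigma_algebra_measurable.
  by rewrite -[X in measurable X]setTI; exact: (mUV measurableT _ mH).
rewrite HE -[in LHS](setTI [set o | H (S o) o]) (prob_indep_sigma (G := G))//.
  apply: eq_integral => o _; rewrite /H max_r; last by case/andP: (St o).
  exact: two_phase_law.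
by move=> B C mB sC; rewrite !setTI; exact: indepG.
Qed.
End two_phase.

(** * The first-passage event *)

(** If X vanishes at [s] then z = -l <= 0 there. Conversely, while X has not vanished its regulator
    stays at 0, so X = z > 0. *)
Lemma first_passage_lt (T : Type) R (X : R -> T -> R) (E : R -> T -> env)
    (z l : R -> R) (t : R) (o : T) :
  reflected_path z (fun s => X s o) l -> 0 < z 0 ->
  ((first_passage_time X E o < t%:E)%E <-> ~ (forall s, 0 < s -> s < t -> 0 < z s)).
Proof.
move=> hX z0.
have lge0 s : 0 <= s -> 0 <= l s.
  by move=> s0; rewrite -(regulator_start hX); apply: (regulator_nondecreasing hX).
split.
  move=> /ereal_inf_lt[_ [s [s0 Xs] <-]]; rewrite lte_fin => st H.
  have Xs0 : X s o = 0 by case: Xs => -[].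
  have := H s s0 st; have := reflected_decomposition hX (ltW s0); rewrite Xs0.
  by have := lge0 s (ltW s0); lra.
move=> H; rewrite ltNge; apply/negP => tT; apply: H => s s0 st.
have Xpos u : 0 <= u -> u <= s -> 0 < X u o.
  rewrite le_eqVlt => /predU1P[<- _|u0 us].
    by rewrite (reflected_decomposition hX)// (regulator_start hX) addr0.
  rewrite lt_neqAle (reflected_ge0 hX) ?(ltW u0)// andbT eq_sym; apply/eqP => Xu0.
  have : (first_passage_time X E o <= u%:E)%E.
    apply: ereal_inf_lbound; exists u => //; split => //.
    by rewrite Xu0; case: (E u o); [left|right].
  by move=> /(le_trans tT); rewrite lee_fin leNgt (le_lt_trans us st).
have : l 0 = l s.
  by apply: (regulator_support hX) => //; [exact: ltW|move=> u /andP[u0 us]; exact: Xpos].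
rewrite (regulator_start hX) => ls; have := Xpos s (ltW s0) (lexx s).
by rewrite (reflected_decomposition hX) ?(ltW s0)// -ls addr0.
Qed.

(** On each compact [0, t - t / (n + 1)] the minimum is attained, so positivity there means a margin
    1 / (m + 1); this gives a countable combination of closed events. *)
Lemma measurable_stays_pos d (T : measurableType d) R (z : R -> T -> R) (t : R) :
  0 < t -> (forall u, 0 <= u -> measurable_fun setT (z u)) ->
  (forall o, {within `[0, +oo[, continuous (fun u => z u o)}) -> (forall o, 0 < z 0 o) ->
  measurable [set o | forall s, 0 < s -> s < t -> 0 < z s o].
Proof.
move=> t0 mz cz z0.
have tn0 n : 0 <= t - t / n.+1%:R.
  by rewrite subr_ge0 ler_pdivrMr// ler_peMr ?ler1n// ltW.
rewrite (_ : [set o | _] = \bigcap_(n : nat) \bigcup_(m : nat)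
    stays_nneg (fun u o => - m.+1%:R^-1 + z u o) (t - t / n.+1%:R)).
  apply: bigcapT_measurable => n; apply: bigcupT_measurable => m.
  apply: measurable_stays_nneg.
  - exact: tn0.
  - by move=> u u0; apply: measurable_funD => //; exact: mz.
  - by move=> o; exact: within_nneg_continuous_addl.
apply/seteqP; split => o /= H.
  move=> n _; have [c cI cmin] : exists2 c, c \in `[0, t - t / n.+1%:R] &
      forall u, u \in `[0, t - t / n.+1%:R] -> z c o <= z u o.
    apply: EVT_min => //; apply: continuous_subspaceW (cz o) => u /=.
    by rewrite !in_itv/= andbT => /andP[].
  have zc : 0 < z c o.
    move: cI; rewrite in_itv/= => /andP[]; rewrite le_eqVlt => /predU1P[<- //|c0 ct].
    apply: H => //; apply: le_lt_trans ct _.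
    by rewrite gtrDl oppr_lt0 divr_gt0.
  have [m] := ltr_add_invr zc; rewrite add0r => mz0; exists m => // u ut.
  rewrite addrC subr_ge0 (le_trans (ltW mz0))//; apply: cmin.
  by rewrite in_itv.
move=> s s0 st.
have st1 : s / t < 1 by rewrite ltr_pdivrMr// mul1r.
have [n Hn] := ltr_add_invr st1.
have sn : s + t / n.+1%:R < t.
  by move: Hn; rewrite -(ltr_pM2r t0) mulrDl divfK ?gt_eqF// mul1r mulrC.
have [m _ /(_ s)] := H n I.
rewrite (ltW s0) lerBrDr (ltW sn) => /(_ isT) Hs.
apply: lt_le_trans (_ : m.+1%:R^-1 <= _); first by rewrite invr_gt0.
by rewrite -subr_ge0 addrC.
Qed.

(** * Regularity of the two-phase survival probability *)

Section two_phase_survival.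
Variables (R : realType) (b1 w1 b2 w2 t : R).
Hypotheses (w10 : w1 != 0) (w20 : w2 != 0) (t0 : 0 < t).

Lemma two_phase_survival_itv x s : 0 <= x ->
  (0 <= two_phase_survival b1 w1 b2 w2 t x s <= 1)%E.
Proof.
move=> x0; rewrite /two_phase_survival.
case: (leP s 0) => [_|s0]; first by rewrite !lee_fin survival_itv.
case: (leP t s) => [_|st]; first by rewrite !lee_fin survival_itv.
have sf z : 0 <= survival b2 w2 (t - s) z <= 1 by exact: survival_itv.
rewrite killed_ge0//=; last by move=> z; case/andP: (sf z).
by apply: killed_le => //; exact: measurable_survival.
Qed.

Lemma cvg_two_phase_killed (x s : R) (x_ s_ : nat -> R) : (forall n, 0 <= x_ n) ->
  x_ @ \oo --> x -> s_ @ \oo --> s -> 0 < s -> s < t ->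
  killed b1 w1 (survival b2 w2 (t - s_ n)) (s_ n) (x_ n) @[n --> \oo] -->
  killed b1 w1 (survival b2 w2 (t - s)) s x.
Proof.
move=> x0 xx ss s0 st; apply: cvg_killed => //.
- by move=> n; exact: measurable_survival.
- by move=> n z; exact: survival_itv.
- move=> z z0; apply: cvg_survival => //; first by rewrite subr_gt0.
    by apply: cvgB => //; exact: cvg_cst.
  exact: cvg_cst.
Qed.

Lemma cvg_two_phase_survival (x s : R) (x_ : nat -> R) : (forall n, 0 <= x_ n) ->
  x_ @ \oo --> x ->
  two_phase_survival b1 w1 b2 w2 t (x_ n) s @[n --> \oo] --> two_phase_survival b1 w1 b2 w2 t x s.
Proof.
move=> x0 xx; rewrite /two_phase_survival.
case: (leP s 0) => [_|s0].
  by apply: cvg_EFin; [exact: nearW|apply: cvg_survival => //; exact: cvg_cst].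
case: (leP t s) => [_|st].
  by apply: cvg_EFin; [exact: nearW|apply: cvg_survival => //; exact: cvg_cst].
by apply: cvg_two_phase_killed => //; exact: cvg_cst.
Qed.

Lemma measurable_two_phase_survival x : 0 <= x ->
  measurable_fun setT (two_phase_survival b1 w1 b2 w2 t x).
Proof.
move=> x0; pose g (s : R) := fine (killed b1 w1 (survival b2 w2 (t - s)) s x).
have mg : measurable_fun (`]0, t[%classic : set R) g.
  apply: open_continuous_measurable_fun; first exact: itv_open.
  move=> s; rewrite inE/= in_itv/= => /andP[s0 st].
  suff : g u @[u --> s] --> g s by [].
  apply/(@cvg_nbhsP _ R^o) => u us; apply: fine_cvg; rewrite fineK.
    by apply: cvg_two_phase_killed => //; exact: cvg_cst.
  apply: killed_fin_num => //; first exact: measurable_survival.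
  by move=> z; exact: survival_itv.
rewrite (_ : two_phase_survival b1 w1 b2 w2 t x = (fun s => if s <= 0 then (survival b2 w2 t x)%:E else
   if t <= s then (survival b1 w1 t x)%:E else killed b1 w1 (survival b2 w2 (t - s)) s x))//.
apply: measurable_fun_if => //; first exact: measurable_fun_ler.
apply: measurable_fun_if => //.
- rewrite setTI (_ : _ @^-1` _ = `]0, +oo[%classic); first exact: measurable_itv.
  by apply/seteqP; split => s /=; rewrite in_itv/= andbT ltNge; [move=> ->|move/negbTE].
- exact: measurable_funTS (measurable_fun_ler _ _).
rewrite (_ : setT `&` _ `&` _ = `]0, t[%classic); last first.
  apply/seteqP; split => s /=; rewrite in_itv/= !ltNge; first by move=> [[_ ->] ->].
  by move=> /andP[/negbTE -> /negbTE ->].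
apply: (eq_measurable_fun (EFin \o g)); last exact/measurable_EFinP.
move=> s; rewrite inE/= in_itv/= => /andP[s0 st]; rewrite fineK//.
by apply: killed_fin_num => //; [exact: measurable_survival|move=> z; exact: survival_itv].
Qed.
End two_phase_survival.

Lemma prob_eq_off_null d (T : measurableType d) R (P : probability T R)
    (N A B : set T) : measurable N -> P N = 0%E -> measurable A -> measurable B ->
  (forall o, ~ N o -> (A o <-> B o)) -> P A = P B.
Proof.
move=> mN N0 mA mB AB.
have aux C D : measurable C -> measurable D -> (forall o, ~ N o -> C o -> D o) -> (P C <= P D)%E.
  move=> mC mD CD; rewrite -[leRHS]adde0 -N0; apply: le_trans (measureU2 _ mD mN).
  apply: le_measure; [by rewrite inE|by rewrite inE; exact: measurableU|].
  by move=> o Co; case: (pselect (N o)) => [No|No]; [right|left; exact: CD].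
by apply/eqP; rewrite eq_le !aux// => o No; apply AB.
Qed.

Section first_passage.
Context d (T : measurableType d) R (P : probability T R)
  (b1 w1 b2 w2 : R) (eta : env -> R) (p y : R) (E : R -> T -> env)
  (W1 W2 : R -> T -> R) (X L : R -> T -> R).
Hypotheses (w10 : w1 != 0) (w20 : w2 != 0) (eta1 : 0 < eta env1) (eta2 : eta env2 = 0)
  (p01 : 0 <= p <= 1) (y0 : 0 < y)
  (hE : environment_process P eta p E)
  (hW1 : wiener_process P b1 w1 W1) (hW2 : wiener_process P b2 w2 W2)
  (indep : independent3 P (env_sigma E) (process_sigma W1) (process_sigma W2)).

Let occ i u o := occupation_time E i u o.
(** The start is a parameter because the squeeze compares paths from [y] and from slightly below. *)
Let z x u o := x + W1 (occ env1 u o) o + W2 (occ env2 u o) o.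

Hypothesis hX : forall o, reflected_path (fun u => z y u o) (fun u => X u o) (fun u => L u o).

Let mEi i s : 0 <= s -> measurable [set o | E s o = i].
Proof. exact: (environment_measurable hE). Qed.

Let rE s o : 0 <= s -> \forall u \near s^'+, E u o = E s o.
Proof. exact: (environment_right hE). Qed.

Let occ_ge0 i u o : 0 <= occ i u o.
Proof. exact: fine_ge0. Qed.

Let occ_le i u o : 0 <= u -> occ i u o <= u.
Proof. exact: (occupation_time_le o (mEi i) rE). Qed.

Let occ_continuous i o : {within `[0, +oo[, continuous (fun u => occ i u o)}.
Proof.
apply/subspace_continuousP => u; rewrite /= in_itv/= andbT => u0.
apply/cvgrPdist_lt => e e0; rewrite near_withinE.
near=> v => v0; rewrite /= in_itv/= andbT in v0.
have uv : `|u - v| < e by near: v; exact: nbhsx_ballx.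
apply: le_lt_trans uv; have [uv|vu] := leP u v.
  have /andP[h1 h2] := occupation_time_lipschitz o (mEi i) rE u0 uv.
  rewrite /from_subspace/= distrC [leRHS]distrC !ger0_norm ?subr_ge0//.
  by rewrite lerBlDl.
have /andP[h1 h2] := occupation_time_lipschitz o (mEi i) rE v0 (ltW vu).
by rewrite /from_subspace/= !ger0_norm ?subr_ge0 ?(ltW vu)// lerBlDl.
Unshelve. all: by end_near. Qed.

Let z_continuous x o : {within `[0, +oo[, continuous (fun u => z x u o)}.
Proof.
apply: (@within_continuousD _ _ _ _ (fun u => x + W1 (occ env1 u o) o) (fun u => W2 (occ env2 u o) o)).
  apply: within_nneg_continuous_addl.
  apply: (@within_nneg_continuous_comp _ (fun u => W1 u o) (fun u => occ env1 u o)) => //.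
  exact: (wiener_continuous hW1).
apply: (@within_nneg_continuous_comp _ (fun u => W2 u o) (fun u => occ env2 u o)) => //.
exact: (wiener_continuous hW2).
Qed.

Let mocc i u : measurable_fun setT (occ i u).
Proof. by apply: measurable_occupation_time; [exact: mEi|exact: rE]. Qed.

Let mz x u : 0 <= u -> measurable_fun setT (z x u).
Proof.
move=> u0; apply: measurable_funD; first apply: measurable_funD => //.
- apply: (@measurable_time_change _ _ _ W1 _ _ _ (mocc _ u)) => //; first exact: (wiener_measurable hW1).
  by move=> v o v0; apply: within_nneg_continuous_right v0; exact: (wiener_continuous hW1).
- apply: (@measurable_time_change _ _ _ W2 _ _ _ (mocc _ u)) => //; first exact: (wiener_measurable hW2).
  by move=> v o v0; apply: within_nneg_continuous_right v0; exact: (wiener_continuous hW2).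
Qed.

(** Off the null set of returning environments, the clocks at u <= t depend on the environment only
    through S = [occ env1 t], so [z] is a two-phase path. [S] is measurable for [env_sigma E], hence
    independent of both Wiener paths. *)
Let stays_law t x : 0 < t -> 0 <= x ->
  P (stays_nneg (z x) t) =
  (\int[P]_o two_phase_survival b1 w1 b2 w2 t x (occ env1 t o))%E.
Proof.
move=> t0 x0; have [N [mN N0 mono]] := environment_monotone hE eta2.
pose T' := g_sigma_algebraType [set A | exists (t : R) i, 0 <= t /\ A = [set w | E t w = i]].
have indep12 A B : process_sigma W1 A -> process_sigma W2 B -> P (A `&` B) = (P A * P B)%E.
  move=> sA sB; have := indep (A := setT) _ sA sB; rewrite setTI probability_setT mul1e; apply.
  exact: (@measurableT _ T').
have indepS B C1 C2 : measurable B -> process_sigma W1 C1 -> process_sigma W2 C2 ->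
    P (occ env1 t @^-1` B `&` C1 `&` C2) = (P (occ env1 t @^-1` B) * P C1 * P C2)%E.
  move=> mB s1 s2; apply: indep => //.
  have : measurable_fun (setT : set T') (occupation_time E env1 t).
    apply: measurable_occupation_time => // s s0; apply: sub_sigma_algebra.
    by exists s, env1.
  by move=> /(_ measurableT _ mB); rewrite setTI.
have St o : 0 <= occ env1 t o <= t by rewrite occ_ge0 occ_le// ltW.
have [mSw <-] := switched_law hW1 hW2 w10 w20 indep12 (mocc env1 t) indepS t0 x0 St.
have mz' : measurable (stays_nneg (z x) t).
  apply: measurable_stays_nneg => //; first exact: ltW.
  by move=> u u0; exact: mz.
have zE o : ~ N o -> forall u, 0 <= u <= t -> z x u o = two_phase_path W1 W2 x (occ env1 t o) u o.
  move=> No u ut.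
  have [c c0 [_ cP]] := occupation_switch (fun s => @rE s o) (mono o No) (ltW t0).
  have [h1 h2] := cP u ut; have /cP[t1 _] : 0 <= t <= t by rewrite lexx ltW.
  rewrite /z /two_phase_path /occ h1 h2 t1; case/andP: ut => u0 ut.
  by rewrite minCA minA (min_r ut).
apply: (prob_eq_off_null mN N0) => // o No; split => H u ut.
  by rewrite -zE//; exact: H.
by rewrite zE//; exact: H.
Qed.

(* {T_y >= t} is squeezed between the events of staying nonnegative from [y] and from [y - e]. *)
Let stays_cvg t : 0 < t ->
  P (stays_nneg (z (y - y / n.+2%:R)) t) @[n --> \oo] --> P (stays_nneg (z y) t).
Proof.
move=> t0; have x0 n : 0 <= y - y / n.+2%:R.
  by rewrite subr_ge0 ler_pdivrMr// ler_peMr ?ler1n// ltW.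
rewrite stays_law ?(ltW y0)//; under eq_fun do rewrite stays_law//.
have ys : 0 <= y by exact: ltW.
have mphi x : 0 <= x ->
    measurable_fun setT (fun o => two_phase_survival b1 w1 b2 w2 t x (occ env1 t o)).
  move=> xx; have := @measurable_two_phase_survival R b1 w1 b2 w2 t w10 w20 x xx.
  by move=> mt; apply: measurableT_comp mt _.
have := @dominated_cvg _ T R P setT measurableT
  (fun n o => two_phase_survival b1 w1 b2 w2 t (y - y / n.+2%:R) (occ env1 t o))
  (fun o => two_phase_survival b1 w1 b2 w2 t y (occ env1 t o)) (cst 1%E).
apply => //.
- by move=> n; exact: mphi.
- move=> o _; apply: cvg_two_phase_survival => //.
  rewrite -[X in _ --> X]subr0 -(mulr0 y); apply: cvgB; first exact: cvg_cst.
  apply: cvgM; first exact: cvg_cst.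
  have := @cvg_harmonic R; rewrite -(cvg_shiftS (fun n => n.+1%:R^-1 : R)).
  exact.
- by apply/integrableP; split => //; rewrite /= integral_cst//= normr1 probability_setT mul1e ltry.
- move=> n o _; have /andP[h0 h1] :=
    two_phase_survival_itv b1 b2 t w10 w20 (occ env1 t o) (x0 n).
  by rewrite gee0_abs.
Qed.

Let mstays t x : 0 <= t -> measurable (stays_nneg (z x) t).
Proof. by move=> t0; apply: measurable_stays_nneg => // u u0; exact: mz. Qed.

Let z0 x o : z x 0 o = x.
Proof.
have h i : occ i 0 o = 0 by apply/eqP; rewrite eq_le occ_le// occ_ge0.
by rewrite /z !h (wiener_start hW1) (wiener_start hW2) !addr0.
Qed.

(** Positivity before [t] implies nonnegativity up to [t] by continuity; conversely a path that
    stays nonnegative from a lower start is positive from [y]. The limit [stays_cvg] closes the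
    gap. *)
Let pos_law t : 0 < t ->
  P [set o | forall s, 0 < s -> s < t -> 0 < z y s o] = P (stays_nneg (z y) t).
Proof.
move=> t0; have mp : measurable [set o | forall s, 0 < s -> s < t -> 0 < z y s o].
  apply: measurable_stays_pos => //; first by move=> u u0; exact: mz.
  by move=> o; rewrite z0.
apply/eqP; rewrite eq_le; apply/andP; split.
  apply: le_measure; [by rewrite inE|by rewrite inE; apply: mstays; exact: ltW|].
  move=> o H u /andP[u0 ut]; rewrite leNgt; apply/negP => zu.
  have u00 : 0 < u by rewrite lt_neqAle u0 andbT; apply: contraTneq zu => <-; rewrite z0 -leNgt ltW.
  have /nbhs_ballP[e e0 He] := within_nneg_continuous_lt (@z_continuous y o) u0 zu.
  (* A point slightly before [u], still negative: strict positivity is only known before [t], and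
     [u] may equal [t]. *)
  pose v := u - Num.min (u / 2) (e / 2).
  have m0 : 0 < Num.min (u / 2) (e / 2) by rewrite lt_min !divr_gt0.
  have mu2 : Num.min (u / 2) (e / 2) <= u / 2 by rewrite ge_min lexx.
  have me2 : Num.min (u / 2) (e / 2) <= e / 2 by rewrite ge_min lexx orbT.
  have v0 : 0 < v by rewrite /v; lra.
  have vt : v < t by rewrite /v; lra.
  have : z y v o < 0.
    apply: He; last exact: ltW.
    by rewrite /ball/= /v opprB addrC subrK gtr0_norm//; move: (e0 : 0 < e) => ee; lra.
  by rewrite ltNge (ltW (H v v0 vt)).
apply: (cvge_to_le (stays_cvg t0)); apply: nearW => n.
apply: le_measure; [by rewrite inE; apply: mstays; exact: ltW|by rewrite inE|].
move=> o H s s0 st; have := H s; rewrite (ltW s0) (ltW st) => /(_ isT).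
have : 0 < y / n.+2%:R by rewrite divr_gt0.
rewrite /z; move: (y / n.+2%:R) => c c0; lra.
Qed.

Lemma first_passage_survival t : 0 < t ->
  (1 - first_passage_cdf P X E t)%:E =
  ((1 - p)%:E * two_phase_survival b1 w1 b2 w2 t y 0 +
   (p * expR (- (eta env1 * t)))%:E * two_phase_survival b1 w1 b2 w2 t y t +
   p%:E * \int[leb]_(s in `]0%R, t[)
     ((eta env1 * expR (- (eta env1 * s)))%:E * two_phase_survival b1 w1 b2 w2 t y s))%E.
Proof.
move=> t0; have ys : 0 <= y by exact: ltW.
have mp : measurable [set o | forall s, 0 < s -> s < t -> 0 < z y s o].
  apply: measurable_stays_pos => //; first by move=> u u0; exact: mz.
  by move=> o; rewrite z0.
have fE : [set o | (first_passage_time X E o < t%:E)%E] =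
    ~` [set o | forall s, 0 < s -> s < t -> 0 < z y s o].
  apply/seteqP; split => o /=; have zo : 0 < z y 0 o by rewrite z0.
    by move=> H; apply/(first_passage_lt E t (hX o)).
  by move=> H; apply/(first_passage_lt E t (hX o)).
rewrite /first_passage_cdf fE.
have Pc : P (~` [set o | forall s, 0 < s -> s < t -> 0 < z y s o]) = _ := probability_setC P mp.
rewrite Pc EFinB fineK; last first.
  by rewrite fin_numB fin_num_measure.
have E1 (v : \bar R) : v \is a fin_num -> (1 - (1 - v) = v)%E.
  by move=> /fineK <-; rewrite -!EFinB opprB addrC subrK.
rewrite E1; last exact: fin_num_measure.
rewrite [LHS]pos_law// stays_law//.
case/andP: p01 => p0 p1.
apply: censored_exponential_law => //.
- by move=> o; rewrite occ_ge0 occ_le// ltW.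
(* Off the null set, S > s holds exactly when the environment is still in state 1 at time s < t,
   which gives the exponential tail. *)
- move=> s /andP[s0 st]; rewrite -(environment_prob hE eta2 s0).
  have [N [mN N0 mono]] := environment_monotone hE eta2.
  apply: (prob_eq_off_null mN N0).
  + rewrite (_ : [set o | _] = occ env1 t @^-1` `]s, +oo[).
      by rewrite -[X in measurable X]setTI; apply: mocc.
    by apply/seteqP; split => o /=; rewrite in_itv/= andbT.
  + exact: mEi.
  + move=> o No; have [c c0 [cE cP]] := occupation_switch (fun s => @rE s o) (mono o No) (ltW t0).
    have /cP[t1 _] : 0 <= t <= t by rewrite lexx ltW.
    have /cE[c1 c2] : 0 <= s <= t by rewrite s0 ltW.
    rewrite /= /occ t1 lt_min st /=; split; [exact: c2|exact: c1].
- exact: measurable_two_phase_survival.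
- by move=> s; case/andP: (two_phase_survival_itv b1 b2 t w10 w20 s ys).
Qed.
End first_passage.

(** * The density of passages in the second environment *)

(** With r = |z - m| / |s|, widening the Gaussian by sqrt 2 multiplies its exponential by exp(r^2 /
    4), which dominates both 1 and r and so pays for z <= |s| r + |m|. *)
Lemma mul_normal_pdf_le R (m s z : R) : s != 0 ->
  z * normal_pdf m s z <= (`|s| + `|m|) * Num.sqrt 2 * normal_pdf m (Num.sqrt 2 * s) z.
Proof.
move=> s0; have as0 : 0 < `|s| by rewrite normr_gt0.
have q0 : 0 < Num.sqrt 2 :> R by rewrite sqrtr_gt0.
have q2 : Num.sqrt 2 ^+ 2 = 2 :> R by rewrite sqr_sqrtr.
rewrite !normal_pdf_expE ?mulf_neq0 ?(gt_eqF q0)// exprMn q2.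
set e := expR ((z - m) ^+ 2 / (4 * s ^+ 2)).
have eE : expR (- ((z - m) ^+ 2 / (2 * (2 * s ^+ 2)))) = e * expR (- ((z - m) ^+ 2 / (2 * s ^+ 2))).
  by rewrite -expRD; congr expR; field.
have qE : (Num.sqrt (2 * pi * (2 * s ^+ 2)))^-1 = (Num.sqrt 2)^-1 * (Num.sqrt (2 * pi * s ^+ 2))^-1 :> R.
  by rewrite -invfM -sqrtrM//; congr (Num.sqrt _)^-1; ring.
rewrite eE qE.
have -> : forall c f : R, (`|s| + `|m|) * Num.sqrt 2 * ((Num.sqrt 2)^-1 * c * (e * f)) =
    (`|s| + `|m|) * e * (c * f).
  by move=> c f; field; rewrite gt_eqF.
rewrite ler_wpM2r ?mulr_ge0 ?invr_ge0 ?sqrtr_ge0 ?expR_ge0//.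
pose r := `|z - m| / `|s|.
have eE' : e = expR (r ^+ 2 / 4).
  congr expR; rewrite /r expr_div_n !real_normK ?num_real//.
  by field.
have r0 : 0 <= r by rewrite divr_ge0.
have e1 := expR_ge1Dx (r ^+ 2 / 4); rewrite -eE' in e1.
have zr : z - m <= `|s| * r by rewrite /r mulrCA divff ?mulr1 ?ler_norm// gt_eqF.
have mm := ler_norm m; have m0 := normr_ge0 m.
have re : r <= e by apply: le_trans e1; have := sqr_ge0 (r / 2 - 1); lra.
have e11 : 1 <= e by apply: le_trans e1; rewrite lerDl divr_ge0 ?sqr_ge0.
have h1 : `|s| * r <= `|s| * e by rewrite ler_pM2l.
have h2 : `|m| <= `|m| * e by rewrite ler_peMr.
lra.
Qed.

(** Kendall's identity: the passage density is z / u times the free transition density from [z] to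
    0. *)
Lemma g_hat_normal_pdf R (b w u z : R) : w != 0 -> 0 < u ->
  g_hat b w u z = z / u * normal_pdf (- (b * u)) (w * Num.sqrt u) z.
Proof.
move=> w0 u0; rewrite normal_pdf_expE ?scale_sqrt_neq0// sqr_scale_sqrt ?(ltW u0)// opprK /g_hat.
rewrite [RHS]mulrA [2 * pi * (_ * _)]mulrA; congr (_ * _).
  have -> : 2 * pi * w ^+ 2 * u ^+ 3 = u ^+ 2 * (2 * pi * w ^+ 2 * u) by ring.
  by rewrite sqrtrM ?sqr_ge0// sqrtr_sqr gtr0_norm// invfM mulrA.
by rewrite mulrA.
Qed.

(** A bound for the integral of [g_hat] over its starting point, of order u^(-1/2) near u = 0. *)
Definition g_hat_mass R (b w u : R) : R :=
  Num.sqrt 2 * (`|w| * Num.sqrt u + `|b| * u) / u.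

Lemma g_hat_mass_gt0 R (b w u : R) : w != 0 -> 0 < u -> 0 < g_hat_mass b w u.
Proof.
move=> w0 u0; rewrite /g_hat_mass divr_gt0// mulr_gt0 ?sqrtr_gt0// ltr_wpDr//.
  by rewrite mulr_ge0// ltW.
by rewrite mulr_gt0 ?normr_gt0// sqrtr_gt0.
Qed.

Lemma g_hat_le_normal_pdf R (b w u z : R) : w != 0 -> 0 < u ->
  g_hat b w u z <= g_hat_mass b w u * normal_pdf (- (b * u)) (Num.sqrt 2 * (w * Num.sqrt u)) z.
Proof.
move=> w0 u0; rewrite g_hat_normal_pdf// /g_hat_mass mulrAC ler_pdivrMr//.
apply: le_trans (mul_normal_pdf_le _ _ (scale_sqrt_neq0 w0 u0)) _.
rewrite normrN !normrM (ger0_norm (sqrtr_ge0 _)) (ger0_norm (ltW u0)).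
suff -> : forall c N : R, Num.sqrt 2 * c / u * N * u = c * Num.sqrt 2 * N by exact: lexx.
by move=> c N; field; rewrite gt_eqF.
Qed.

Lemma normal_pdf_le_peak R (m s z : R) : s != 0 ->
  normal_pdf m s z <= (Num.sqrt (2 * pi * s ^+ 2))^-1.
Proof.
move=> s0; rewrite normal_pdf_expE// ger_pMr ?invr_gt0 ?sqrtr_gt0.
  by rewrite -expR0 ler_expR oppr_le0 divr_ge0 ?sqr_ge0// mulr_ge0 ?sqr_ge0.
by rewrite mulr_gt0 ?exprn_even_gt0// mulr_gt0// pi_gt0.
Qed.

(** The mass bound times the peak of the widened Gaussian, of variance 2 w^2 u. It is of order 1 / u
    near 0 and serves only for normalisation at a fixed positive [u]. *)
Definition g_hat_sup R (b w u : R) : R :=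
  g_hat_mass b w u * (Num.sqrt (2 * pi * (2 * (w ^+ 2 * u))))^-1.

Lemma g_hat_sup_gt0 R (b w u : R) : w != 0 -> 0 < u -> 0 < g_hat_sup b w u.
Proof.
move=> w0 u0; rewrite mulr_gt0 ?g_hat_mass_gt0// invr_gt0 sqrtr_gt0.
rewrite mulr_gt0//; first by rewrite mulr_gt0// pi_gt0.
by rewrite mulr_gt0// mulr_gt0// exprn_even_gt0.
Qed.

Lemma g_hat_le_sup R (b w u z : R) : w != 0 -> 0 < u ->
  g_hat b w u z <= g_hat_sup b w u.
Proof.
move=> w0 u0; apply: le_trans (g_hat_le_normal_pdf b z w0 u0) _.
have q0 : 0 < Num.sqrt 2 :> R by rewrite sqrtr_gt0.
have s0 : Num.sqrt 2 * (w * Num.sqrt u) != 0 by rewrite mulf_neq0 ?scale_sqrt_neq0// gt_eqF.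
rewrite /g_hat_sup ler_pM2l ?g_hat_mass_gt0//.
apply: le_trans (normal_pdf_le_peak _ _ s0) _.
by rewrite exprMn sqr_scale_sqrt ?(ltW u0)// sqr_sqrtr.
Qed.

Lemma cvg_g_hat_mass R (b w u : R) (u_ : nat -> R) : w != 0 -> 0 < u ->
  u_ @ \oo --> u -> g_hat_mass b w (u_ n) @[n --> \oo] --> g_hat_mass b w u.
Proof.
move=> w0 u0 uu; apply: cvgM; last by apply: cvgV => //; rewrite gt_eqF.
apply: cvgM; first exact: cvg_cst.
apply: cvgD; apply: cvgM => //; try exact: cvg_cst.
by apply: continuous_cvg => //; exact: sqrt_continuous.
Qed.

Lemma cvg_g_hat_sup R (b w u : R) (u_ : nat -> R) : w != 0 -> 0 < u ->
  u_ @ \oo --> u -> g_hat_sup b w (u_ n) @[n --> \oo] --> g_hat_sup b w u.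
Proof.
move=> w0 u0 uu; apply: cvgM; first exact: cvg_g_hat_mass.
have w2 : 0 < w ^+ 2 by rewrite exprn_even_gt0.
apply: cvgV.
  rewrite gt_eqF// sqrtr_gt0 mulr_gt0//; first by rewrite mulr_gt0// pi_gt0.
  by rewrite mulr_gt0// mulr_gt0.
apply: continuous_cvg; first exact: sqrt_continuous.
apply: cvgM; first exact: cvg_cst.
apply: cvgM; first exact: cvg_cst.
by apply: cvgM => //; exact: cvg_cst.
Qed.

(* The density of switching [tau] units after the start and reaching 0 after [u] further units. *)
Definition switch_density R (b1 w1 b2 w2 y tau u : R) : \bar R :=
  killed b1 w1 (g_hat b2 w2 u) tau y.

Section switch_density.
Variables (R : realType) (b1 w1 b2 w2 y : R).
Hypotheses (w10 : w1 != 0) (w20 : w2 != 0) (y0 : 0 < y).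
Local Notation k := (switch_density b1 w1 b2 w2 y).

(* [cvg_killed] requires functions with values in [0, 1]. *)
Definition normalised_g_hat u z := g_hat b2 w2 u (Num.max 0 z) / g_hat_sup b2 w2 u.

Lemma normalised_g_hat_itv u z : 0 < u -> 0 <= normalised_g_hat u z <= 1.
Proof.
move=> u0; have D0 := g_hat_sup_gt0 b2 w20 u0.
rewrite /normalised_g_hat divr_ge0 ?(ltW D0)//=.
  by rewrite ler_pdivrMr ?g_hat_sup_gt0// mul1r g_hat_le_sup.
by apply: g_hat_ge0; rewrite le_max lexx.
Qed.

Lemma measurable_normalised_g_hat u : measurable_fun setT (normalised_g_hat u).
Proof.
apply: measurable_funM; last exact: measurable_cst.
by apply: measurable_g_hat; [exact: measurable_cst|exact: measurable_maxr].
Qed.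

Lemma switch_densityE tau u : 0 < tau -> 0 < u ->
  k tau u = ((g_hat_sup b2 w2 u)%:E * killed b1 w1 (normalised_g_hat u) tau y)%E.
Proof.
move=> tau0 u0; have D0 := g_hat_sup_gt0 b2 w20 u0.
rewrite /switch_density /killed -ge0_integralZl_EFin//; last exact: ltW.
- apply: eq_integral => z; rewrite inE/= in_itv/= andbT => z0.
  rewrite -EFinM /normalised_g_hat max_r ?ltW//; congr (_%:E); field.
  by rewrite gt_eqF.
- move=> z /=; rewrite in_itv/= andbT => z0.
  have /andP[n0 _] := normalised_g_hat_itv z u0.
  by rewrite lee_fin mulr_ge0// alpha_hat_ge0// ltW.
- apply/measurable_EFinP; apply: measurable_funTS; apply: measurable_funM.
    by apply: measurable_alpha_hat.
  exact: measurable_normalised_g_hat.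
Qed.

Lemma switch_density_fin_num tau u : 0 < tau -> 0 < u -> k tau u \is a fin_num.
Proof.
move=> tau0 u0; rewrite switch_densityE// fin_numM// killed_fin_num//; first exact: ltW.
  exact: measurable_normalised_g_hat.
by move=> z; exact: normalised_g_hat_itv.
Qed.

Lemma cvg_switch_density (tau u : R) (tau_ u_ : nat -> R) : 0 < tau -> 0 < u ->
  (forall n, 0 < tau_ n) -> (forall n, 0 < u_ n) ->
  tau_ @ \oo --> tau -> u_ @ \oo --> u ->
  k (tau_ n) (u_ n) @[n --> \oo] --> k tau u.
Proof.
move=> tau0 u0 tp up tt uu; rewrite switch_densityE//.
under eq_fun do rewrite switch_densityE//.
apply: cvgeM.
- apply: mule_def_fin => //; apply: killed_fin_num => //; first exact: ltW.
    exact: measurable_normalised_g_hat.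
  by move=> z; exact: normalised_g_hat_itv.
- by apply: cvg_EFin; [exact: nearW|exact: cvg_g_hat_sup].
apply: cvg_killed => //.
- by move=> n; exact: ltW.
- exact: cvg_cst.
- by move=> n; exact: measurable_normalised_g_hat.
- by move=> n z; exact: normalised_g_hat_itv.
- move=> z z0; apply: cvgM; first by apply: cvg_g_hat => //; exact: cvg_cst.
  by apply: cvgV; [rewrite gt_eqF// g_hat_sup_gt0|exact: cvg_g_hat_sup].
Qed.

(** The first kernel is bounded by its peak and the second is integrated in [z], giving tau^(-1/2)
    u^(-1/2) near 0. Bounding the second by its supremum instead would give 1 / u, which is not
    integrable. *)
Lemma switch_density_le tau u : 0 < tau -> 0 < u ->
  (k tau u <= ((Num.sqrt (2 * pi * (w1 ^+ 2 * tau)))^-1 * g_hat_mass b2 w2 u)%:E)%E.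
Proof.
move=> tau0 u0; have m0 := g_hat_mass_gt0 b2 w20 u0.
set c := (Num.sqrt _)^-1; have c0 : 0 <= c by rewrite invr_ge0 sqrtr_ge0.
set s := Num.sqrt 2 * (w2 * Num.sqrt u).
have s0 : s != 0 by rewrite mulf_neq0 ?scale_sqrt_neq0// gt_eqF// sqrtr_gt0.
apply: (@le_trans _ _ (\int[leb]_(z in `]0%R, +oo[)
    ((c * g_hat_mass b2 w2 u) * normal_pdf (- (b2 * u)) s z)%:E)%E).
  apply: ge0_le_integral => //.
  - move=> z /=; rewrite in_itv/= andbT => z0.
    by rewrite lee_fin mulr_ge0 ?g_hat_ge0 ?alpha_hat_ge0// ltW.
  - apply/measurable_EFinP; apply: measurable_funTS; apply: measurable_funM.
      by apply: measurable_alpha_hat.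
    by apply: measurable_g_hat.
  - apply/measurable_EFinP; apply: measurable_funTS; apply: measurable_funM => //.
    exact: measurable_normal_pdf.
  move=> z /=; rewrite in_itv/= andbT => z0; rewrite lee_fin -mulrA.
  apply: ler_pM; [by apply: alpha_hat_ge0 => //; exact: ltW|by apply: g_hat_ge0; exact: ltW| |].
    apply: le_trans (alpha_hat_le _ _ _ w10 tau0) _.
    apply: le_trans (normal_pdf_le_peak _ _ (scale_sqrt_neq0 w10 tau0)) _.
    by rewrite sqr_scale_sqrt ?(ltW tau0).
  exact: g_hat_le_normal_pdf.
under eq_integral do rewrite EFinM.
rewrite ge0_integralZl_EFin//.
- rewrite -[leRHS]mule1; apply: lee_wpmul2l; first by rewrite lee_fin mulr_ge0// ltW.
  rewrite -(integral_normal_pdf (- (b2 * u)) s); apply: ge0_subset_integral => //.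
    by apply/measurable_EFinP; exact: measurable_normal_pdf.
  by move=> z _; rewrite lee_fin normal_pdf_ge0.
- by move=> z _; rewrite lee_fin normal_pdf_ge0.
- by apply/measurable_EFinP; apply: measurable_funTS; exact: measurable_normal_pdf.
- by rewrite mulr_ge0// ltW.
Qed.
End switch_density.

(** * Changes of variable and integration over a triangle *)

Lemma ge0_integral_itvoo_affine R (a b c d : R) (f : R -> \bar R) :
  0 < a -> measurable_fun setT f -> (forall x, (0 <= f x)%E) ->
  (\int[leb]_(x in `](a * c + b)%R, (a * d + b)%R[) f x =
   a%:E * \int[leb]_(x in `]c, d[) f (a * x + b)%R)%E.
Proof.
move=> a0 mf f0; rewrite integral_mkcond (@ge0_integral_affine _ a b)//.
- rewrite [in RHS]integral_mkcond; congr (_ * _)%E; apply: eq_integral => x _; rewrite !patchE.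
  congr (if _ then _ else _); apply/idP/idP; rewrite !inE/= !in_itv/= !ltrD2r !ltr_pM2l//.
- by apply/(measurable_restrictT _ _).1 => //; exact: measurable_funTS.
- by move=> x; rewrite patchE; case: ifP.
Qed.

Lemma ge0_integral_itvoo_reflect R (a b : R) (f : R -> \bar R) :
  measurable_fun setT f -> (forall x, (0 <= f x)%E) ->
  (\int[leb]_(x in `]a, b[) f (a + b - x)%R =
   \int[leb]_(x in `]a, b[) f x)%E.
Proof.
move=> mf f0; have mr : measurable_fun setT (f \_ `]a, b[).
  by apply/(measurable_restrictT _ _).1 => //; exact: measurable_funTS.
have r0 x : (0 <= (f \_ `]a, b[) x)%E by rewrite patchE; case: ifP.
rewrite [RHS]integral_mkcond (@ge0_integral_affine _ 1 (a + b) (f \_ `]a, b[))// mul1e.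
rewrite -(@ge0_integral_oppr _ (fun x => (f \_ `]a, b[) (1 * x + (a + b))%R)); last first.
- by move=> x; exact: r0.
- apply: measurableT_comp => //; apply: measurable_funD => //; exact: measurable_funM.
rewrite integral_mkcond; apply: eq_integral => x _; rewrite !patchE mul1r addrC.
by congr (if _ then _ else _); apply/idP/idP; rewrite !inE/= !in_itv/=; move=> /andP[? ?];
  apply/andP; split; lra.
Qed.

Section triangle.
Variables (R : realType) (t : R) (F : R -> R -> \bar R).
Hypotheses (mF : measurable_fun setT (fun z : R * R => F z.1 z.2))
  (F0 : forall s v, (0 <= F s v)%E).

(** Extension by 0 outside the triangle s < v, so that Tonelli applies on a square. *)
Let H (s v : R) : \bar R := if s < v then F s v else 0%E.

Let H0 s v : (0 <= H s v)%E.
Proof. by rewrite /H; case: ifP. Qed.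

Let mH : measurable_fun setT (fun z : R * R => H z.1 z.2).
Proof.
apply: measurable_fun_ifT => //.
by apply: measurable_fun_ltr; [exact: measurable_fst|exact: measurable_snd].
Qed.

Let integral_lower s : 0 < s -> s < t ->
  (\int[leb]_(v in `]s, t[) F s v = \int[leb]_(v in `]0%R, t[) H s v)%E.
Proof.
move=> s0 st; rewrite integral_mkcond [RHS]integral_mkcond; apply: eq_integral => v _.
rewrite !patchE /H !mem_setE !in_itv/=; case: (ltP s v) => sv /=; last by case: ifP.
by rewrite (lt_trans s0 sv).
Qed.

Let integral_upper v : v < t ->
  (\int[leb]_(s in `]0%R, v[) F s v = \int[leb]_(s in `]0%R, t[) H s v)%E.
Proof.
move=> vt; rewrite integral_mkcond [RHS]integral_mkcond; apply: eq_integral => s _.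
rewrite !patchE /H !mem_setE !in_itv/=; case: (ltP s v) => sv /=; rewrite ?andbF ?andbT//.
  by rewrite (lt_trans sv vt) andbT.
by case: ifP.
Qed.

Lemma integral_triangle :
  (\int[leb]_(s in `]0%R, t[) \int[leb]_(v in `]s, t[) F s v =
   \int[leb]_(v in `]0%R, t[) \int[leb]_(s in `]0%R, v[) F s v)%E.
Proof.
transitivity (\int[leb]_(s in `]0%R, t[) \int[leb]_(v in `]0%R, t[) H s v)%E.
  by apply: eq_integral => s; rewrite inE/= in_itv/= => /andP[s0 st]; exact: integral_lower.
have mH' : measurable_fun ((`]0, t[%classic : set R) `*` (`]0, t[%classic : set R))
  (fun z : R * R => H z.1 z.2) by exact: measurable_funTS.
rewrite (fubini_tonelli_in leb leb _ _ mH' (fun s v _ _ => H0 s v));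
  [|exact: measurable_itv..].
by apply: eq_integral => v; rewrite inE/= in_itv/= => /andP[v0 vt]; rewrite integral_upper.
Qed.

Lemma measurable_integral_lower :
  measurable_fun (`]0, t[%classic : set R) (fun s => \int[leb]_(v in `]s, t[) F s v)%E.
Proof.
apply: (eq_measurable_fun (fun s => \int[leb]_(v in `]0%R, t[) H s v)%E).
  by move=> s; rewrite inE/= in_itv/= => /andP[s0 st]; rewrite integral_lower.
by apply: (measurable_integral_in leb) => //; exact: measurable_funTS.
Qed.

Lemma measurable_integral_upper :
  measurable_fun (`]0, t[%classic : set R) (fun v => \int[leb]_(s in `]0%R, v[) F s v)%E.
Proof.
apply: (eq_measurable_fun (fun v => \int[leb]_(s in `]0%R, t[) H s v)%E).
  by move=> v; rewrite inE/= in_itv/= => /andP[v0 vt]; rewrite integral_upper.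
apply: (measurable_integral_in leb (f := fun v s => H s v)) => //.
apply: measurable_funTS.
have msw : measurable_fun setT (fun z : R * R => (z.2, z.1)).
  by apply: measurable_fun_pair; [exact: measurable_snd|exact: measurable_fst].
exact: (measurableT_comp mH msw).
Qed.
End triangle.

(** For t <= 0 the square root is 0 and so is its inverse, hence [alpha_hat] vanishes; nonnegativity
    needs no condition on time. *)
Lemma alpha_hat_nneg R (b w z t x : R) : w != 0 -> 0 <= x -> 0 <= z ->
  0 <= alpha_hat b w z t x.
Proof.
move=> w0 x0 z0; have [t0|t0] := ltP 0 t; first exact: alpha_hat_ge0.
rewrite /alpha_hat ler0_sqrtr ?invr0 ?mul0r//.
by rewrite mulr_ge0_le0// mulr_ge0 ?sqr_ge0// mulr_ge0 ?pi_ge0.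
Qed.

Section switching.
Variables (R : realType) (b1 w1 b2 w2 eta y : R).
Hypotheses (w10 : w1 != 0) (w20 : w2 != 0) (eta0 : 0 < eta) (y0 : 0 < y).
Local Notation k := (switch_density b1 w1 b2 w2 y).

Lemma switch_density_nneg tau u : (0 <= k tau u)%E.
Proof.
apply: integral_ge0 => z /=; rewrite in_itv/= andbT => z0.
by rewrite lee_fin mulr_ge0 ?g_hat_ge0 ?alpha_hat_nneg// ltW.
Qed.

Lemma measurable_switch_density d (T : measurableType d) (f g : T -> R) :
  measurable_fun setT f -> measurable_fun setT g ->
  measurable_fun setT (fun x => k (f x) (g x)).
Proof.
move=> mf mg; apply: (measurable_integral_in leb) => //.
  apply: measurable_funTS; apply/measurable_EFinP; apply: measurable_funM.
    apply: measurable_alpha_hat => //.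
    by apply: measurableT_comp => //; exact: measurable_fst.
  apply: measurable_g_hat => //.
  by apply: measurableT_comp => //; exact: measurable_fst.
move=> x z _ /=; rewrite in_itv/= andbT => z0.
by rewrite lee_fin mulr_ge0 ?g_hat_ge0 ?alpha_hat_nneg// ltW.
Qed.

(** Mass balance for a switch at [s]: a path alive at [s] either survives the remaining time or
    passes at some [v] in (s, t). It is [g_hat_survival] integrated against the absorbed kernel. *)
Lemma killed_survival_switch s t : 0 < s -> s < t ->
  (killed b1 w1 (survival b2 w2 (t - s)) s y + \int[leb]_(v in `]s, t[) k s (v - s)%R =
   (survival b1 w1 s y)%:E)%E.
Proof.
move=> s0 st; have ts : 0 < t - s by rewrite subr_gt0.
have al0 z : 0 < z -> 0 <= alpha_hat b1 w1 z s y.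
  by move=> z0; apply: alpha_hat_ge0 => //; exact: ltW.
have ma (f : R -> R) : measurable_fun setT f ->
    measurable_fun (`]0, +oo[%classic : set R) (fun z => (alpha_hat b1 w1 z s y * f z)%:E).
  move=> mf; apply/measurable_EFinP; apply: measurable_funTS; apply: measurable_funM => //.
  by apply: measurable_alpha_hat.
have ms := measurable_survival b2 w20 (t - s).
have sf z : 0 <= survival b2 w2 (t - s) z <= 1 by exact: survival_itv.
rewrite survival_killed ?(ltW y0)//.
have -> : (\int[leb]_(v in `]s, t[) k s (v - s)%R =
    killed b1 w1 (fun z => 1 - survival b2 w2 (t - s) z)%R s y)%E.
  rewrite /switch_density /killed fubini_tonelli_in//; first last.
  - move=> v z /=; rewrite !in_itv/= andbT => /andP[sv vt] z0.
    by rewrite lee_fin mulr_ge0 ?g_hat_ge0 ?alpha_hat_nneg// ltW.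
  - apply: measurable_funTS; apply/measurable_EFinP; apply: measurable_funM.
      by apply: measurable_alpha_hat => //; exact: measurable_snd.
    apply: measurable_g_hat; last exact: measurable_snd.
    by apply: measurable_funB => //; exact: measurable_fst.
  apply: eq_integral => z; rewrite inE/= in_itv/= andbT => z0.
  under eq_integral do rewrite EFinM.
  rewrite ge0_integralZl_EFin ?al0//; first last.
  - apply/measurable_EFinP; apply: measurable_funTS; apply: measurable_g_hat => //.
    exact: measurable_funB.
  - by move=> v _; rewrite lee_fin g_hat_ge0// ltW.
  rewrite [RHS]EFinM; congr (_ * _)%E.
  rewrite EFinB survival_killed ?(ltW z0)// -g_hat_survival//.
  have := @ge0_integral_itvoo_affine R 1 s 0 (t - s) (fun v => (g_hat b2 w2 (v - s) z)%:E) ltr01.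
  rewrite mulr0 add0r !mul1r subrK mul1e => ->.
  - by apply: eq_integral => r _; rewrite mul1r addrK.
  - by apply/measurable_EFinP; apply: measurable_g_hat => //; exact: measurable_funB.
  - by move=> v; rewrite lee_fin g_hat_ge0// ltW.
rewrite /killed -ge0_integralD//.
- apply: eq_integral => z _; rewrite -EFinD; congr (_%:E); rewrite /=; ring.
- move=> z /=; rewrite in_itv/= andbT => z0; have /andP[g0 _] := sf z.
  by rewrite lee_fin mulr_ge0// al0.
- exact: ma.
- move=> z /=; rewrite in_itv/= andbT => z0; have /andP[_ g1] := sf z.
  by rewrite lee_fin mulr_ge0 ?al0// subr_ge0.
- by apply: ma; exact: measurable_funB.
Qed.

(** The convolution of the formula without its factor eta p, with the space integral innermost, the
    order in which it can be estimated. *)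
Definition switch_passage_density v : \bar R :=
  (\int[leb]_(tau in `]0%R, v[) ((expR (- (eta * tau)))%:E * k tau (v - tau)))%E.

Lemma switch_passage_densityE v :
  (switch_passage_density v =
   \int[leb]_(z in `]0%R, +oo[) \int[leb]_(tau in `]0%R, v[)
     (expR (- (eta * tau)) * alpha_hat b1 w1 z tau y * g_hat b2 w2 (v - tau) z)%:E)%E.
Proof.
rewrite fubini_tonelli_in//; first last.
- move=> z tau /=; rewrite !in_itv/= andbT => z0 _.
  by rewrite lee_fin mulr_ge0 ?g_hat_ge0 ?(ltW z0)// mulr_ge0 ?expR_ge0// alpha_hat_nneg// ltW.
- apply: measurable_funTS; apply/measurable_EFinP; apply: measurable_funM.
    apply: measurable_funM.
      apply: measurableT_comp => //; apply: measurableT_comp => //.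
      by apply: measurable_funM => //; exact: measurable_snd.
    by apply: measurable_alpha_hat.
  apply: measurable_g_hat; last exact: measurable_fst.
  by apply: measurable_funB => //; exact: measurable_snd.
apply: eq_integral => tau _.
rewrite /switch_density /killed -ge0_integralZl_EFin ?expR_ge0//.
- by apply: eq_integral => z _; rewrite -EFinM mulrA.
- move=> z /=; rewrite in_itv/= andbT => z0.
  by rewrite lee_fin mulr_ge0 ?g_hat_ge0 ?alpha_hat_nneg// ltW.
- apply/measurable_EFinP; apply: measurable_funTS; apply: measurable_funM.
    by apply: measurable_alpha_hat.
  by apply: measurable_g_hat.
Qed.

(** The mass balance weighted by the switching density, with the integrals over 0 < s < v < t
    exchanged. The upper limit [t] then appears only as a bound of integration in the two remaining
    terms. *)
Lemma integral_killed_survival t : 0 < t ->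
  (\int[leb]_(s in `]0%R, t[)
     ((eta * expR (- (eta * s)))%:E * killed b1 w1 (survival b2 w2 (t - s)) s y) +
   eta%:E * \int[leb]_(v in `]0%R, t[) switch_passage_density v =
   \int[leb]_(s in `]0%R, t[) (eta * expR (- (eta * s)) * survival b1 w1 s y)%:E)%E.
Proof.
move=> t0.
have me : measurable_fun setT (fun s => expR (- (eta * s))).
  by apply: measurableT_comp => //; apply: measurableT_comp => //; exact: measurable_funM.
pose F s v := ((expR (- (eta * s)))%:E * k s (v - s)%R)%E.
have F0 s v : (0 <= F s v)%E by rewrite mule_ge0 ?switch_density_nneg// lee_fin expR_ge0.
have mF : measurable_fun setT (fun z : R * R => F z.1 z.2).
  apply: emeasurable_funM.
    by apply/measurable_EFinP; apply: measurableT_comp me _; exact: measurable_fst.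
  apply: measurable_switch_density; first exact: measurable_fst.
  by apply: measurable_funB; [exact: measurable_snd|exact: measurable_fst].
have mk (s : R) : measurable_fun setT (fun v : R => k s (v - s)).
  by apply: measurable_switch_density => //; exact: measurable_funB.
have mS : measurable_fun (`]0, t[%classic : set R)
    (fun s => ((eta * expR (- (eta * s)))%:E * killed b1 w1 (survival b2 w2 (t - s)) s y))%E.
  apply: (eq_measurable_fun (fun s => (eta * expR (- (eta * s)))%:E *
      two_phase_survival b1 w1 b2 w2 t y s)%E).
    move=> s; rewrite inE/= in_itv/= => /andP[s0 st].
    by rewrite /two_phase_survival leNgt s0/= leNgt st.
  apply: measurable_funTS; apply: emeasurable_funM.
    by apply/measurable_EFinP; exact: measurable_funM.
  by apply: measurable_two_phase_survival => //; exact: ltW.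
rewrite /switch_passage_density -(integral_triangle t mF F0).
rewrite -ge0_integralZl_EFin; first last.
- exact: ltW.
- exact: measurable_integral_lower.
- by move=> s _; apply: integral_ge0 => v _.
- exact: measurable_itv.
have eta_s0 s : 0 <= eta * expR (- (eta * s)) by rewrite mulr_ge0 ?expR_ge0// ltW.
have kl0 s : 0 < s -> s < t -> (0 <= killed b1 w1 (survival b2 w2 (t - s)) s y)%E.
  move=> s0 st; apply: killed_ge0 => //; first exact: ltW.
  by move=> z; case/andP: (survival_itv b2 w20 (t - s) z).
rewrite -ge0_integralD//; first last.
- by apply: measurable_funeM; exact: measurable_integral_lower.
- by move=> s _; rewrite mule_ge0 ?lee_fin ?(ltW eta0)//; apply: integral_ge0.
- by move=> s /=; rewrite in_itv/= => /andP[s0 st]; rewrite mule_ge0 ?lee_fin// kl0.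
apply: eq_integral => s; rewrite inE/= in_itv/= => /andP[s0 st].
rewrite ge0_integralZl_EFin ?expR_ge0//; first last.
- by apply: measurable_funTS; exact: mk.
- by move=> v _; exact: switch_density_nneg.
rewrite muleA -EFinM -muleDr//; first by rewrite killed_survival_switch// -EFinM.
by apply: ge0_adde_def; rewrite inE; [exact: kl0|apply: integral_ge0 => v _; exact: switch_density_nneg].
Qed.
End switching.

(** * The arcsine-type bound *)

Lemma integral_inv_sqrt R :
  (\int[leb]_(x in `]0%R, 1%R[) ((Num.sqrt x)^-1)%:E = (2 : R)%:E)%E.
Proof.
rewrite integral_itv_bndo_bndc; last first.
  apply: measurable_funTS; apply/measurable_EFinP; apply: measurable_funV.
  exact: measurable_sqrtr.
apply: eq_trans (@ge0_FTC2_right_open R (fun x => (Num.sqrt x)^-1) (fun x : R => 2 * Num.sqrt x) 0 1 0 _ _ _ _ _) _ => //.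
- move=> x x0; apply: continuous_comp; first exact: sqrt_continuous.
  by apply: inv_continuous; rewrite gt_eqF// sqrtr_gt0.
- move=> x x0; have d : is_derive x 1 Num.sqrt (2 * Num.sqrt x)^-1 by exact: is_derive1_sqrt.
  have : is_derive x 1 (fun x => 2 * Num.sqrt x) (2 *: (2 * Num.sqrt x)^-1) by exact: is_deriveZ.
  move/is_derive_eq; apply; rewrite /GRing.scale /= invfM mulrA divff ?mul1r//.
- rewrite (_ : nbhs (0 : R) = nbhs (2 * Num.sqrt 0 : R)); last by rewrite sqrtr0 mulr0.
  apply: cvg_at_right_filter; apply: cvgM; first exact: cvg_cst.
  exact: sqrt_continuous.
- by rewrite sqrtr1 mulr1 subr0.
Qed.

Lemma integrable_arcsine_bound R (C : R) :
  leb.-integrable (`]0, 1[%classic : set R)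
    (fun x => (C * ((Num.sqrt x)^-1 + (Num.sqrt (1 - x))^-1))%:E).
Proof.
have mf : measurable_fun setT (fun x : R => ((Num.sqrt x)^-1)).
  by apply: measurable_funV; exact: measurable_sqrtr.
have mEf : measurable_fun setT (fun x : R => ((Num.sqrt x)^-1)%:E) by exact/measurable_EFinP.
have f0 (x : R) : (0 <= ((Num.sqrt x)^-1)%:E)%E by rewrite lee_fin invr_ge0 sqrtr_ge0.
have m1 : measurable_fun setT (fun x : R => 1 - x) by exact: measurable_funB.
have mg : measurable_fun setT (fun x : R => (Num.sqrt (1 - x))^-1).
  exact: (measurableT_comp mf m1).
suff H : leb.-integrable (`]0, 1[%classic : set R)
    ((fun x => ((Num.sqrt x)^-1)%:E) \+ (fun x => ((Num.sqrt (1 - x))^-1)%:E))%E.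
  exact: (@integrableZl _ _ _ _ _ _ C _ H).
apply: integrableD => //; apply/integrableP; split.
- by apply: measurable_funTS; apply/measurable_EFinP.
- under eq_integral do rewrite /= ger0_norm ?invr_ge0 ?sqrtr_ge0//.
  by rewrite integral_inv_sqrt ltry.
- by apply: measurable_funTS; apply/measurable_EFinP.
- under eq_integral do rewrite /= ger0_norm ?invr_ge0 ?sqrtr_ge0//.
  have := @ge0_integral_itvoo_reflect R 0 1 _ mEf f0.
  rewrite add0r integral_inv_sqrt => E.
  by rewrite [X in (X < _)%E](_ : _ = (2 : R)%:E) ?ltry// -E.
Qed.

(** After the substitution tau = v x the powers of [v] in v tau^(-1/2) (v - tau)^(-1/2) cancel; only
    the drift part keeps sqrt v, bounded by sqrt M. The factor is thus uniform for v <= M. *)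
Definition arcsine_factor R (w1 b2 w2 M : R) : R :=
  Num.sqrt 2 / (Num.sqrt (2 * pi) * `|w1|) * (`|w2| + `|b2| * Num.sqrt M).

Lemma scaled_switch_density_bound R (w1 b2 w2 v M x : R) : w1 != 0 -> 0 < v -> v <= M ->
  0 < x -> x < 1 ->
  v * ((Num.sqrt (2 * pi * (w1 ^+ 2 * (v * x))))^-1 * g_hat_mass b2 w2 (v - v * x)) <=
  arcsine_factor w1 b2 w2 M * ((Num.sqrt x)^-1 + (Num.sqrt (1 - x))^-1).
Proof.
rewrite /arcsine_factor => w10 v0 vM x0 x1; have x1' : 0 < 1 - x by rewrite subr_gt0.
set a := Num.sqrt x; set c := Num.sqrt (1 - x); set r := Num.sqrt v.
have a0 : 0 < a by rewrite sqrtr_gt0.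
have c0 : 0 < c by rewrite sqrtr_gt0.
have r0 : 0 < r by rewrite sqrtr_gt0.
have aE : a ^+ 2 = x by rewrite sqr_sqrtr// ltW.
have cE : c ^+ 2 = 1 - x by rewrite sqr_sqrtr// ltW.
have rE : r ^+ 2 = v by rewrite sqr_sqrtr// ltW.
have aw : 0 < `|w1| by rewrite normr_gt0.
have p2 : 0 <= 2 * pi :> R by rewrite mulr_ge0 ?pi_ge0.
have q0 : 0 < Num.sqrt (2 * pi) :> R by rewrite sqrtr_gt0 mulr_gt0// pi_gt0.
have q2 : 0 < Num.sqrt 2 :> R by rewrite sqrtr_gt0.
have s1 : Num.sqrt (2 * pi * (w1 ^+ 2 * (v * x))) = Num.sqrt (2 * pi) * (`|w1| * (r * a)).
  rewrite sqrtrM// [Num.sqrt (w1 ^+ 2 * _)]sqrtrM ?sqr_ge0// sqrtr_sqr.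
  by rewrite [Num.sqrt (v * x)]sqrtrM// ltW.
have uE : v - v * x = r ^+ 2 * c ^+ 2 by rewrite rE cE; ring.
have s2 : Num.sqrt (r ^+ 2 * c ^+ 2) = r * c.
  by rewrite -exprMn sqrtr_sqr gtr0_norm// mulr_gt0.
rewrite s1 uE /g_hat_mass s2 -rE.
have -> : r ^+ 2 * ((Num.sqrt (2 * pi) * (`|w1| * (r * a)))^-1 *
    (Num.sqrt 2 * (`|w2| * (r * c) + `|b2| * (r ^+ 2 * c ^+ 2)) / (r ^+ 2 * c ^+ 2))) =
    Num.sqrt 2 / (Num.sqrt (2 * pi) * `|w1|) * ((`|w2| + `|b2| * (r * c)) * (a * c)^-1).
  move: (Num.sqrt (2 * pi)) q0 (Num.sqrt 2) q2 => q q0 q' q'0; field.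
  by rewrite (gt_eqF q0) (gt_eqF aw) (gt_eqF a0) (gt_eqF c0) (gt_eqF r0).
rewrite -[leRHS]mulrA ler_wpM2l//.
have c1 : c <= 1 by rewrite -sqrtr1 ler_wsqrtr// gerBl ltW.
have rM : r <= Num.sqrt M by rewrite ler_wsqrtr.
apply: ler_pM.
- by rewrite addr_ge0// mulr_ge0// mulr_ge0// ltW.
- by rewrite invr_ge0 mulr_ge0// ltW.
- rewrite lerD2l ler_wpM2l//; apply: le_trans rM.
  by rewrite ler_piMr// ltW.
(* Since a and c lie in [0, 1] and a^2 + c^2 = 1, a + c >= 1; hence 1 / (a c) is at most 1 / a + 1 /
   c. *)
have ac : a^-1 + c^-1 = (a + c) * (a * c)^-1 by field; rewrite (gt_eqF a0) (gt_eqF c0).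
rewrite ac ler_peMl//; first by rewrite invr_ge0 mulr_ge0// ltW.
have a1 : a <= 1 by rewrite -sqrtr1 ler_wsqrtr// ltW.
have := aE; have := cE; nra.
Qed.

Section switch_passage.
Variables (R : realType) (b1 w1 b2 w2 eta y : R).
Hypotheses (w10 : w1 != 0) (w20 : w2 != 0) (eta0 : 0 < eta) (y0 : 0 < y).
Local Notation k := (switch_density b1 w1 b2 w2 y).
Local Notation K := (switch_passage_density b1 w1 b2 w2 eta y).

(* The substitution [tau = v * x] makes the domain of integration independent of [v]. *)
Let scaled v x : \bar R := (v%:E * ((expR (- (eta * (v * x))))%:E * k (v * x) (v - v * x)))%E.

Let mscaled v : measurable_fun setT (scaled v).
Proof.
apply: measurable_funeM; apply: emeasurable_funM.
  apply/measurable_EFinP; apply: measurableT_comp => //; apply: measurableT_comp => //.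
  exact: measurable_funM.
by apply: measurable_switch_density => //; exact: measurable_funB.
Qed.

Let scaled_ge0 v x : 0 < v -> (0 <= scaled v x)%E.
Proof.
move=> v0; rewrite /scaled mule_ge0 ?lee_fin ?(ltW v0)// mule_ge0 ?lee_fin ?expR_ge0//.
by apply: switch_density_nneg.
Qed.

Let passage_scaled v : 0 < v -> (K v = \int[leb]_(x in `]0%R, 1%R[) scaled v x)%E.
Proof.
move=> v0; pose f tau := ((expR (- (eta * tau)))%:E * k tau (v - tau)%R)%E.
have mf : measurable_fun setT f.
  apply: emeasurable_funM.
    by apply/measurable_EFinP; apply: measurableT_comp => //; apply: measurableT_comp => //.
  by apply: measurable_switch_density => //; exact: measurable_funB.
have f0 tau : (0 <= f tau)%E.
  by rewrite mule_ge0 ?lee_fin ?expR_ge0// switch_density_nneg.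
have := @ge0_integral_itvoo_affine R v 0 0 1 f v0 mf f0.
rewrite mulr0 mulr1 !addr0 /switch_passage_density -/f => ->.
have pull (g : R -> \bar R) : measurable_fun setT g -> (forall x, (0 <= g x)%E) ->
    (\int[leb]_(x in `]0%R, 1%R[) (v%:E * g x) =
     v%:E * \int[leb]_(x in `]0%R, 1%R[) g x)%E.
  by move=> mg g0; rewrite ge0_integralZl_EFin ?(ltW v0)//; exact: measurable_funTS.
rewrite -pull.
- by apply: eq_integral => x _; rewrite addr0.
- by apply: (measurableT_comp mf); apply: measurable_funD => //; exact: measurable_funM.
- by move=> x.
Qed.

Let scaled_le v M x : 0 < v -> v <= M -> 0 < x -> x < 1 ->
  (scaled v x <=
   (arcsine_factor w1 b2 w2 M * ((Num.sqrt x)^-1 + (Num.sqrt (1 - x))^-1))%:E)%E.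
Proof.
move=> v0 vM x0 x1.
have vx : 0 < v * x by rewrite mulr_gt0.
have vx' : 0 < v - v * x by rewrite subr_gt0 gtr_pMr.
apply: (@le_trans _ _ (v%:E * ((Num.sqrt (2 * pi * (w1 ^+ 2 * (v * x))))^-1 *
   g_hat_mass b2 w2 (v - v * x))%:E)%E); last first.
  by rewrite -EFinM lee_fin; exact: scaled_switch_density_bound.
apply: lee_wpmul2l; first by rewrite lee_fin ltW.
rewrite -[leRHS]mul1e; apply: lee_pmul.
- by rewrite lee_fin expR_ge0.
- exact: switch_density_nneg.
- by rewrite lee_fin -expR0 ler_expR oppr_le0 mulr_ge0 ?(ltW eta0)// ltW.
- exact: switch_density_le.
Qed.

Lemma switch_passage_density_ge0 v : (0 <= K v)%E.
Proof.
apply: integral_ge0 => tau _; rewrite mule_ge0 ?lee_fin ?expR_ge0//.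
exact: switch_density_nneg.
Qed.

Lemma cvg_switch_passage_density (t : R) (t_ : nat -> R) : 0 < t -> (forall n, 0 < t_ n) ->
  (forall n, t_ n <= 2 * t) -> t_ @ \oo --> t -> K (t_ n) @[n --> \oo] --> K t.
Proof.
move=> t0 tp tM tt; rewrite passage_scaled//; under eq_fun do rewrite passage_scaled//.
have := @dominated_cvg _ (measurableTypeR R) R leb `]0, 1[%classic (measurable_itv _)
  (fun n x => scaled (t_ n) x) (scaled t)
  (fun x => (arcsine_factor w1 b2 w2 (2 * t) * ((Num.sqrt x)^-1 + (Num.sqrt (1 - x))^-1))%:E).
apply.
- by move=> n; apply: measurable_funTS; exact: mscaled.
- move=> x /=; rewrite in_itv/= => /andP[x0 x1].
  have tx : t_ n * x @[n --> \oo] --> t * x by apply: cvgM => //; exact: cvg_cst.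
  have kx : k (t_ n * x) (t_ n - t_ n * x) @[n --> \oo] --> k (t * x) (t - t * x).
    apply: cvg_switch_density => //.
    + by rewrite mulr_gt0.
    + by rewrite subr_gt0 gtr_pMr.
    + by move=> n; rewrite mulr_gt0.
    + by move=> n; rewrite subr_gt0 gtr_pMr.
    + exact: cvgB.
  have kf : k (t * x) (t - t * x) \is a fin_num.
    by apply: switch_density_fin_num => //; [rewrite mulr_gt0|rewrite subr_gt0 gtr_pMr].
  apply: cvgeM; [by apply: mule_def_fin => //; rewrite fin_numM| |].
    by apply: cvg_EFin => //; exact: nearW.
  apply: cvgeM => //; first by apply: mule_def_fin.
  apply: cvg_EFin; first exact: nearW.
  apply: continuous_cvg; first exact: continuous_expR.
  by apply: cvgN; apply: cvgM => //; exact: cvg_cst.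
- by [].
- exact: integrable_arcsine_bound.
- move=> n x /=; rewrite in_itv/= => /andP[x0 x1].
  by rewrite gee0_abs ?scaled_ge0//; exact: scaled_le.
Qed.

Lemma switch_passage_density_fin_num t : 0 < t -> K t \is a fin_num.
Proof.
move=> t0; rewrite ge0_fin_numE ?switch_passage_density_ge0//.
rewrite passage_scaled//.
apply: (@le_lt_trans _ _ (\int[leb]_(x in `]0%R, 1%R[)
    (arcsine_factor w1 b2 w2 t * ((Num.sqrt x)^-1 + (Num.sqrt (1 - x))^-1))%:E)%E).
  have /integrableP[mG _] := integrable_arcsine_bound (arcsine_factor w1 b2 w2 t).
  apply: ge0_le_integral => //.
  - by move=> x _; exact: scaled_ge0.
  - by apply: measurable_funTS; exact: mscaled.
  - by move=> x /=; rewrite in_itv/= => /andP[x0 x1]; exact: scaled_le.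
by apply: integrable_lty => //; exact: integrable_arcsine_bound.
Qed.

Lemma continuous_switch_passage_density t : 0 < t -> {for t, continuous (fun v => fine (K v))}.
Proof.
move=> t0; suff : fine (K v) @[v --> t] --> fine (K t) by [].
apply/(@cvg_nbhsP _ R^o) => u ut.
(* Clamping to [t / 2, 2 t] makes positivity and the upper bound hold for every n; the sequence is
   unchanged from some rank on. *)
pose u' n := Num.min (Num.max (u n) (t / 2)) (2 * t).
have uu' : \forall n \near \oo, u n = u' n.
  near=> n; have u1 : t / 2 < u n.
    by near: n; apply: (cvgr_gt t ut); rewrite ltr_pdivrMr// ltr_pMr// ltr1n.
  have u2 : u n < 2 * t by near: n; apply: (cvgr_lt t ut); rewrite ltr_pMl// ltr1n.
  by rewrite /u' max_l ?(ltW u1)// min_l// ltW.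
have u't : u' n @[n --> \oo] --> t by apply: cvg_trans ut; exact: near_eq_cvg.
have : fine (K (u' n)) @[n --> \oo] --> fine (K t).
  apply: fine_cvg; rewrite fineK ?switch_passage_density_fin_num//.
  apply: cvg_switch_passage_density => // n; last by rewrite ge_min lexx orbT.
  rewrite lt_min mulr_gt0// andbT lt_max; apply/orP; right.
  by rewrite divr_gt0.
apply: cvg_trans; apply: near_eq_cvg.
by apply: filterS uu' => n ->.
Unshelve. all: by end_near. Qed.
End switch_passage.

(** * The first-passage density *)

(** The fundamental theorem asks for integrability slightly beyond [t], so a bound [M] past [t] is
    given, and [N] between them yields a closed end inside the open interval. *)
Lemma is_derive_integral R (J : R -> \bar R) (t M : R) : 0 < t -> t < M ->
  (forall x, 0 < x -> (J x \is a fin_num) && (0 <= J x)%E) ->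
  measurable_fun (`]0, M[%classic : set R) J ->
  (\int[leb]_(x in `]0%R, M[) J x < +oo)%E ->
  {for t, continuous (fun x => fine (J x))} ->
  is_derive t 1 (fun x => fine (\int[leb]_(s in `]0%R, x[) J s)%E) (fine (J t)).
Proof.
move=> t0 tM J0 mJ Joo cJ.
have [N tN NM] : exists2 N, t < N & N < M by exists ((t + M) / 2); lra.
have JfE x : 0 < x -> ((fine (J x))%:E = J x)%E.
  by move=> x0; case/andP: (J0 x x0) => xf _; rewrite fineK.
have mfJ x : x < M -> measurable_fun (`]0, x]%classic : set R) (fun s => (fine (J s))%:E).
  move=> xM; apply: (eq_measurable_fun J).
    by move=> s; rewrite inE/= in_itv/= => /andP[s0 _]; rewrite JfE.
  apply: measurable_funS mJ => // s /=; rewrite !in_itv/= => /andP[-> sx].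
  exact: le_lt_trans xM.
have iN : leb.-integrable (`]0, N]%classic : set R) (EFin \o (fun s => fine (J s))).
  apply/integrableP; split; first exact: mfJ.
  apply: le_lt_trans Joo.
  apply: (@le_trans _ _ (\int[leb]_(s in `]0%R, N]) J s)%E).
    rewrite le_eqVlt; apply/orP; left; apply/eqP; apply: eq_integral => s /=.
    rewrite inE/= in_itv/= => /andP[s0 _]; case/andP: (J0 s s0) => sf sp.
    by rewrite ger0_norm ?fine_ge0// JfE.
  apply: ge0_subset_integral => //.
  - by move=> s /=; rewrite in_itv/= => /andP[s0 _]; case/andP: (J0 s s0).
  - by move=> s /=; rewrite !in_itv/= => /andP[-> sN]; exact: le_lt_trans NM.
have b0 : (BRight 0 < BRight t :> itv_bound R)%O by rewrite bnd_simp.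
have [dF FE] := @continuous_FTC1 R (fun s => fine (J s)) (BRight 0) t N tN iN b0 cJ.
have EF x : x < M -> fine (\int[leb]_(s in `]0%R, x[) J s)%E =
    (\int[leb]_(s in [set` Interval (BRight 0) (BRight x)]) fine (J s))%R.
  move=> xM; rewrite /Rintegral; congr fine.
  rewrite -(@integral_itv_bndo_bndc _ _ _ (fun s => (fine (J s))%:E))//; last first.
    by apply: measurable_funS (mfJ x xM) => //; apply: subset_itvl; rewrite bnd_simp.
  by apply: eq_integral => s; rewrite inE/= in_itv/= => /andP[s0 _]; rewrite JfE.
have d : is_derive t 1 (fun x => \int[leb]_(s in [set` Interval (BRight 0) (BRight x)])
    fine (J s))%R (fine (J t)).
  by apply: DeriveDef; [exact: dF|rewrite -derive1E; exact: FE].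
apply: near_eq_is_derive d; near=> x; rewrite EF//; near: x; exact: lt_nbhsl.
Unshelve. all: by end_near. Qed.

Lemma is_derive_survival_fun R (b w t x : R) : w != 0 -> 0 < t -> 0 <= x ->
  is_derive t 1 (fun s => survival b w s x) (- g_hat b w t x).
Proof.
move=> w0 t0 x0; apply: near_eq_is_derive (is_derive_survival b x w0 t0).
near=> s; have s0 : 0 < s by near: s; exact: lt_nbhsr.
by apply: EFin_inj; rewrite survival_killed// killed_one_cdf.
Unshelve. all: by end_near. Qed.

Lemma two_phase_survival_ge R (b1 w1 b2 w2 t x s : R) : s <= 0 ->
  two_phase_survival b1 w1 b2 w2 t x s = (survival b2 w2 t x)%:E.
Proof. by rewrite /two_phase_survival => ->. Qed.

Lemma two_phase_survival_le R (b1 w1 b2 w2 t x s : R) : 0 < s -> t <= s ->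
  two_phase_survival b1 w1 b2 w2 t x s = (survival b1 w1 t x)%:E.
Proof. by move=> s0 ts; rewrite /two_phase_survival leNgt s0/= ts. Qed.

(** * Differentiation of the distribution function, known from here on only through [cdfE] *)

Section assembly.
Variables (R : realType) (b1 w1 b2 w2 eta p y : R) (cdf : R -> R).
Hypotheses (w10 : w1 != 0) (w20 : w2 != 0) (eta0 : 0 < eta) (y0 : 0 < y).
Hypothesis cdfE : forall t, 0 < t ->
  (1 - cdf t)%:E =
  ((1 - p)%:E * two_phase_survival b1 w1 b2 w2 t y 0 +
   (p * expR (- (eta * t)))%:E * two_phase_survival b1 w1 b2 w2 t y t +
   p%:E * \int[leb]_(s in `]0%R, t[)
     ((eta * expR (- (eta * s)))%:E * two_phase_survival b1 w1 b2 w2 t y s))%E.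

Local Notation K := (switch_passage_density b1 w1 b2 w2 eta y).
Let J (s : R) : \bar R := (eta * expR (- (eta * s)) * survival b1 w1 s y)%:E.

Let J_ge0 s : (0 <= J s)%E.
Proof.
have /andP[s0 _] := survival_itv b1 w10 s y.
by rewrite lee_fin mulr_ge0// mulr_ge0 ?expR_ge0// ltW.
Qed.

Let J_le s : 0 < s -> (J s <= eta%:E)%E.
Proof.
move=> s0; have /andP[S0 S1] := survival_itv b1 w10 s y.
rewrite lee_fin -mulrA ler_piMr ?(ltW eta0)// mulr_ile1 ?expR_ge0//.
by rewrite -expR0 ler_expR oppr_le0 mulr_ge0// ltW.
Qed.

Let J_continuous t : 0 < t -> {for t, continuous (fun s => fine (J s))}.
Proof.
move=> t0; suff : fine (J s) @[s --> t] --> fine (J t) by [].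
apply/(@cvg_nbhsP _ R^o) => u ut /=; apply: cvgM.
  apply: cvgM; first exact: cvg_cst.
  apply: continuous_cvg; first exact: continuous_expR.
  by apply: cvgN; apply: cvgM => //; exact: cvg_cst.
by apply: cvg_survival => //; exact: cvg_cst.
Qed.

Let mJ M : measurable_fun (`]0, M[%classic : set R) J.
Proof.
apply: (eq_measurable_fun (EFin \o (fun s => fine (J s)))) => //.
apply/measurable_EFinP; apply: open_continuous_measurable_fun; first exact: itv_open.
by move=> s; rewrite inE/= in_itv/= => /andP[s0 _]; exact: J_continuous.
Qed.

Let integral_J_lty M : (\int[leb]_(s in `]0%R, M[) J s < +oo)%E.
Proof.
apply: (@le_lt_trans _ _ (\int[leb]_(s in `]0%R, M[) (cst eta%:E s))%E).
  apply: ge0_le_integral => //.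
  - exact: mJ.
  - by move=> s /=; rewrite in_itv/= => /andP[s0 _]; exact: J_le.
rewrite integral_cst//= lebesgue_measure_itv/=.
by case: ifP => _; rewrite ?mule0 ?ltry// -EFinB -EFinM ltry.
Qed.

Let passage_split t : 0 < t ->
  (\int[leb]_(s in `]0%R, t[)
     ((eta * expR (- (eta * s)))%:E * two_phase_survival b1 w1 b2 w2 t y s) +
   eta%:E * \int[leb]_(v in `]0%R, t[) K v =
   \int[leb]_(s in `]0%R, t[) J s)%E.
Proof.
move=> t0; rewrite -(integral_killed_survival b1 b2 w10 w20 eta0 y0 t0); congr (_ + _)%E.
apply: eq_integral => s; rewrite inE/= in_itv/= => /andP[s0 st].
by rewrite /two_phase_survival leNgt s0/= leNgt st.
Qed.

Let integral_tps_ge0 t : (0 <= \int[leb]_(s in `]0%R, t[)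
     ((eta * expR (- (eta * s)))%:E * two_phase_survival b1 w1 b2 w2 t y s))%E.
Proof.
apply: integral_ge0 => s _; have /andP[h _] := two_phase_survival_itv b1 b2 t w10 w20 s (ltW y0).
by rewrite mule_ge0// lee_fin mulr_ge0 ?expR_ge0// ltW.
Qed.

Let integral_K_ge0 t : (0 <= \int[leb]_(v in `]0%R, t[) K v)%E.
Proof. by apply: integral_ge0 => v _; exact: switch_passage_density_ge0. Qed.

(** Finiteness comes from the mass balance: eta times this integral is at most the integral of [J],
    and [J] is at most eta. *)
Let integral_K_lty t : 0 < t -> (\int[leb]_(v in `]0%R, t[) K v < +oo)%E.
Proof.
move=> t0; have := integral_J_lty t; rewrite -passage_split// => H.
have : (eta%:E * \int[leb]_(v in `]0%R, t[) K v < +oo)%E.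
  by apply: le_lt_trans H; rewrite leeDr.
case: (\int[leb]_(v in `]0%R, t[) K v)%E (integral_K_ge0 t) => [r| |]//=.
  by move=> _ _; rewrite ltry.
by move=> _; rewrite gt0_muley// lte_fin.
Qed.

(* The two-phase integral is not differentiated directly: [integral_killed_survival] trades it
   for integrals whose integrands do not depend on [t]. *)
Let cdf_explicit t : 0 < t -> cdf t =
  1 - (1 - p) * survival b2 w2 t y - p * (expR (- (eta * t)) * survival b1 w1 t y)
    - p * fine (\int[leb]_(s in `]0%R, t[) J s)%E
    + p * eta * fine (\int[leb]_(v in `]0%R, t[) K v)%E.
Proof.
move=> t0.
have Kf : (\int[leb]_(v in `]0%R, t[) K v)%E \is a fin_num.
  by rewrite ge0_fin_numE// integral_K_lty.
have Jf : (\int[leb]_(s in `]0%R, t[) J s)%E \is a fin_num.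
  rewrite ge0_fin_numE ?integral_J_lty//; apply: integral_ge0 => s _; exact: J_ge0.
have := passage_split t0; have := cdfE t0.
rewrite two_phase_survival_ge// two_phase_survival_le// => E1 E2.
have Af : (\int[leb]_(s in `]0%R, t[)
     ((eta * expR (- (eta * s)))%:E * two_phase_survival b1 w1 b2 w2 t y s))%E \is a fin_num.
  rewrite ge0_fin_numE//; apply: le_lt_trans (integral_J_lty t); rewrite -E2 leeDl//.
  by rewrite mule_ge0// lee_fin ltW.
move: E1 E2; rewrite -(fineK Af) -(fineK Kf) -(fineK Jf) -!EFinM -!EFinD.
rewrite /= => -[E1] [E2]; have -> : cdf t = 1 - (1 - cdf t) by ring.
by rewrite E1 -E2; ring.
Qed.

Let mK M : measurable_fun (`]0, M[%classic : set R) K.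
Proof.
pose F s v := ((expR (- (eta * s)))%:E * switch_density b1 w1 b2 w2 y s (v - s)%R)%E.
apply: (@measurable_integral_upper _ _ F); last first.
  by move=> s v; rewrite mule_ge0 ?switch_density_nneg// lee_fin expR_ge0.
apply: emeasurable_funM.
  apply/measurable_EFinP; apply: measurableT_comp => //; apply: measurableT_comp => //.
  exact: measurable_funM.
apply: measurable_switch_density => //.
by apply: measurable_funB; [exact: measurable_snd|exact: measurable_fst].
Qed.

(** Differentiating exp(-eta t) in the unswitched term yields p J(t), which the derivative of the
    integral of [J] cancels; only the three passage terms remain. *)
Lemma is_derive_first_passage (t : R) : 0 < t ->
  is_derive t 1 cdf (p * expR (- (eta * t)) * g_hat b1 w1 t y + (1 - p) * g_hat b2 w2 t y +
    eta * p * fine (K t)).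
Proof.
move=> t0; have tM : t < t + 1 by rewrite ltrDl.
have M0 : 0 < t + 1 by rewrite addr_gt0.
have J0 x : 0 < x -> (J x \is a fin_num) && (0 <= J x)%E by rewrite J_ge0.
have K0 x : 0 < x -> (K x \is a fin_num) && (0 <= K x)%E.
  by move=> x0; rewrite switch_passage_density_fin_num// switch_passage_density_ge0.
have cK : {for t, continuous (fun x => fine (K x))} by exact: continuous_switch_passage_density.
have dJ := @is_derive_integral R J t _ t0 tM J0 (@mJ _) (integral_J_lty _) (J_continuous t0).
have dK := @is_derive_integral R K t _ t0 tM K0 (@mK _) (integral_K_lty M0) cK.
have d1 := is_derive_survival_fun b1 w10 t0 (ltW y0).
have d2 := is_derive_survival_fun b2 w20 t0 (ltW y0).
have dE : is_derive t 1 (fun s => expR (- (eta * s))) (expR (- (eta * t)) * - eta).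
  have dl : is_derive t 1 (fun s : R => - (eta * s)) (- eta).
    have := is_deriveN (is_deriveZ eta (is_derive_id t (1 : R))).
    by rewrite /GRing.scale /= mulr1.
  exact: (@is_derive1_comp _ expR (fun s => - (eta * s)) t _ _ (is_derive_expR _) dl).
have dS := is_deriveD (is_deriveB (is_deriveB (is_deriveB (is_derive_cst (1 : R) t 1)
  (is_deriveZ (1 - p) d2)) (is_deriveZ p (is_deriveM dE d1))) (is_deriveZ p dJ))
  (is_deriveZ (p * eta) dK).
have {}dS := is_derive_eq dS (_ : _ = p * expR (- (eta * t)) * g_hat b1 w1 t y +
  (1 - p) * g_hat b2 w2 t y + eta * p * fine (K t)).
apply: near_eq_is_derive (dS _); last by rewrite /GRing.scale /=; ring.
by near=> s; rewrite cdf_explicit//; near: s; exact: lt_nbhsr.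
Unshelve. all: by end_near. Qed.
End assembly.

Theorem proposition9 (R : realType) (d : measure_display)
  (T : measurableType d) (P : probability T R)
  (lambda mu omega eta : env -> R) (p y : R)
  (X : R -> T -> R) (E : R -> T -> env)
  (hlambda : forall i, 0 < lambda i) (hmu : forall i, 0 < mu i)
  (homega : forall i, 0 < omega i ^+ 2)
  (heta1 : 0 < eta env1) (heta2 : eta env2 = 0)
  (hp : 0 <= p <= 1) (hy : 0 < y)
  (hXE : alternating_wiener_process P lambda mu omega eta p y X E) :
  let beta i := lambda i - mu i in
  let k := derive1 (first_passage_cdf P X E) in
  forall t : R, 0 < t ->
    derivable (first_passage_cdf P X E) t 1 /\
    (k t)%:E =
      ((p * expR (- (eta env1 * t)) * g_hat (beta env1) (omega env1) t y)%:E
       + ((1 - p) * g_hat (beta env2) (omega env2) t y)%:E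
       + (eta env1 * p)%:E *
         \int[lebesgue_measure]_(z in `]0%R, +oo[)
           \int[lebesgue_measure]_(tau in `]0%R, t[)
             (expR (- (eta env1 * tau))
              * alpha_hat (beta env1) (omega env1) z tau y
              * g_hat (beta env2) (omega env2) (t - tau) z)%:E)%E.
Proof.
move=> beta k t t0; have [W [L [hE hW indep hX]]] := hXE.
have w0 i : omega i != 0 by have := homega i; rewrite lt0r sqrf_eq0 => /andP[].
have cdfE := first_passage_survival (w0 env1) (w0 env2) heta1 heta2 hp hy hE (hW env1) (hW env2) indep hX.
have dcdf := is_derive_first_passage (w0 env1) (w0 env2) heta1 hy cdfE t0.
split; first exact: ex_derive.
rewrite /k derive1E derive_val -switch_passage_densityE//.
(* The double integral of the statement is an extended real; its finiteness identifies it with the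
   real derivative. *)
by rewrite -[in RHS](fineK (switch_passage_density_fin_num _ _ _ _ _ _ t0)).
Qed.
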